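(* Let $\Omega$ be a bounded measurable set in $\mathbb{R}^d$ of positive Lebesgue measure $m(\Omega)$. If $\Omega$ is spectral, then there exists a Borel measure $\gamma$ on $\mathbb{R}^d$ such that: (a) $\gamma$ is a positive, translation-bounded measure; (b) the support of $\gamma$ is contained in the closed set $Z(\Omega)\cup\{0\}$, where $Z(\Omega)=\{t\in\mathbb{R}^d:\widehat{\mathbf{1}_\Omega}(t)=0\}$; (c) $\gamma=\delta_0$ in some open neighborhood of the origin; (d) the Fourier transform $\widehat{\gamma}$ is also a positive, translation-bounded measure; (e) $\widehat{\gamma}=m(\Omega)\,\delta_0$ in the open set $\Delta(\Omega)=\{x\in\mathbb{R}^d: m(\Omega\cap(\Omega+x))>0\}$.
   Context: $\Omega$ is spectral if there is a countable set $\Lambda\subset\mathbb{R}^d$ such that the exponentials $e^{2\pi i\langle\lambda,x\rangle}$, $\lambda\in\Lambda$, form an orthogonal basis of $L^2(\Omega)$. The Fourier transform is $\widehat f(t)=\int f(x)e^{-2\pi i\langle t,x\rangle}dx$, extended to tempered distributions by duality. A measure $\mu$ is translation-bounded if $\sup_{x}|\mu|(B+x)<\infty$ for some (equivalently every) open ball $B$; such measures are tempered distributions. $\delta_0$ is the unit point mass at the origin. *)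

(* Defs.v *)
From HB Require Import structures.
From mathcomp Require Import all_boot all_order all_algebra.
From mathcomp Require Import all_classical all_reals all_analysis.
Import Order.TTheory GRing.Theory Num.Theory.
Import numFieldNormedType.Exports.

Set Implicit Arguments.
Unset Strict Implicit.
Unset Printing Implicit Defensive.

Local Open Scope classical_set_scope.
Local Open Scope ring_scope.

Section Defs.
Variables (R : realType) (d : nat).

Local Notation Rd := 'rV[R]_d.

Definition dotv (x t : Rd) : R := \sum_(i < d) x 0 i * t 0 i.
Definition normsq (x : Rd) : R := dotv x x.

Definition eball (x : Rd) (r : R) : set Rd := [set y | normsq (y - x) < r ^+ 2].

Definition box (a b : Rd) : set Rd := [set x | forall i, a 0 i <= x 0 i <= b 0 i].
Definition vol (a b : Rd) : R := \prod_(i < d) Num.max (b 0 i - a 0 i) 0.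

Definition leb_outer (S : set Rd) : \bar R :=
  ereal_inf [set s | exists a b : nat -> Rd,
      S `<=` \bigcup_k box (a k) (b k) /\
      s = (\sum_(k <oo) ((vol (a k) (b k))%:E))%E].

Definition leb_sets : set (set Rd) :=
  [set S | forall T, leb_outer T = (leb_outer (T `&` S) + leb_outer (T `&` ~` S))%E].

Definition RdLeb := g_sigma_algebraType leb_sets.
Definition RdBorel := g_sigma_algebraType (fun A : set 'rV[R]_d => open A).

Definition is_lebesgue (leb : {measure set RdLeb -> \bar R}) : Prop :=
  forall S : set RdLeb, measurable S -> leb S = leb_outer S.

(** Fourier transform of the indicator of Om:
    hat(1_Om)(t) = int_Om e^{-2 pi i <t,x>} dx
    (real part, imaginary part). *)
Definition ft_ind_re (leb : {measure set RdLeb -> \bar R}) (Om : set Rd) (t : Rd) : R :=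
  Rintegral leb Om (fun x : RdLeb => cos (2 * pi * dotv t x)).
Definition ft_ind_im (leb : {measure set RdLeb -> \bar R}) (Om : set Rd) (t : Rd) : R :=
  - Rintegral leb Om (fun x : RdLeb => sin (2 * pi * dotv t x)).

Definition Zset leb (Om : set Rd) : set Rd :=
  [set t | ft_ind_re leb Om t = 0 /\ ft_ind_im leb Om t = 0].

Definition Deltaset (leb : {measure set RdLeb -> \bar R}) (Om : set Rd) : set Rd :=
  [set x | (0 < leb (Om `&` [set (y + x)%R | y in Om]))%E].

(** Spectrality.  Complex-valued functions are represented by their real and
    imaginary parts.  The exponential e_l(x) = e^{2 pi i <l,x>}. *)
Definition L2 (leb : {measure set RdLeb -> \bar R}) (Om : set Rd) (f g : Rd -> R) : Prop :=
  measurable_fun (Om : set RdLeb) (f : RdLeb -> R) /\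
  measurable_fun (Om : set RdLeb) (g : RdLeb -> R) /\
  (\int[leb]_(x in Om) ((f x) ^+ 2 + (g x) ^+ 2)%:E < +oo)%E.

(** Finite linear combination  sum_k c_k e_{l_k}, c_k = p_k + i q_k,
    real and imaginary parts. *)
Definition lincomb_re (s : seq (Rd * (R * R))) (x : Rd) : R :=
  \sum_(c <- s) (c.2.1 * cos (2 * pi * dotv c.1 x) - c.2.2 * sin (2 * pi * dotv c.1 x)).
Definition lincomb_im (s : seq (Rd * (R * R))) (x : Rd) : R :=
  \sum_(c <- s) (c.2.1 * sin (2 * pi * dotv c.1 x) + c.2.2 * cos (2 * pi * dotv c.1 x)).

Definition orthogonal_basis_exp (leb : {measure set RdLeb -> \bar R}) (Om : set Rd)
    (Lam : set Rd) : Prop :=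
  (forall l mu, Lam l -> Lam mu -> l <> mu ->
     (* <e_l, e_mu> = int_Om e^{2 pi i <l - mu, x>} dx = 0 *)
     Rintegral leb Om (fun x : RdLeb => cos (2 * pi * dotv (l - mu) x)) = 0 /\
     Rintegral leb Om (fun x : RdLeb => sin (2 * pi * dotv (l - mu) x)) = 0) /\
  (forall f g : Rd -> R, L2 leb Om f g ->
     forall eps : R, 0 < eps ->
     exists s : seq (Rd * (R * R)), (forall c, c \in s -> Lam c.1) /\
       (\int[leb]_(x in Om) ((f x - lincomb_re s x) ^+ 2
                             + (g x - lincomb_im s x) ^+ 2)%:E < (eps ^+ 2)%:E)%E).

Definition spectral (leb : {measure set RdLeb -> \bar R}) (Om : set Rd) : Prop :=
  exists Lam : set Rd, countable Lam /\ orthogonal_basis_exp leb Om Lam.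

Definition translation_bounded (mu : {measure set RdBorel -> \bar R}) : Prop :=
  exists C : R, forall x : Rd, (mu (eball x 1) <= C%:E)%E.

Definition msupport (mu : {measure set RdBorel -> \bar R}) : set Rd :=
  [set x | forall U : set 'rV[R]_d, open U -> U x -> (0 < mu U)%E].

Definition eq_dirac_on (mu : {measure set RdBorel -> \bar R}) (c : \bar R) (U : set Rd) : Prop :=
  forall A : set RdBorel, measurable A -> A `<=` U ->
    mu A = (c * (\1_A (0 : Rd))%:E)%E.

Definition pderiv (j : 'I_d) (f : Rd -> R) : Rd -> R :=
  fun a => derive (f : 'rV[R]_d -> R) a 'e_j.
Definition iter_pderiv (js : seq 'I_d) (f : Rd -> R) : Rd -> R :=
  foldr pderiv f js.

Definition schwartz (f : Rd -> R) : Prop :=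
  (forall (js : seq 'I_d) (a : Rd) (j : 'I_d),
      derivable (iter_pderiv js f : 'rV[R]_d -> R) a 'e_j) /\
  (forall (js : seq 'I_d) (k : nat), exists C : R, forall x : Rd,
      (1 + normsq x) ^+ k * `|iter_pderiv js f x| <= C).

(** Fourier transform of the complex Schwartz function phi = u + i v:
    hat(phi)(t) = int phi(x) e^{-2 pi i <t,x>} dx. *)
Definition ft_re (leb : {measure set RdLeb -> \bar R}) (u v : Rd -> R) (t : Rd) : R :=
  Rintegral leb setT (fun x : RdLeb =>
    u x * cos (2 * pi * dotv t x) + v x * sin (2 * pi * dotv t x)).
Definition ft_im (leb : {measure set RdLeb -> \bar R}) (u v : Rd -> R) (t : Rd) : R :=
  Rintegral leb setT (fun x : RdLeb =>
    v x * cos (2 * pi * dotv t x) - u x * sin (2 * pi * dotv t x)).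

(** nu is the (distributional) Fourier transform of gam:
    <nu, phi> = <gam, hat(phi)> for every complex Schwartz function phi. *)
Definition is_fourier_of (leb : {measure set RdLeb -> \bar R})
    (gam nu : {measure set RdBorel -> \bar R}) : Prop :=
  forall u v : Rd -> R, schwartz u -> schwartz v ->
    Rintegral nu setT (u : RdBorel -> R) = Rintegral gam setT (ft_re leb u v : RdBorel -> R) /\
    Rintegral nu setT (v : RdBorel -> R) = Rintegral gam setT (ft_im leb u v : RdBorel -> R).

End Defs.

(* Main.v *)
(** Let [Lam] be a spectrum of [Om], [m] the measure of [Om] and [f x] that of [Om & (Om + x)].
    Since [Lam] is separated and Parseval's identity holds with uniformly small tails, there are
    finite sets [s] in [Lam], of Folner type, such that the sum over [l, l'] in [s] of
    [|hat 1_Om (l + v - l')|^2] is at least [(m^2 - eta) #s] for all small [v].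
    Let [gam_s] be [1 / #s] times the sum of the unit masses at the differences [l - l'], and let
    [nu_s] have density [|sum_(l in s) e_l|^2 / #s]; it is the Fourier transform of [gam_s].
    By orthogonality the integral of [f] against any translate of [nu_s] is [m^2], which bounds
    [nu_s] uniformly on unit balls; by the Folner property the mass that [f nu_s] has away from
    the origin is [O(eta)]. Vague limits along an ultrafilter give [gam] and [nu], and their
    Fourier duality survives because Schwartz functions decay fast enough. *)

Require Import Defs.
From HB Require Import structures.
From mathcomp Require Import all_boot all_order all_algebra.
From mathcomp Require Import all_classical all_reals all_analysis.
From mathcomp Require Import measurable_realfun ring lra.
Import Order.TTheory GRing.Theory Num.Theory.
Import numFieldNormedType.Exports.
Local Open Scope classical_set_scope.
Local Open Scope ring_scope.

Set Implicit Arguments.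
Unset Strict Implicit.
Unset Printing Implicit Defensive.

(** Completeness sums over all of [Lam], whereas a finite [s] sees only its own differences. This is
    the obstacle behind the Folner condition: inner points of [s] recover [m^2] up to a tail, and
    the boundary is a small fraction of [s]. The shift [v] enters because the integral of
    [cos (2 pi <v, x>)] against [f nu_s] is the double sum divided by [#s]. A double sum close to
    its maximum [m^2 #s] makes [1 - cos (2 pi <v, x>)] small in mean for [f nu_s], and finitely many
    [v] detect every point of the bounded support of [f] that is away from the origin. The mass
    [m^2] is thus left to the origin, where [f = m]; this is the source of the constant in (e). A
    second obstacle: [Om] is measurable for the sigma-algebra of the outer measure, while [gam] and
    [nu] are Borel. [Om] is replaced by a Borel hull of the same measure, and the argument runs with
    the Borel restriction of the Lebesgue measure, through translation invariance, finiteness on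
    bounded sets and continuity of translations in measure. *)

Notation borel_set A := (measurable (A : set (RdBorel _ _))).
Notation translation_invariant mu :=
  (forall (A : set 'rV_ _) (x : 'rV_ _), borel_set A -> mu [set y | A (y + x)%R] = mu A).
Notation shift_continuous mu Om := (forall e, 0 < e -> exists2 del, 0 < del &
  forall v, `|v| < del -> (mu (Om `\` [set y | Om (y + v)%R]) <= e%:E)%E).

(** * The sup norm of row vectors and Borel measurability *)

Section RowVectors.
Variables (R : realType) (d : nat).
Local Notation Rd := 'rV[R]_d.
Local Notation Bd := (RdBorel R d).

Lemma le_coord_norm (x : Rd) i : `|x 0 i| <= `|x|.
Proof.
rewrite [leRHS]/Num.norm/= mx_normrE.
exact: (le_bigmax _ (fun ij : 'I_1 * 'I_d => `|x ij.1 ij.2|) (0, i)).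
Qed.

Lemma norm_ltP (x : Rd) e : 0 < e -> (`|x| < e) <-> (forall i, `|x 0 i| < e).
Proof.
move=> e0; split=> [xe i|xe]; first exact: le_lt_trans (le_coord_norm _ _) xe.
rewrite [ltLHS]/Num.norm/= mx_normrE; apply/bigmax_ltP; split=> //= -[i j] _ /=.
by rewrite ord1.
Qed.

Lemma norm_leP (x : Rd) e : 0 <= e -> (`|x| <= e) <-> (forall i, `|x 0 i| <= e).
Proof.
move=> e0; split=> [xe i|xe]; first exact: le_trans (le_coord_norm _ _) xe.
rewrite [leLHS]/Num.norm/= mx_normrE; apply/bigmax_leP; split=> //= -[i j] _ /=.
by rewrite ord1.
Qed.

Lemma norm_geP (x : Rd) e : 0 < e -> e <= `|x| -> exists i, e <= `|x 0 i|.
Proof.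
move=> e0 ex; apply: contrapT => /forallNP H.
have : `|x| < e by apply/norm_ltP => // i; rewrite ltNge; apply/negP/H.
by rewrite ltNge ex.
Qed.

Lemma ball_norm (x y : Rd) e : ball x e y <-> `|x - y| < e.
Proof. by rewrite mx_norm_ball. Qed.

Lemma rat_vector_dense (x : Rd) e : 0 < e ->
  exists q : 'rV[rat]_d, `|x - map_mx ratr q| < e.
Proof.
move=> e0.
have H i : exists q : rat, x 0 i - e < ratr q < x 0 i + e.
  have /rat_in_itvoo[q] : x 0 i - e < x 0 i + e by rewrite ltrBlDr -addrA ltrDl addr_gt0.
  by rewrite in_itv/= => ?; exists q.
have [q Hq] := choice H.
exists (\row_i q i); apply/norm_ltP => // i; rewrite !mxE.
by rewrite ltr_distlC; have := Hq i; case/andP=> -> ->.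
Qed.

(** An open set is a countable union of sup-norm balls with rational centres and radii
    [1 / (n + 1)], and each such ball is an intersection of coordinate strips. The domain is
    arbitrary because the lemma serves both the identity of [RdLeb] and addition on [Bd * Bd]. *)
Lemma measurable_preimage_open d' (T : measurableType d') (g : T -> Rd) :
  (forall i, measurable_fun setT (fun x => g x 0 i)) ->
  forall U : set Rd, open U -> measurable (g @^-1` U).
Proof.
move=> mg U oU.
pose D (qn : 'rV[rat]_d * nat) : set T :=
  if `[< ball (map_mx ratr qn.1 : Rd) (qn.2.+1%:R^-1) `<=` U >] then
  g @^-1` (ball (map_mx ratr qn.1 : Rd) (qn.2.+1%:R^-1)) else set0.
have -> : g @^-1` U = \bigcup_qn D qn.
  apply/seteqP; split=> [x Ux|x [qn _]]; last first.
    by rewrite /D; case: asboolP => // sU; exact: sU.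
  have /nbhs_ballP[e /= e0 eU] := oU _ Ux.
  have [n ne] : exists n, n.+1%:R^-1 < e / 2.
    by exists (Num.truncn (e/2)^-1); rewrite invf_plt ?posrE ?divr_gt0// truncnS_gt.
  have [q qx] := @rat_vector_dense (g x) (n.+1%:R^-1) ltac:(by []).
  exists (q, n) => //; rewrite /D/=; case: asboolP => [_|]; last first.
    case=> z zq; apply: eU; apply/ball_norm; rewrite (splitr e).
    have -> : g x - z = (g x - map_mx ratr q) + (map_mx ratr q - z).
      by rewrite addrA subrK.
    apply: le_lt_trans (ler_normD _ _) _; apply: ltrD.
      exact: lt_trans qx ne.
    by move/ball_norm : zq => /lt_trans; apply.
  by apply/ball_norm; rewrite distrC.
apply: countable_bigcupT_measurable; first exact: countableP.
move=> [q n]; rewrite /D; case: ifPn => _ //=.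
have -> : g @^-1` ball (map_mx ratr q : Rd) n.+1%:R^-1 =
   \big[setI/setT]_(i <- index_enum 'I_d) [set x | g x 0 i \in `](ratr (q 0 i) - n.+1%:R^-1), (ratr (q 0 i) + n.+1%:R^-1)[ ].
  rewrite -bigcap_seq; apply/seteqP; split=> x /=.
    move=> /ball_norm /norm_ltP => /(_ ltac:(by [])) H i _; have := H i.
    by rewrite /= !mxE ltr_distlC in_itv/= => /andP[-> ->].
  move=> H; apply/ball_norm/norm_ltP => // i; have := H i (mem_index_enum _).
  by rewrite /= !mxE in_itv/= ltr_distlC.
apply: bigsetI_measurable => i _.
have := mg i measurableT `](ratr (q 0 i) - n.+1%:R^-1), (ratr (q 0 i) + n.+1%:R^-1)[%classic.
by rewrite setTI; apply; exact: measurable_itv.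
Qed.

Lemma measurable_fun_borel d' (T : measurableType d') (g : T -> Bd) :
  (forall U : set Rd, open U -> measurable (g @^-1` U)) -> measurable_fun setT g.
Proof.
move=> H; apply: (@measurability _ _ T Bd setT g (fun A : set Rd => open A) erefl).
by move=> _ [U oU <-]; rewrite setTI; exact: H.
Qed.

Lemma measurable_open (U : set Rd) : open U -> borel_set U.
Proof. exact: sub_sigma_algebra. Qed.

Lemma measurable_closed (U : set Rd) : closed U -> borel_set U.
Proof. by move=> ?; rewrite -(setCK U); apply: measurableC; apply: measurable_open; rewrite openC. Qed.

Lemma continuous_measurable (f : Rd -> R) : continuous f ->
  measurable_fun setT (f : Bd -> R).
Proof.
move=> cf; apply: (measurability _ (RGenOpens.measurableE R)).
move=> _ [_ [a [b ->]] <-]; rewrite setTI.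
apply: measurable_open; apply: (@open_comp _ _ f `]a,b[%classic) => // x _; exact: cf.
Qed.

Lemma measurable_coord i : measurable_fun setT ((fun x => x 0 i) : Bd -> R).
Proof. by apply: continuous_measurable => x; exact: coord_continuous. Qed.

End RowVectors.

(** * The Lebesgue outer measure: subadditivity, Caratheodory sets, translations *)

Section OuterMeasure.
Variables (R : realType) (d : nat).
Local Notation Rd := 'rV[R]_d.
Local Notation Bd := (RdBorel R d).
Implicit Types (a b x : Rd) (S T : set Rd).
Local Notation outer := (@leb_outer R d).

Lemma vol_ge0 a b : 0 <= vol a b.
Proof. by apply: prodr_ge0 => i _; rewrite le_max lexx orbT. Qed.

Lemma leb_outer_le T (a b : nat -> Rd) : T `<=` \bigcup_k box (a k) (b k) ->
  (outer T <= \sum_(k <oo) (vol (a k) (b k))%:E)%E.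
Proof. by move=> H; apply: ereal_inf_lbound; exists a, b. Qed.

Lemma le_leb_outer T (c : \bar R) :
  (forall a b : nat -> Rd, T `<=` \bigcup_k box (a k) (b k) ->
    (c <= \sum_(k <oo) (vol (a k) (b k))%:E)%E) -> (c <= outer T)%E.
Proof. by move=> H; apply: le_ereal_inf_tmp => _ [a [b [Tab ->]]]; exact: H. Qed.

Lemma leb_outer_ge0 T : (0 <= outer T)%E.
Proof.
by apply: le_leb_outer => a b _; apply: nneseries_ge0 => k _ _; rewrite lee_fin vol_ge0.
Qed.

Lemma leb_outer_approx T (e : R) : (outer T < +oo)%E -> 0 < e ->
  exists a b : nat -> Rd, T `<=` \bigcup_k box (a k) (b k) /\
    (\sum_(k <oo) (vol (a k) (b k))%:E <= outer T + e%:E)%E.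
Proof.
move=> Too e0; have fT : outer T \is a fin_num.
  by rewrite ge0_fin_numE// leb_outer_ge0.
have [s [a [b [Tab ->]]] /ltW slt] := lb_ereal_inf_adherent e0 fT.
by exists a, b.
Qed.

(** Two covers, each optimal up to [e / 2], are interleaved by parity. All terms being nonnegative,
    a partial sum of length [n] is at most the one of length [2 n], which splits exactly into the
    two covers. *)
Lemma leb_outerU S T : (outer (S `|` T) <= outer S + outer T)%E.
Proof.
have [->|Soo] := eqVneq (outer S) +oo%E.
  by rewrite addye ?leey// gt_eqF// (lt_le_trans _ (leb_outer_ge0 T))// ltNy0.
have [->|Too] := eqVneq (outer T) +oo%E.
  by rewrite addey ?leey// gt_eqF// (lt_le_trans _ (leb_outer_ge0 S))// ltNy0.
apply/lee_addgt0Pr => e e0; have e20 : 0 < e / 2 by rewrite divr_gt0.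
rewrite -!ltey in Soo Too.
have [a [b [Sab Sle]]] := leb_outer_approx Soo e20.
have [a' [b' [Tab Tle]]] := leb_outer_approx Too e20.
pose A k := if odd k then a k./2 else a' k./2.
pose B k := if odd k then b k./2 else b' k./2.
have AB : S `|` T `<=` \bigcup_k box (A k) (B k).
  move=> x [/Sab|/Tab] [k _ xk].
    by exists k.*2.+1 => //; rewrite /A /B/= odd_double/= uphalf_double.
  by exists k.*2 => //; rewrite /A /B/= odd_double/= doubleK.
have AE m : (\sum_(0 <= i < m.*2) (vol (A i) (B i))%:E =
    \sum_(0 <= k < m) (vol (a k) (b k))%:E + \sum_(0 <= k < m) (vol (a' k) (b' k))%:E)%E.
  elim: m => [|m IH]; first by rewrite !big_geq// adde0.
  rewrite doubleS !big_nat_recr//= IH.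
  rewrite /A /B/= odd_double/= uphalf_double doubleK -addeA.
  by rewrite [X in (_ + X = _)%E]addeC addeACA.
apply: (le_trans (leb_outer_le AB)).
apply: (@le_trans _ _ (\sum_(k <oo) (vol (a k) (b k))%:E + \sum_(k <oo) (vol (a' k) (b' k))%:E)%E).
  apply: lime_le.
    by apply: is_cvg_nneseries => k _ _; rewrite lee_fin vol_ge0.
  near=> n.
  apply: (@le_trans _ _ (\sum_(0 <= k < n) (vol (a k) (b k))%:E + \sum_(0 <= k < n) (vol (a' k) (b' k))%:E)%E); last first.
    by apply: leeD; apply: nneseries_lim_ge => k _ _; rewrite lee_fin vol_ge0.
  apply: (@le_trans _ _ (\sum_(0 <= i < n.*2) (vol (A i) (B i))%:E)%E).
    rewrite [leRHS](big_cat_nat _ (n:=n)) //=; last by rewrite -addnn leq_addr.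
    by rewrite leeDl// sume_ge0// => i _; rewrite lee_fin vol_ge0.
  by rewrite AE.
rewrite [in leRHS](splitr e) EFinD addeACA; exact: leeD.
Unshelve. all: by end_near. Qed.

Lemma leb_setsP S : (forall T, (outer (T `&` S) + outer (T `&` ~` S) <= outer T)%E) ->
  leb_sets S.
Proof.
move=> H T; apply/eqP; rewrite eq_le H andbT.
rewrite -{1}(setIT T) -(setUv S) setIUr; exact: leb_outerU.
Qed.

Definition set_coord x (i : 'I_d) (c : R) : Rd := \row_j (if j == i then c else x 0 j).

(** A box is cut along the hyperplane [x_i = c]. Since [vol] clips negative sides to zero, [Num.min]
    and [Num.max] give the right answer for every position of [c], and for empty boxes too. *)
Lemma vol_split a b i (c : R) :
  vol a b = vol a (set_coord b i (Num.min (b 0 i) c)) + vol (set_coord a i (Num.max (a 0 i) c)) b.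
Proof.
rewrite /vol (bigD1 i)//= [X in _ = X + _](bigD1 i)//= [X in _ = _ + X](bigD1 i)//= !mxE eqxx.
have E j : j != i ->
  (Num.max (set_coord b i (Num.min (b 0 i) c) 0 j - a 0 j) 0 = Num.max (b 0 j - a 0 j) 0) *
  (Num.max (b 0 j - set_coord a i (Num.max (a 0 i) c) 0 j) 0 = Num.max (b 0 j - a 0 j) 0).
  by move=> /negPf ji; rewrite !mxE ji.
rewrite (eq_bigr _ (fun j ji => (E j ji).1)) (eq_bigr _ (fun j ji => (E j ji).2)).
rewrite -mulrDl; congr (_ * _).
rewrite /Num.max /Num.min; repeat case: ifP => //; rewrite -?[_ = false]negbTE; lra.
Qed.

(** Each box of a cover of [T] is cut by the hyperplane into one box for either part of [T], without
    loss of volume. *)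
Lemma halfspace_leb_sets i (c : R) : leb_sets [set x : Rd | x 0 i <= c].
Proof.
apply: leb_setsP => T; apply: le_leb_outer => a b Tab.
under eq_eseriesr do rewrite (vol_split _ _ i c) EFinD.
rewrite nneseriesD//; try by move=> k _ _; rewrite lee_fin vol_ge0.
apply: leeD; apply: leb_outer_le => x [/Tab[k _ xk]] /= xc; exists k => // j.
  rewrite mxE; case: eqP => [->|_]; last exact: xk.
  by rewrite le_min xc; have /andP[-> ->] := xk i.
rewrite mxE; case: eqP => [->|_]; last exact: xk.
by rewrite ge_max; have /andP[-> ->] := xk i; rewrite ltW// ltNge; apply/negP.
Qed.

Lemma box_shift a b x : [set y | box a b (y + x)] = box (a - x) (b - x).
Proof.
by apply/seteqP; split=> y H i; have := H i; rewrite !mxE lerBlDr lerBrDr.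
Qed.

Lemma vol_shift a b x : vol (a - x) (b - x) = vol a b.
Proof. by apply: eq_bigr => i _; rewrite !mxE; congr Num.max; ring. Qed.

Lemma leb_outer_shift_le S x : (outer [set y | S (y + x)%R] <= outer S)%E.
Proof.
apply: le_leb_outer => a b Sab.
under eq_eseriesr do rewrite -(vol_shift _ _ x).
apply: leb_outer_le => y /Sab[k _ yk]; exists k => //.
by rewrite -box_shift.
Qed.

Lemma leb_outer_shift S x : outer [set y | S (y + x)] = outer S.
Proof.
apply/eqP; rewrite eq_le leb_outer_shift_le/=.
have {1}-> : S = [set y | [set z | S (z + x)] (y - x)].
  by apply/seteqP; split=> y /=; rewrite subrK.
exact: leb_outer_shift_le.
Qed.

Lemma leb_sets_shift S x : leb_sets S -> leb_sets [set y : Rd | S (y + x)].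
Proof.
move=> HS; apply: leb_setsP => T.
have E (A : set Rd) : T `&` [set y | A (y + x)] = [set y | ([set z | T (z - x)] `&` A) (y + x)].
  by apply/seteqP; split=> y /=; rewrite addrK.
have -> : ~` [set y | S (y + x)] = [set y | (~` S) (y + x)] by [].
by rewrite !E !leb_outer_shift -HS -(leb_outer_shift T (- x)).
Qed.

Lemma measurable_halfspace i (c : R) :
  measurable ([set x : Rd | x 0 i <= c] : set (RdLeb R d)).
Proof. apply: sub_sigma_algebra; exact: halfspace_leb_sets. Qed.

Lemma measurable_coord_leb i : measurable_fun setT (fun x : RdLeb R d => (x : Rd) 0 i).
Proof.
apply: (measurability _ (RGenInftyO.measurableE R)).
move=> _ [_ [c ->] <-]; rewrite setTI.
have -> : (fun x : RdLeb R d => (x : Rd) 0 i) @^-1` `]-oo, c[ =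
   \bigcup_n [set x : Rd | x 0 i <= c - n.+1%:R^-1].
  apply/seteqP; split=> x /=.
    rewrite in_itv/= -subr_gt0 => xc; exists (Num.truncn (c - (x:Rd) 0 i)^-1) => //=.
    by rewrite lerBrDr -lerBrDl ltW// invf_plt ?posrE// truncnS_gt.
  by move=> [n _] /= /le_lt_trans; rewrite in_itv/=; apply; rewrite ltrBlDr ltrDl invr_gt0.
apply: bigcupT_measurable => n; exact: measurable_halfspace.
Qed.

Lemma measurable_id_leb : measurable_fun setT (id : RdLeb R d -> Bd).
Proof.
apply: measurable_fun_borel => U oU.
exact: (@measurable_preimage_open R d _ (RdLeb R d) (fun x : RdLeb R d => x) measurable_coord_leb U oU).
Qed.

Lemma borel_leb (B : set Rd) : borel_set B -> measurable (B : set (RdLeb R d)).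
Proof. by move=> mB; have := measurable_id_leb measurableT mB; rewrite setTI. Qed.

Lemma measurable_shift_leb x : measurable_fun setT ((fun y => y + x) : RdLeb R d -> RdLeb R d).
Proof.
apply: (@measurability _ _ (RdLeb R d) (RdLeb R d) setT (fun y => y + x) (@leb_sets R d) erefl).
by move=> _ [S HS <-]; rewrite setTI; apply: sub_sigma_algebra; exact: leb_sets_shift.
Qed.

Lemma measurable_shift x : measurable_fun setT ((fun y => y + x) : Bd -> Bd).
Proof.
apply: measurable_fun_borel => U oU; apply: measurable_open.
apply: (@open_comp 'rV[R]_d 'rV[R]_d (fun y => y + x)) => // y _.
by apply: (@continuousD R 'rV[R]_d 'rV[R]_d id (cst x) y); [exact: cvg_id|exact: cst_continuous].
Qed.

(** A single box becomes a sequence by appending copies of the degenerate box [box 0 0], whose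
    volume vanishes as soon as one coordinate exists. *)
Lemma leb_outer_box a b : (0 < d)%N -> (outer (box a b) <= (vol a b)%:E)%E.
Proof.
move=> d0.
have H : box a b `<=` \bigcup_k box (if k is 0%N then a else 0) (if k is 0%N then b else 0).
  by move=> x xab; exists 0%N.
apply: (le_trans (leb_outer_le H)).
rewrite nneseries_recl//; last by move=> k _; rewrite lee_fin vol_ge0.
rewrite eseries_cond/= eseries0 ?adde0// => -[|k]//= _ _; congr EFin.
by rewrite /vol (bigD1 (Ordinal d0))//= !mxE subrr maxxx mul0r.
Qed.

End OuterMeasure.

Lemma measure_mono d0 (T : measurableType d0) (R : realType) (mu : {measure set T -> \bar R}) (A B : set T) :
  measurable A -> measurable B -> A `<=` B -> (mu A <= mu B)%E.
Proof. by move=> mA mB AB; apply: le_measure => //; rewrite inE. Qed.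

(** * Restriction of the Lebesgue measure to Borel sets, and Borel hulls *)

Section BorelLebesgue.
Variables (R : realType) (d : nat).
Local Notation Rd := 'rV[R]_d.
Local Notation Bd := (RdBorel R d).
Variable leb : {measure set RdLeb R d -> \bar R}.

Definition lebB : set Bd -> \bar R := fun A => leb (A : set (RdLeb R d)).

Lemma lebB_set0 : lebB set0 = 0%E. Proof. exact: measure0. Qed.

Lemma lebB_ge0 A : (0 <= lebB A)%E. Proof. exact: measure_ge0. Qed.

Lemma lebB_sigma_additive : semi_sigma_additive lebB.
Proof.
move=> F mF tF mUF; apply: (@measure_semi_sigma_additive _ _ _ leb (F : nat -> set (RdLeb R d))) => //.
  by move=> i; exact: borel_leb.
exact: borel_leb.
Qed.

HB.instance Definition _ := isMeasure.Build _ _ _ lebB lebB_set0 lebB_ge0 lebB_sigma_additive.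

(** [lebB] is the pushforward of [leb] by the identity from [RdLeb] to [RdBorel]. The formula for
    nonnegative functions is applied to the positive and to the negative part. *)
Lemma integral_lebB (D : set Rd) (f : Rd -> \bar R) :
  borel_set D -> measurable_fun setT (f : Bd -> \bar R) ->
  (\int[leb]_(x in D) f x = \int[lebB]_(x in D) f x)%E.
Proof.
move=> mD mf.
have H (g : Rd -> \bar R) : measurable_fun setT (g : Bd -> \bar R) -> (forall x, 0 <= g x)%E ->
  (\int[leb]_(x in D) g x = \int[lebB]_(x in D) g x)%E.
  move=> mg g0; have := @ge0_integral_pushforward _ _ (RdLeb R d) Bd R id (@measurable_id_leb R d) leb D g mD.
  by move=> <- //; exact: measurable_funTS.
rewrite integralE [RHS]integralE; congr (_ - _)%E; apply: H.
- exact: (@measurable_funepos _ Bd).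
- by move=> x; exact: funepos_ge0.
- exact: (@measurable_funeneg _ Bd).
- by move=> x; exact: funeneg_ge0.
Qed.

(** This is what allows [Om] to be replaced by a Borel hull: the Fourier coefficients over [Om] and
    the distances in [L^2(Om)] become integrals over the hull. *)
Lemma integral_hull (A B : set Rd) (f : Rd -> \bar R) :
  measurable (A : set (RdLeb R d)) -> borel_set B -> A `<=` B ->
  leb (B `\` A) = 0%E -> measurable_fun setT (f : Bd -> \bar R) ->
  (\int[leb]_(x in A) f x = \int[lebB]_(x in B) f x)%E.
Proof.
move=> mA mB AB BA0 mf; rewrite -integral_lebB//.
have mBl := borel_leb mB.
have mfl : measurable_fun setT (f : RdLeb R d -> \bar R).
  have -> : f = f \o id by [].
  by apply: (measurable_comp _ _ mf (@measurable_id_leb R d)).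
have H (g : Rd -> \bar R) : measurable_fun setT (g : RdLeb R d -> \bar R) -> (forall x, 0 <= g x)%E ->
  (\int[leb]_(x in A) g x = \int[leb]_(x in B) g x)%E.
  move=> mg g0.
  rewrite [RHS](@ge0_negligible_integral _ (RdLeb R d) R leb B (B `\` A))//.
  - by rewrite setDD setIC (setIidl AB).
  - exact: measurableD.
  - exact: measurable_funTS.
rewrite integralE [RHS]integralE; congr (_ - _)%E; apply: H.
- exact: (@measurable_funepos _ (RdLeb R d)).
- by move=> x; exact: funepos_ge0.
- exact: (@measurable_funeneg _ (RdLeb R d)).
- by move=> x; exact: funeneg_ge0.
Qed.

Hypothesis Hleb : is_lebesgue leb.

(** In dimension zero [vol] is an empty product, hence one; every sequence of boxes then has
    infinite total volume, and so would the empty set have infinite outer measure. *)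
Lemma is_lebesgue_dim_gt0 : (0 < d)%N.
Proof.
rewrite lt0n; apply/eqP => d0.
have : leb set0 = +oo%E; last by rewrite measure0.
rewrite Hleb//; apply/eqP; rewrite eq_le leey/=; apply: le_leb_outer => a b _.
have E k : (vol (a k) (b k))%:E = 1%E :> \bar R.
  congr EFin; rewrite /vol big1// => i _; have := ltn_ord i.
  by rewrite {2}d0.
rewrite (eq_eseriesr (g := fun=> 1%E)); last by move=> k _; rewrite E.
rewrite leye_eq; apply/eqP/eq_infty => r.
apply: le_trans (nneseries_lim_ge (P := xpredT) (m := 0) (Num.truncn r).+1 _) => //.
rewrite (eq_bigr (fun=> (1%:E)))// sumEFin big_const_nat subn0 iter_addr addr0 lee_fin.
by rewrite ltW// truncnS_gt.
Qed.

Let d0 := is_lebesgue_dim_gt0.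

Lemma lebB_shift (A : set Rd) x : borel_set A ->
  lebB [set y | A (y + x)] = lebB A.
Proof.
move=> mA; rewrite /lebB !Hleb ?leb_outer_shift//; first exact: borel_leb.
apply: borel_leb; have := measurable_shift x measurableT mA; by rewrite setTI.
Qed.

Lemma closed_box (a b : Rd) : closed (box a b).
Proof.
have -> : box a b = \big[setI/setT]_(i <- index_enum 'I_d) [set x : Rd | x 0 i \in `[a 0 i, b 0 i] ].
  rewrite -bigcap_seq; apply/seteqP; split=> x /= H i; last first.
    by have := H i (mem_index_enum _); rewrite /= in_itv.
  by have := H i; rewrite /= in_itv.
apply: big_ind => [|A B cA cB|i _]; [exact: closedT|exact: closedI|].
apply: (@closed_comp _ _ (fun x : Rd => x 0 i) `[a 0 i, b 0 i]%classic); last exact: interval_closed.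
by move=> x _; exact: coord_continuous.
Qed.

Lemma measurable_box (a b : Rd) : measurable (box a b : set Bd).
Proof. apply: measurable_closed; exact: closed_box. Qed.

Lemma lebB_box_le (a b : Rd) : (lebB (box a b) <= (vol a b)%:E)%E.
Proof.
rewrite /lebB Hleb; last by apply: borel_leb; exact: measurable_box.
exact: leb_outer_box.
Qed.

Lemma bounded_set_box (A : set Rd) : bounded_set A ->
  exists M : R, 0 < M /\ A `<=` box (const_mx (- M)) (const_mx M).
Proof.
move=> [M [Mr HM]]; exists (Num.max M 0 + 1); split.
  by rewrite ltr_wpDl// le_max lexx orbT.
have MM : M < Num.max M 0 + 1 by rewrite ltr_pwDr// le_max lexx.
move=> x /(HM _ MM) xM i; rewrite !mxE -ler_norml.
exact: le_trans (le_coord_norm _ _) xM.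
Qed.

Lemma lebB_bounded (A : set Rd) : borel_set A -> bounded_set A -> (lebB A < +oo)%E.
Proof.
move=> mA /bounded_set_box[M [_ AM]].
apply: le_lt_trans (@measure_mono _ Bd R lebB _ _ mA (measurable_box _ _) AM) _.
by apply: le_lt_trans (lebB_box_le _ _) _; rewrite ltry.
Qed.

Lemma box_cover_measure (A : set Rd) (e : R) : measurable (A : set (RdLeb R d)) ->
  (leb A < +oo)%E -> 0 < e ->
  exists a b : nat -> Rd, A `<=` \bigcup_k box (a k) (b k) /\
    (lebB (\bigcup_k box (a k) (b k)) <= leb A + e%:E)%E.
Proof.
move=> mA Aoo e0; rewrite Hleb// in Aoo *.
have [a [b [Aab le]]] := leb_outer_approx Aoo e0.
exists a, b; split=> //; apply: le_trans le.
apply: (@le_trans _ _ (\sum_(k <oo) lebB (box (a k) (b k)))%E).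
  apply: measure_sigma_subadditive => //; first by move=> n; exact: measurable_box.
  by apply: bigcup_measurable => n _; exact: measurable_box.
by apply: lee_nneseries => // n _; exact: lebB_box_le.
Qed.

(** The hull is the intersection of box covers with excess [1 / (n + 1)], cut with a large box so
    that it stays bounded like [A]. *)
Lemma borel_hull (A : set Rd) : measurable (A : set (RdLeb R d)) -> (leb A < +oo)%E ->
  bounded_set A ->
  exists B : set Rd, [/\ borel_set B, A `<=` B, bounded_set B &
    leb (B `\` A) = 0%E].
Proof.
move=> mA Aoo bA; have [M [M0 AM]] := bounded_set_box bA.
have H n := box_cover_measure mA Aoo (e := n.+1%:R^-1) ltac:(by rewrite invr_gt0).
have [a /choice[b Hab]] := choice H.
pose U n := \bigcup_k box (a n k) (b n k).
pose C := box (const_mx (- M)) (const_mx M) : set Rd.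
have mU n : measurable (U n : set Bd).
  by apply: bigcup_measurable => k _; exact: measurable_box.
have mB : measurable (C `&` \bigcap_n U n : set Bd).
  by apply: measurableI; [exact: measurable_box|exact: bigcap_measurable].
exists (C `&` \bigcap_n U n); split=> //.
- by move=> x Ax; split; [exact: AM|move=> n _; exact: (Hab n).1].
- exists M; split; first exact: num_real.
  move=> M' MM' x [Cx _]; apply/norm_leP; first exact/ltW/(lt_trans M0).
  move=> i; have := Cx i; rewrite !mxE -ler_norml => /le_trans; apply; exact: ltW.
set B := _ `&` _.
have AB : A `<=` B by move=> x Ax; split; [exact: AM|move=> n _; exact: (Hab n).1].
have mBl := borel_leb mB.
have BleA : (leb B <= leb A)%E.
  apply/lee_addgt0Pr => e e0; pose n := Num.truncn e^-1.
  have ne : n.+1%:R^-1 <= e by rewrite invf_ple ?posrE// ltW// truncnS_gt.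
  apply: (@le_trans _ _ (leb A + (n.+1%:R^-1)%:E)%E); last by rewrite leeD2l// lee_fin.
  apply: le_trans (Hab n).2; apply: (@measure_mono _ Bd R lebB _ _ mB (mU n)).
  by move=> x [_ /(_ n I)].
apply/eqP; rewrite eq_le measure_ge0 andbT.
rewrite measureD//; last exact: le_lt_trans BleA Aoo.
rewrite (_ : B `&` A = A); last exact: setIidr.
by rewrite leeBlDr ?add0e// ge0_fin_numE.
Qed.

End BorelLebesgue.

(** * Continuity of translations in measure *)

Lemma nonincreasing_measure_lt d0 (T : measurableType d0) (R : realType)
    (mu : {measure set T -> \bar R}) (F : (set T)^nat) (c : \bar R) :
  (mu (F 0%N) < +oo)%E -> (forall i, measurable (F i)) -> nonincreasing_seq F ->
  (mu (\bigcap_n F n) < c)%E -> exists n, (mu (F n) < c)%E.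
Proof.
move=> F0 mF niF Fc.
have H := @nonincreasing_cvg_mu _ T R mu F F0 mF (bigcapT_measurable mF) niF.
have [N _ HN] := H _ (open_ereal_lt' Fc).
by exists N; exact: (HN N (leqnn N)).
Qed.

Section ShiftContinuity.
Variables (R : realType) (d : nat).
Local Notation Rd := 'rV[R]_d.
Local Notation Bd := (RdBorel R d).

Definition thicken (A : set Rd) (r : R) : set Rd := \bigcup_(a in A) ball a r.

Lemma open_thicken A r : open (thicken A r).
Proof.
apply: bigcup_open => a _; have [r0|r0] := ltP 0 r; first exact: ball_open.
rewrite (_ : ball a r = set0); first exact: open0.
by apply/seteqP; split=> // x [/lt_le_trans /(_ r0)]; rewrite ltxx.
Qed.

Lemma bigcap_thicken (A : set Rd) : closed A ->
  \bigcap_n thicken A n.+1%:R^-1 = A.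
Proof.
move=> cA; apply/seteqP; split=> x; last first.
  by move=> Ax n _; exists x => //; apply: ballxx.
move=> H; apply: (cA x) => U /nbhs_ballP[e /= e0 eU].
have [a Aa ax] := H (Num.truncn e^-1) I.
exists a; split=> //; apply: eU; apply: ball_sym; apply: le_ball ax.
by rewrite invf_ple ?posrE// ltW// truncnS_gt.
Qed.

Lemma bounded_subset (A B : set Rd) : A `<=` B -> bounded_set B -> bounded_set A.
Proof. by move=> AB [M [Mr HM]]; exists M; split=> // x Mx y /AB; exact: HM. Qed.

Lemma bounded_box (a b : Rd) : bounded_set (box a b).
Proof.
exists (`|a| + `|b|); split; first exact: num_real.
move=> M MM x xab; apply/norm_leP.
  by apply/ltW/(le_lt_trans _ MM); rewrite addr_ge0.
move=> i; have /andP[ax xb] := xab i.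
have := le_coord_norm a i; have := le_coord_norm b i.
move: MM ax xb; rewrite ler_norml !ler_norml => *; apply/andP; split; lra.
Qed.

Lemma bounded_thicken (A : set Rd) r : bounded_set A -> bounded_set (thicken A r).
Proof.
move=> [M [Mr HM]]; exists (M + 1 + r); split; first exact: num_real.
move=> M' MM' x [a /(HM (M + 1) ltac:(by rewrite ltrDl)) /= aM /ball_norm ax].
have -> : x = a - (a - x) by rewrite opprB addrC subrK.
apply: (le_trans (ler_normB _ _)); lra.
Qed.

Variable leb : {measure set RdLeb R d -> \bar R}.
Hypothesis Hleb : is_lebesgue leb.
Local Notation lebB := (lebB leb).

Lemma measurable_shift_set (A : set Rd) x : borel_set A ->
  borel_set [set y | A (y + x)].
Proof. by move=> mA; have := measurable_shift x measurableT mA; rewrite setTI. Qed.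

Lemma measurable_thicken (A : set Rd) r : measurable (thicken A r : set Bd).
Proof. apply: measurable_open; exact: open_thicken. Qed.

(* [B] is close in measure to a finite union [A] of closed boxes, and [A + x] lies in
   a small neighbourhood of [A]. *)
Lemma shift_continuity (B : set Rd) (e : R) :
  borel_set B -> bounded_set B -> 0 < e ->
  exists2 del : R, 0 < del & forall x : Rd, `|x| < del ->
    (lebB (B `\` [set y : Rd | B (y + x)%R]) <= e%:E)%E.
Proof.
(* One third each for leaving the finite union of boxes, for moving that union, and for passing from
   the moved union back to the moved [B]. *)
move=> mB bB e0; pose e' := e / 3; have e'0 : 0 < e' by rewrite divr_gt0.
have Boo : (lebB B < +oo)%E by exact: lebB_bounded.
have [a [b [Bab leV]]] := box_cover_measure Hleb (borel_leb mB) Boo e'0.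
have [M [M0 BM]] := bounded_set_box bB.
pose C := box (const_mx (- M)) (const_mx M) : set Rd.
pose V := \bigcup_k box (a k) (b k).
pose A n := (\bigcup_(k < n) box (a k) (b k)) `&` C.
have cA n : closed (A n).
  apply: closedI; last exact: closed_box.
  apply: closed_bigcup => [|i _]; [exact: finite_II|exact: closed_box].
have mA n : measurable (A n : set Bd) by exact: measurable_closed.
have mV : borel_set V.
  by apply: bigcup_measurable => k _; exact: measurable_box.
have [N HN] : exists n, (lebB (B `\` A n) < e'%:E)%E.
  apply: (@nonincreasing_measure_lt _ Bd R lebB (fun n => B `\` A n)).
  - apply: le_lt_trans Boo; apply: (@measure_mono _ Bd R lebB) => //.
    by apply: measurableD => //; exact: mA.
  - by move=> i; apply: measurableD => //; exact: mA.
  - move=> m n mn; apply/subsetPset => x [Bx nA]; split=> // -[[k km kx] Cx].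
    by apply: nA; split=> //; exists k => //=; exact: leq_trans mn.
  - rewrite (_ : \bigcap_n _ = set0) ?measure0 ?lte_fin//.
    apply/seteqP; split=> // x H; have [Bx _] := H 0%N I.
    have [k _ kx] := Bab _ Bx; have [_ []] := H k.+1 I.
    by split; [exists k => /=|exact: BM].
have HAB : (lebB (A N `\` B) <= e'%:E)%E.
  apply: (@le_trans _ _ (lebB (V `\` B))).
    apply: (@measure_mono _ Bd R lebB).
    - by apply: measurableD => //; exact: mA.
    - exact: measurableD.
    - by move=> x [[[k _ kx] _] nB]; split=> //; exists k.
  have Voo : (lebB V < +oo)%E by apply: le_lt_trans leV _; rewrite lte_add_pinfty// ltry.
  rewrite measureD//= (_ : V `&` B = B); last exact: setIidr.
  by rewrite leeBlDl ?ge0_fin_numE//.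
have [n Hn] : exists n, (lebB (thicken (A N) (n.+1%:R^-1)%R `\` A N) < e'%:E)%E.
  apply: (@nonincreasing_measure_lt _ Bd R lebB (fun n => thicken (A N) n.+1%:R^-1 `\` A N)).
  - apply: (@le_lt_trans _ _ (lebB (thicken (A N) 1%:R^-1))).
      apply: (@measure_mono _ Bd R lebB).
      + by apply: measurableD; [exact: measurable_thicken|exact: mA].
      + exact: measurable_thicken.
      + by move=> x [].
    apply: lebB_bounded => //; first exact: measurable_thicken.
    apply: bounded_thicken; apply: (@bounded_subset _ C); first by move=> x [].
    exact: bounded_box.
  - by move=> i; apply: measurableD; [exact: measurable_thicken|exact: mA].
  - move=> i j ij; apply/subsetPset => x [[y Ay yx] nA]; split=> //; exists y => //.
    by apply: le_ball yx; rewrite lef_pV2 ?posrE// ler_nat.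
  - rewrite (_ : \bigcap_n _ = set0) ?measure0 ?lte_fin//.
    apply/seteqP; split=> // x H.
    have : (\bigcap_n thicken (A N) n.+1%:R^-1) x by move=> i _; have [] := H i I.
    by rewrite bigcap_thicken//; have [_] := H 0%N I.
exists n.+1%:R^-1; first by rewrite invr_gt0.
move=> x xn.
set Bx := [set y | B (y + x)]; pose Ax := [set y | A N (y + x)].
have mBx : borel_set Bx by exact: measurable_shift_set.
have mAx : borel_set Ax by exact: measurable_shift_set.
have m1 : measurable (B `\` A N : set Bd) by apply: measurableD.
have m2 : measurable (A N `\` Ax : set Bd) by apply: measurableD.
have m3 : measurable (Ax `\` Bx : set Bd) by apply: measurableD.
apply: (@le_trans _ _ (lebB ((B `\` A N) `|` (A N `\` Ax) `|` (Ax `\` Bx)))).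
  apply: (@measure_mono _ Bd R lebB).
  - exact: measurableD.
  - by apply: measurableU => //; exact: measurableU.
  - move=> y [By nBx]; have [Ay|nAy] := pselect (A N y); last by left; left.
    by have [Axy|nAxy] := pselect (Ax y); [right|left; right].
have {mBx mAx}-> : e = e' + e' + e' by rewrite /e'; field.
apply: (le_trans (@measureU2 _ Bd R lebB _ _ (measurableU _ _ m1 m2) m3)).
rewrite EFinD; apply: leeD; last first.
  have -> : Ax `\` Bx = [set y | (A N `\` B) (y + x)] by [].
  have m5 : measurable (A N `\` B : set Bd) by apply: measurableD => //; exact: mA.
  by rewrite [leLHS](lebB_shift Hleb x m5).
apply: (le_trans (@measureU2 _ Bd R lebB _ _ m1 m2)).
rewrite EFinD; apply: leeD; first exact: ltW.
have -> : A N `\` Ax = [set y | ([set z | A N (z - x)] `\` A N) (y + x)].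
  by apply/seteqP; split=> y /=; rewrite /= addrK.
have m4 : borel_set ([set z | A N (z - x)] `\` A N).
  by apply: measurableD; [exact: measurable_shift_set|exact: mA].
rewrite [leLHS](lebB_shift Hleb x m4); apply: le_trans (ltW Hn).
apply: (@measure_mono _ Bd R lebB) => //.
  by apply: measurableD; [exact: measurable_thicken|exact: mA].
move=> z [Az nAz]; split=> //; exists (z - x) => //; apply/ball_norm.
by rewrite addrAC subrr add0r normrN.
Qed.

End ShiftContinuity.

(** * Polynomial growth: doubling of balls, separated sets, decaying weights *)

Section Growth.
Variables (R : realType) (d : nat).
Local Notation Rd := 'rV[R]_d.
Local Notation Bd := (RdBorel R d).

(** In each coordinate the open interval of radius [2 r] is covered by those of radius [r] centred
    at the offsets [-r], [0] and [r]; the outer two alone would miss the midpoint. *)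
Lemma ball_cover3 (x : Rd) r : 0 < r ->
  ball x (r * 2) `<=` \bigcup_(f : {ffun 'I_d -> 'I_3})
    ball (x + \row_i (r * ((f i)%:R - 1))) r.
Proof.
move=> r0 y /ball_norm /norm_ltP H; have {}H := H ltac:(by rewrite mulr_gt0).
pose f := [ffun i : 'I_d => if y 0 i < x 0 i then inord 0 else
  if y 0 i == x 0 i then inord 1 else inord 2 : 'I_3].
exists f => //; apply/ball_norm/norm_ltP => // i.
have := H i; rewrite !mxE ffunE ltr_norml => /andP[h1 h2].
rewrite ltr_norml; case: (ltgtP (y 0 i) (x 0 i)) => [yx|xy|yx]; rewrite inordK//; apply/andP; split; lra.
Qed.

(** Each doubling of the radius costs a factor [3 ^ d]. Subadditivity is asked for covers of a ball
    by balls of half its radius, so that [phi] may be a measure or the counting function of a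
    list. *)
Lemma ball_growth (phi : set Rd -> \bar R) (C r : R) : 0 < r -> 0 <= C ->
  (forall (x : Rd) s (I : finType) (c : I -> Rd),
    ball x s `<=` \bigcup_i ball (c i) (s / 2) -> 0 < s ->
    (phi (ball x s) <= \sum_i phi (ball (c i) (s / 2)))%E) ->
  (forall x, phi (ball x r) <= C%:E)%E ->
  forall k x, (phi (ball x (r * 2 ^+ k)) <= ((3 ^ d)%:R ^+ k * C)%:E)%E.
Proof.
move=> r0 C0 sub H; elim=> [|k IH] x; first by rewrite !expr0 mulr1 mul1r.
have rk0 : 0 < r * 2 ^+ k by rewrite mulr_gt0// exprn_gt0.
rewrite exprSr mulrA.
have E : r * 2 ^+ k * 2 / 2 = r * 2 ^+ k by rewrite mulfK.
apply: (le_trans (sub _ _ _ (fun f : {ffun 'I_d -> 'I_3} => x + \row_i ((r * 2 ^+ k) * ((f i)%:R - 1))) _ _)).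
- rewrite E; exact: ball_cover3.
- by rewrite mulr_gt0.
rewrite E; apply: le_trans (lee_sum _ (fun f _ => IH _)) _.
rewrite sumEFin lee_fin sumr_const card_ffun !card_ord -[leLHS]mulr_natr exprSr.
by rewrite mulrAC.
Qed.

Lemma measure_cover_seq d0 (T : measurableType d0) (mu : {measure set T -> \bar R})
  (I : eqType) (s : seq I) (A : set T) (B : I -> set T) :
  measurable A -> (forall i, measurable (B i)) -> A `<=` \bigcup_(i in [set` s]) B i ->
  (mu A <= \sum_(i <- s) mu (B i))%E.
Proof.
move=> mA mB; elim: s A mA => [|i s IH] A mA.
  move=> AB; rewrite big_nil (_ : A = set0) ?measure0//.
  by apply/seteqP; split=> // x /AB[].
move=> AB; rewrite big_cons.
apply: (@le_trans _ _ (mu (B i `|` (A `\` B i)))).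
  apply: measure_mono => //; first by apply: measurableU => //; exact: measurableD.
  by move=> x Ax; have [|] := pselect (B i x); [left|right].
apply: (le_trans (measureU2 _ (mB i) (measurableD mA (mB i)))).
rewrite leeD2l//; apply: IH; first exact: measurableD.
move=> x [/AB[j /=]]; rewrite inE => /orP[/eqP->//|js Bjx _]; by exists j.
Qed.

Lemma measurable_ball_borel (x : Rd) r : measurable (ball x r : set Bd).
Proof.
apply: measurable_open; have [r0|r0] := ltP 0 r; first exact: ball_open.
rewrite (_ : ball x r = set0); first exact: open0.
by apply/seteqP; split=> // y [/lt_le_trans /(_ r0)]; rewrite ltxx.
Qed.

Lemma measure_ball_growth (mu : {measure set Bd -> \bar R}) (C r : R) :
  0 < r -> 0 <= C -> (forall x : Rd, mu (ball x r) <= C%:E)%E ->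
  forall k (x : Rd), (mu (ball x (r * 2 ^+ k)) <= ((3 ^ d)%:R ^+ k * C)%:E)%E.
Proof.
move=> r0 C0 H; apply: ball_growth => // x s I c cov s0.
apply: (measure_cover_seq mu).
- exact: measurable_ball_borel.
- by move=> i; exact: measurable_ball_borel.
- by move=> y /cov[i _ yi]; exists i => //=; rewrite mem_index_enum.
Qed.

Definition separated (del : R) (s : seq Rd) :=
  forall x y, x \in s -> y \in s -> x <> y -> del <= `|x - y|.

(** An open ball of radius [del / 2] holds at most one point of [s]; [ball_growth] is then applied
    to the counting function. *)
Lemma separated_count_ball (del : R) (s : seq Rd) : 0 < del -> separated del s -> uniq s ->
  forall k (x : Rd), (count (fun y : Rd => (`|x - y| < del / 2 * 2 ^+ k)%R) s <= (3 ^ d) ^ k)%N.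
Proof.
move=> del0 sep us k x.
pose phi (A : set Rd) : \bar R := (count (fun y => `[< A y >]) s)%:R%:E.
have phiE y r : phi (ball y r) = (count (fun z : Rd => `|y - z| < r) s)%:R%:E.
  congr (_%:R%:E); apply: eq_count => z /=; apply/asboolP/idP => /ball_norm //.
have := @ball_growth phi 1 (del / 2) ltac:(by rewrite divr_gt0) ler01.
move=> H; rewrite -(ler_nat R) -lee_fin -phiE natrX.
rewrite -[X in (_ <= X%:E)%E]mulr1; apply: H.
- move=> y r I c cov _; rewrite /phi sumEFin -natr_sum lee_fin ler_nat.
  rewrite -sum1_count; under [leqRHS]eq_bigr do rewrite -sum1_count.
  rewrite big_mkcond/=; under [leqRHS]eq_bigr do rewrite big_mkcond/=.
  rewrite exchange_big/= leq_sum// => z _; case: asboolP => // yz.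
  have [i _ zi] := cov _ yz; rewrite (bigD1 i)//=; case: asboolP => // _.
- move=> y; rewrite phiE lee_fin (ler_nat _ _ 1) -size_filter.
  have : uniq (seq.filter (fun z => `|y - z| < del / 2) s) by rewrite filter_uniq.
  have : forall z, z \in seq.filter (fun z => `|y - z| < del / 2) s -> z \in s /\ `|y - z| < del / 2.
    by move=> z; rewrite mem_filter => /andP[].
  case: (seq.filter _ s) => [|a [|b t]]//= Hs /andP[+ _]; rewrite inE negb_or => /andP[/eqP ab _].
  have [as_ ya] := Hs a (mem_head _ _).
  have [|bs yb] := Hs b; first by rewrite !inE eqxx orbT.
  have := sep _ _ as_ bs ab; rewrite leNgt => /negP; case.
  have -> : a - b = (y - b) - (y - a) by rewrite opprB [RHS]addrC addrA subrK.
  apply: (le_lt_trans (ler_normB _ _)); lra.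
Qed.

(** Translation-bounded measures may have infinite mass. These weights are integrable against all of
    them once [p > 2 d], and they serve as the common domination in what follows. *)
Definition decay (p : nat) (x : Rd) : R := (1 + `|x|) ^- p.

Lemma decay_ge0 p x : 0 <= decay p x.
Proof. by rewrite invr_ge0 exprn_ge0// addr_ge0. Qed.

Lemma decay_continuous p : continuous (decay p).
Proof.
move=> x; apply: (@continuous_comp _ _ _ (fun x : Rd => `|x|) (fun r => (1 + r) ^- p)).
  exact: norm_continuous.
apply: (@continuousV _ _ (fun r : R => (1 + r) ^+ p)).
  by rewrite expf_neq0// gt_eqF// ltr_pwDl.
apply: (@continuous_comp _ _ _ (fun r : R => 1 + r) (fun y => y ^+ p)); last exact: exprn_continuous.
by apply: cvgD; [exact: cvg_cst|exact: cvg_id].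
Qed.

Lemma measurable_decay p : measurable_fun setT (decay p : Bd -> R).
Proof. by apply: continuous_measurable; exact: decay_continuous. Qed.

(* Over the dyadic ball of radius [2 ^ k], of mass at most [3 ^ (d * k) * C], the weight is
   of order [2 ^ (- k * (2 * d + 1))]. *)
Lemma integral_decay (mu : {measure set Bd -> \bar R}) (C : R) (p : nat) :
  0 <= C -> (forall x : Rd, mu (ball x 1) <= C%:E)%E -> (d.*2 < p)%N ->
  (\int[mu]_x (decay p x)%:E <= (2 ^+ p.+1 * C)%:E)%E.
Proof.
move=> C0 H dp.
pose c k : R := 2 ^+ p * (2 ^+ k) ^- p.
have c0 k : 0 <= c k by rewrite mulr_ge0 ?invr_ge0 ?exprn_ge0.
pose g k (x : Bd) : \bar R := (c k * \1_(ball (0 : Rd) (2 ^+ k)) x)%:E.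
have mg k : measurable_fun setT (g k).
  apply/measurable_EFinP/measurable_funM => //; apply: measurable_indic.
  exact: measurable_ball_borel.
have g0 k x : (0 <= g k x)%E by rewrite lee_fin mulr_ge0.
apply: (@le_trans _ _ (\int[mu]_x \sum_(k <oo) g k x)%E).
  apply: ge0_le_integral => //.
  - by move=> x _; rewrite lee_fin decay_ge0.
  - by apply/measurable_EFinP; exact: measurable_decay.
  - exact: ge0_emeasurable_sum.
  - move=> x _.
    (* The least dyadic ball containing [x]; minimality gives the upper bound on [2 ^+ n]. *)
    have [n [xn nx]] : exists n, `|x| < 2 ^+ n /\ (2 ^+ n <= 2 * (1 + `|x|)).
      have ex : exists n, `|x : Rd| < 2 ^+ n.
        exists (Num.truncn `|x : Rd|).+1; apply: lt_le_trans (truncnS_gt _) _.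
        by rewrite -natrX ler_nat ltnW// ltn_expl.
      exists (ex_minn ex); case: ex_minnP => -[|n] xn mn.
        by rewrite expr0; split=> //; rewrite mulrDr mulr1 -addrA ler_wpDr// ?ler1n//; rewrite addr_ge0// mulr_ge0.
      split=> //; rewrite exprS ler_pM2l// leNgt; apply/negP => xn'.
      suff : (n.+1 <= n)%N by rewrite ltnn.
      by apply: mn; apply: le_lt_trans xn'; rewrite lerDr.
    apply: (@le_trans _ _ (g n x)).
      rewrite lee_fin indicE mem_set; last by apply/ball_norm; rewrite sub0r normrN.
      have x0 : 0 < 1 + `|x : Rd| by rewrite ltr_pwDl.
      rewrite mulr1 /c /decay ler_pdivlMr ?exprn_gt0// mulrC ler_pdivrMr ?exprn_gt0//.
      by rewrite -exprMn lerXn2r// nnegrE ?exprn_ge0// mulr_ge0// ltW.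
    rewrite (@nneseriesD1 _ _ n)// leeDl// nneseries_ge0//.
rewrite integral_nneseries//.
apply: (@le_trans _ _ (\sum_(k <oo) ((2 ^+ p.+1 * C) / (2 ^ k.+1)%:R)%:E)%E); last first.
  by apply: epsilon_trick0; rewrite mulr_ge0// exprn_ge0.
apply: lee_nneseries => [k _ _|k _]; first exact: integral_ge0.
rewrite /g; under eq_integral do rewrite EFinM.
rewrite ge0_integralZl//; last 2 first.
- by apply/measurable_EFinP; apply: measurable_indic; exact: measurable_ball_borel.
- by rewrite lee_fin.
rewrite integral_indic//= ?setIT; last exact: measurable_ball_borel.
have := measure_ball_growth ltr01 C0 H k 0; rewrite mul1r => Hk.
apply: (le_trans (lee_wpmul2l _ Hk)); first by rewrite lee_fin.
rewrite -EFinM lee_fin /c.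
have -> : ((2 ^ k.+1)%:R : R) = 2 * 2 ^+ k by rewrite natrX exprS.
have -> : 2 ^+ p.+1 = 2 * 2 ^+ p :> R by rewrite exprS.
rewrite mulrA.
have E : 2 * 2 ^+ p * C / (2 * 2 ^+ k) = 2 ^+ p * (2 ^+ k) ^-1 * C :> R.
  by field; rewrite expf_neq0.
rewrite E ler_wpM2r// -mulrA ler_wpM2l// ?exprn_ge0//.
(* One factor is kept for the geometric series. The remaining [p.-1 >= 2 d] absorb the growth, as
   [3 ^ d <= 4 ^ d = 2 ^ (2 d)]. *)
have -> : (2 ^+ k) ^- p = (2 ^+ k)^-1 * (2 ^+ k) ^- p.-1 :> R.
  by rewrite -[in LHS](ltn_predK dp) exprS invfM.
rewrite -mulrA ler_piMr ?invr_ge0 ?exprn_ge0// mulrC ler_pdivrMr ?exprn_gt0// mul1r.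
rewrite -exprM mulnC exprM lerXn2r ?nnegrE ?exprn_ge0 ?ler0n//.
rewrite -natrX ler_nat; apply: (@leq_trans (4 ^ d)); first exact: leq_exp2r || by case: d => // n; rewrite leq_exp2r.
have -> : (4 ^ d = 2 ^ d.*2)%N by rewrite -mul2n expnM.
by rewrite leq_pexp2l// -ltnS (ltn_predK dp).
Qed.

End Growth.

(** * Limits along an ultrafilter and construction of vague limits *)

Section UltraLimit.
Variables (R : realType) (F : set_system nat).
Hypothesis FU : UltraFilter F.

(** A cluster point in the compact segment is a limit, because an ultrafilter contains a set or its
    complement. In place of an extraction of subsequences, the masses of all compact sets converge
    at once. *)
Lemma ultra_bounded_cvg (u : nat -> R) (a b : R) : (forall n, a <= u n <= b) -> cvg (u @ F).
Proof.
move=> ub; have PF : ProperFilter F := ultra_proper.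
have [p [_ clp]] : `[a, b]%classic `&` cluster (u @ F) !=set0.
  apply: segment_compact.
  by apply: (@filterE _ F) => n; rewrite /= in_itv/=.
apply/cvg_ex; exists p => U pU.
have [//|H] := @in_ultra_setVsetC _ F (u @^-1` U) FU.
by have [x [nUx Ux]] := clp (~` U) U H pU.
Qed.
End UltraLimit.

Lemma ge0_fineD (R : realType) (x y : \bar R) : (0 <= x)%E -> (0 <= y)%E -> (x < +oo)%E -> (y < +oo)%E ->
  fine (x + y)%E = fine x + fine y.
Proof. by move=> *; rewrite fineD// ge0_fin_numE. Qed.

(* For a vaguely bounded sequence of measures, the limit along an ultrafilter is a content
   on compact sets; the measure it induces by Halmos' method is the vague limit. *)
Section VagueLimit.
Variables (R : realType) (d : nat).
Local Notation Rd := 'rV[R]_d.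
Local Notation Bd := (RdBorel R d).
Variables (F : set_system nat) (mu : nat -> {measure set Bd -> \bar R}) (C : R).
Hypothesis FU : UltraFilter F.
Hypothesis C0 : 0 <= C.
Hypothesis Hmu : forall n (x : Rd), (mu n (ball x 1) <= C%:E)%E.

Lemma bounded_set_ball (A : set Rd) : bounded_set A -> exists k, A `<=` ball (0 : Rd) (1 * 2 ^+ k).
Proof.
move=> [M [Mr HM]]; exists (Num.truncn (M + 1)).+1 => x /(HM (M + 1) ltac:(by rewrite ltrDl)) /= xM.
apply/ball_norm; rewrite sub0r normrN mul1r; apply: le_lt_trans xM _.
by apply: lt_le_trans (truncnS_gt _) _; rewrite -natrX ler_nat ltnW// ltn_expl.
Qed.

Lemma vague_bounded (A : set Rd) : bounded_set A -> borel_set A ->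
  exists2 M : R, 0 <= M & forall n, (mu n A <= M%:E)%E.
Proof.
move=> /bounded_set_ball[k Ak] mA; exists ((3 ^ d)%:R ^+ k * C).
  by rewrite mulr_ge0// exprn_ge0// ler0n.
move=> n; apply: le_trans (measure_ball_growth ltr01 C0 (Hmu n) k 0).
by apply: measure_mono => //; exact: measurable_ball_borel.
Qed.

Lemma vague_lty n (A : set Rd) : bounded_set A -> borel_set A -> (mu n A < +oo)%E.
Proof.
by move=> bA mA; have [M _ HM] := vague_bounded bA mA; apply: le_lt_trans (HM n) _; rewrite ltry.
Qed.

Let lam (K : set Rd) : R := lim ((fun n => fine (mu n K)) @ F).

Lemma bounded_compact (K : set Rd) : compact K -> bounded_set K.
Proof. exact: compact_bounded. Qed.

Lemma measurable_compact (K : set Rd) : compact K -> borel_set K.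
Proof.
by move=> cK; apply: measurable_closed; apply: compact_closed => //; exact: norm_hausdorff.
Qed.

Lemma vague_lam_cvg (K : set Rd) : compact K -> (fun n => fine (mu n K)) @ F --> lam K.
Proof.
move=> cK; have [M M0 HM] := vague_bounded (bounded_compact cK) (measurable_compact cK).
apply: (@ultra_bounded_cvg R F FU _ 0 M) => n.
by rewrite fine_ge0//= -lee_fin fineK// ge0_fin_numE//; apply: le_lt_trans (HM n) _; rewrite ltry.
Qed.

Let PF : ProperFilter F := @ultra_proper _ F FU.

Lemma fine_mono n (K L : set Rd) : compact L -> borel_set K -> K `<=` L ->
  fine (mu n K) <= fine (mu n L).
Proof.
move=> cL mK KL.
have mL := measurable_compact cL.
have Loo := vague_lty n (bounded_compact cL) mL.
have le := @measure_mono _ _ _ (mu n) _ _ mK mL KL.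
by rewrite fine_le// ge0_fin_numE//; exact: le_lt_trans Loo.
Qed.

Lemma vague_lam_mono (K L : set Rd) : compact K -> compact L -> K `<=` L -> lam K <= lam L.
Proof.
move=> cK cL KL; apply: ler_cvg_to (vague_lam_cvg cK) (vague_lam_cvg cL) _.
by apply: filterE => n; apply: fine_mono => //; exact: measurable_compact.
Qed.

Lemma vague_lamU (K L : set Rd) : compact K -> compact L -> lam (K `|` L) <= lam K + lam L.
Proof.
move=> cK cL.
apply: ler_cvg_to (vague_lam_cvg (compactU cK cL)) (cvgD (vague_lam_cvg cK) (vague_lam_cvg cL)) _.
have mK := measurable_compact cK; have mL := measurable_compact cL.
apply: filterE => n /=.
have Koo := vague_lty n (bounded_compact cK) mK.
have Loo := vague_lty n (bounded_compact cL) mL.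
change (fine (mu n (K `|` L)) <= fine (mu n K) + fine (mu n L)).
rewrite -ge0_fineD//; have le := measureU2 (mu n) mK mL.
have oo : (mu n K + mu n L < +oo)%E by rewrite lte_add_pinfty.
by rewrite fine_le// ge0_fin_numE ?adde_ge0//; exact: le_lt_trans oo.
Qed.

Lemma vague_lamU_disj (K L : set Rd) : compact K -> compact L -> K `&` L = set0 ->
  lam (K `|` L) = lam K + lam L.
Proof.
move=> cK cL KL0.
have H1 := vague_lam_cvg (compactU cK cL).
have H2 : ((fun n => fine (mu n K)) + (fun n => fine (mu n L))) @ F --> lam K + lam L.
  by apply: cvgD; exact: vague_lam_cvg.
have E : (fun n => fine (mu n (K `|` L))) = (fun n => fine (mu n K)) + (fun n => fine (mu n L)).
  apply/funext => n; change (fine (mu n (K `|` L)) = fine (mu n K) + fine (mu n L)).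
  have mK := measurable_compact cK; have mL := measurable_compact cL.
  have Koo := vague_lty n (bounded_compact cK) mK.
  have Loo := vague_lty n (bounded_compact cL) mL.
  by rewrite measureU// ge0_fineD.
rewrite E in H1.
have FF : ProperFilter (((fun n => fine (mu n K)) + (fun n => fine (mu n L))) @ F) by exact: fmap_proper_filter.
exact: (@cvg_unique R (@norm_hausdorff _ R) _ FF _ _ H1 H2).
Qed.

(** The value [+oo] off the open sets has the effect that the infimum in [mu_ext], which ranges over
    arbitrary sequences of sets, is taken over open covers. *)
Let rho (U : set Rd) : \bar R :=
  if `[< open U >] then ereal_sup [set (lam K)%:E | K in [set K | compact K /\ K `<=` U]] else +oo%E.

Lemma vague_rho_ge (U K : set Rd) : compact K -> K `<=` U -> ((lam K)%:E <= rho U)%E.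
Proof.
move=> cK KU; rewrite /rho; case: asboolP => _; last exact: leey.
by apply: ereal_sup_ubound; exists K.
Qed.

Lemma vague_lam0 : lam set0 = 0.
Proof.
rewrite /lam; apply: cvg_lim; first exact: norm_hausdorff.
rewrite (_ : (fun n => _) = cst 0); first exact: cvg_cst.
by apply/funext => n; rewrite measure0.
Qed.

Lemma vague_rho_ge0 U : (0 <= rho U)%E.
Proof. by have := @vague_rho_ge U set0 (@compact0 _) (@sub0set _ _); rewrite vague_lam0. Qed.

Lemma vague_rho0 : rho set0 = 0%E.
Proof.
apply/eqP; rewrite eq_le vague_rho_ge0 andbT /rho; case: asboolP => [_|]; last by case; exact: open0.
apply: ge_ereal_sup => _ [K [_ K0] <-].
by rewrite (_ : K = set0) ?vague_lam0//; apply/seteqP; split.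
Qed.

(** Every subset is measurable here. [mu_ext] takes its covers among the measurable sets of its
    type, and the selection of the open ones is left to [rho]. *)
Definition discrete_rV := g_sigma_algebraType (setT : set (set Rd)).

Let mus : set discrete_rV -> \bar R := mu_ext (rho : set discrete_rV -> \bar R).

Let mus_outer : {outer_measure set discrete_rV -> \bar R} := HB.pack mus
  (isOuterMeasure.Build R discrete_rV mus
   (mu_ext0 (vague_rho0 : (rho : set discrete_rV -> \bar R) set0 = 0%E) vague_rho_ge0)
   (mu_ext_ge0 (mu := (rho : set discrete_rV -> \bar R)) vague_rho_ge0)
   (le_mu_ext (rho : set discrete_rV -> \bar R))
   (mu_ext_sigma_subadditive (mu := (rho : set discrete_rV -> \bar R)) vague_rho_ge0)).

Lemma vague_mus_le (A : set Rd) (U : nat -> set Rd) : A `<=` \bigcup_k U k ->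
  (mus A <= \sum_(k <oo) rho (U k))%E.
Proof.
move=> AU; apply: ereal_inf_lbound; exists U => //; split=> // k.
exact: sub_sigma_algebra.
Qed.

Lemma vague_mus_le1 (A U : set Rd) : A `<=` U -> (mus A <= rho U)%E.
Proof.
move=> AU; apply: (le_trans (@vague_mus_le A (fun k => if k is 0%N then U else set0) _)).
  by move=> x /AU Ux; exists 0%N.
rewrite nneseries_recl//; last by move=> k _; exact: vague_rho_ge0.
by rewrite eseries_cond/= eseries0 ?adde0// => -[|k]//= _ _; exact: vague_rho0.
Qed.

(** Choose a compact [K] that nearly exhausts the intersection of [V] and [U], then a compact [L]
    that nearly exhausts the open set [V \ K], which contains [V \ U]. They are disjoint and inside
    [V], and [lam] is additive on disjoint compact sets. *)
Lemma vague_rho_split (V U : set Rd) : open U -> (rho (V `&` U) + mus (V `\` U) <= rho V)%E.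
Proof.
move=> oU; have [oV|nV] := pselect (open V); last first.
  by rewrite [leRHS]/rho; case: asboolP => // _; exact: leey.
have [->|Vfin] := eqVneq (rho V) +oo%E; first exact: leey.
have sup_approx W (e : R) : open W -> W `<=` V -> 0 < e ->
    exists K, [/\ compact K, K `<=` W & (rho W <= (lam K + e)%:E)%E].
  move=> oW WV e0.
  have rhoW : rho W \is a fin_num.
    rewrite ge0_fin_numE ?vague_rho_ge0//; apply: (@le_lt_trans _ _ (rho V)); last by rewrite ltey.
    rewrite {1}/rho; case: asboolP => // _; apply: ge_ereal_sup => _ [K [cK KW] <-].
    by apply: vague_rho_ge => //; exact: subset_trans WV.
  have := rhoW; rewrite {1}/rho; case: asboolP => // _ /(ub_ereal_sup_adherent e0).
  move=> [_ [K [cK KW] <-] lt]; exists K; split=> //.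
  rewrite EFinD -leeBlDr// ltW//; move: lt.
  by rewrite [in X in _ -> X]/rho; case: asboolP.
apply/lee_addgt0Pr => e e0; have e2 : 0 < e / 2 by rewrite divr_gt0.
have [K [cK KVU leK]] := sup_approx (V `&` U) _ (openI oV oU) (@subIsetl _ _ _) e2.
have clK : closed K by apply: compact_closed => //; exact: norm_hausdorff.
have oVK : open (V `\` K) by apply: openI => //; exact: closed_openC.
have [L [cL LVK leL]] := sup_approx (V `\` K) _ oVK (@subDsetl _ _ _) e2.
have KL0 : K `&` L = set0 by apply/seteqP; split=> // x [Kx /LVK[]].
apply: (@le_trans _ _ ((lam K + e / 2)%:E + (lam L + e / 2)%:E)%E).
  apply: leeD => //; apply: le_trans leL; apply: vague_mus_le1.
  by move=> x [Vx nUx]; split=> // /KVU[].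
rewrite -EFinD addrACA -splitr EFinD leeD2r// -vague_lamU_disj//.
apply: vague_rho_ge; first exact: compactU.
by move=> x [/KVU[]//|/LVK[]].
Qed.

Lemma vague_open_caratheodory (U : set Rd) : open U -> caratheodory_measurable (mus : set Rd -> \bar R) U.
Proof.
move=> oU; apply: (@le_caratheodory_measurable _ _ mus_outer) => X.
apply: le_ereal_inf_tmp => _ [V [_ XV] <-].
apply: (@le_trans _ _ (\sum_(k <oo) (rho (V k `&` U) + mus (V k `\` U)))%E); last first.
  apply: lee_nneseries => k _; last exact: vague_rho_split.
  by rewrite adde_ge0 ?vague_rho_ge0//; exact: (outer_measure_ge0 mus_outer).
rewrite nneseriesD; last 2 first.
- by move=> k _ _; exact: vague_rho_ge0.
- by move=> k _ _; exact: (outer_measure_ge0 mus_outer).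
apply: leeD.
  apply: vague_mus_le => x [/XV[k _ Vx] Ux]; by exists k.
apply: le_trans (outer_measure_sigma_subadditive mus_outer _).
by apply: (le_outer_measure mus_outer) => x [/XV[k _ Vx] nUx]; exists k.
Qed.

Lemma vague_borel_caratheodory (A : set Rd) : borel_set A ->
  measurable (A : set (caratheodory_type mus_outer)).
Proof.
move: A; apply: smallest_sub; last by move=> U oU; exact: vague_open_caratheodory.
split.
- exact: measurable0.
- by move=> A mA; rewrite setTD; exact: (@measurableC _ (caratheodory_type mus_outer)).
- by move=> A mA; exact: (@bigcupT_measurable _ (caratheodory_type mus_outer)).
Qed.

Lemma vague_sigma_additive : semi_sigma_additive (mus : set Bd -> \bar R).
Proof.
move=> A mA tA mUA; apply: (@caratheodory_measure_sigma_additive _ _ mus_outer) => //.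
  by move=> i; exact: vague_borel_caratheodory.
exact: vague_borel_caratheodory.
Qed.

Definition vague_limit : {measure set Bd -> \bar R} :=
  HB.pack (mus : set Bd -> \bar R)
   (isMeasure.Build _ Bd R (mus : set Bd -> \bar R)
     (outer_measure0 mus_outer) (fun A => outer_measure_ge0 mus_outer A) vague_sigma_additive).

(** The mass of an open set is at most the supremum of [lam] over its compact subsets, and there the
    masses converge. Together with [vague_limit_compact] this is the semicontinuity through which
    the limit is accessed afterwards. *)
Lemma vague_limit_open (U : set Rd) (c : R) : open U -> (\forall n \near F, (mu n U <= c%:E)%E) ->
  (vague_limit U <= c%:E)%E.
Proof.
move=> oU Hc; apply: (le_trans (@vague_mus_le1 U U _)) => //.
rewrite /rho; case: asboolP => // _; apply: ge_ereal_sup => _ [K [cK KU] <-].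
rewrite lee_fin; apply: (cvgr_to_le (vague_lam_cvg cK)); apply: filterS Hc => n Hc.
have le := @measure_mono _ _ _ (mu n) _ _ (measurable_compact cK) (measurable_open oU) KU.
rewrite -lee_fin fineK; first exact: le_trans Hc.
by rewrite ge0_fin_numE//; exact: vague_lty (bounded_compact cK) (measurable_compact cK).
Qed.

(** Given an open cover of [K], compactness splits [K] into finitely many compact pieces, each
    inside one member, and finite subadditivity of [lam] bounds [lam K] by the sum over the cover.
    For points off [K] the chosen pair [(0, 1)] is a dummy. *)
Lemma vague_limit_compact (K : set Rd) (c : R) : compact K -> (\forall n \near F, (c%:E <= mu n K)%E) ->
  (c%:E <= vague_limit K)%E.
Proof.
move=> cK Hc; apply: (@le_trans _ _ (lam K)%:E).
  rewrite lee_fin; apply: (cvgr_to_ge (vague_lam_cvg cK)); apply: filterS Hc => n Hc.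
  rewrite -lee_fin fineK//.
  by rewrite ge0_fin_numE//; exact: vague_lty (bounded_compact cK) (measurable_compact cK).
apply: le_ereal_inf_tmp => _ [U [_ KU] <-].
have [[i noU]|oU] := pselect (exists i, ~ open (U i)).
  rewrite (eseries_pinfty (k := i)) ?leey//.
    by move=> n _; rewrite -ltNye; apply: lt_le_trans (vague_rho_ge0 _); rewrite ltNy0.
  by rewrite /rho; case: asboolP.
have {}oU i : open (U i) by apply: contrapT => ?; apply: oU; exists i.
have H (x : Rd) : exists ir : nat * R, 0 < ir.2 /\ (K x -> closed_ball x ir.2 `<=` U ir.1).
  have [Kx|] := pselect (K x); last by exists (0%N, 1); split=> /=.
  have [i _ Uix] := KU _ Kx.
  have /nbhs_closedballP[r rU] := oU i _ Uix.
  by exists (i, r%:num); split=> /=.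
have [g Hg] := choice H.
have := cK; rewrite compact_cover => /(_ _ K (fun x => ball x (g x).2)).
case=> [x Kx|x Kx|D DK KD].
- by apply: ball_open; have [] := Hg x.
- by exists x => //; apply: ballxx; have [] := Hg x.
(* Pieces are grouped by the member that contains them: one [U i] may serve several balls, but
   [rho (U i)] occurs only once in the sum. *)
pose L i := \big[setU/set0]_(x <- finmap.enum_fset D | (g x).1 == i) (K `&` closed_ball x (g x).2).
have cL i : compact (L i).
  apply: bigsetU_compact => x _.
  apply: (@subclosed_compact _ _ K) => //.
  apply: closedI; last exact: closed_ball_closed.
  by apply: compact_closed => //; exact: norm_hausdorff.
have LU i : L i `<=` U i.
  rewrite /L -bigcup_seq_cond => y [x /= /andP[xD /eqP <-]] [Ky]; apply: (Hg x).2.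
  by have := DK x xD; rewrite inE.
pose N := (\max_(x <- finmap.enum_fset D) (g x).1).+1.
have KL : K `<=` \big[setU/set0]_(i < N) L i.
  move=> y Ky; have [x xD yx] := KD y Ky; rewrite -bigcup_mkord.
  exists (g x).1.
    by rewrite /= ltnS; apply: leq_bigmax_seq.
  rewrite /L -bigcup_seq_cond; exists x; first by rewrite /= xD eqxx.
  by split=> //; exact: subset_closed_ball.
have cUL n : compact (\big[setU/set0]_(i < n) L i) by apply: bigsetU_compact.
apply: (@le_trans _ _ (\sum_(0 <= i < N) rho (U i))%E); last first.
  by apply: nneseries_lim_ge => i _ _; exact: vague_rho_ge0.
apply: (@le_trans _ _ (lam (\big[setU/set0]_(i < N) L i))%:E).
  by rewrite lee_fin; exact: vague_lam_mono.
elim: N {KL} => [|n IH]; first by rewrite big_ord0 vague_lam0 big_geq.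
rewrite big_ord_recr/= big_nat_recr//=.
apply: (@le_trans _ _ ((lam (\big[setU/set0]_(i < n) L i))%:E + (lam (L n))%:E)%E).
  by rewrite -EFinD lee_fin; have := vague_lamU (cUL n) (cL n).
by apply: leeD => //; exact: (vague_rho_ge (cL n) (@LU n)).
Qed.

End VagueLimit.

(** * Comparison of integrals through superlevel sets *)

Lemma layer_le (R : realType) (N : nat) (h y : R) : 0 < h -> 0 <= y ->
  h * \sum_(k < N) ((k.+1%:R * h <= y)%R%:R : R) <= y.
Proof.
move=> h0 y0; elim: N => [|N IH]; first by rewrite big_ord0 mulr0.
have [Ny|yN] := leP (N.+1%:R * h) y; last first.
  have E : (N.+1%:R * h <= y) = false by rewrite leNgt yN.
  by rewrite big_ord_recr/= E addr0.
apply: le_trans Ny; rewrite mulrC ler_pM2r//.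
apply: (@le_trans _ _ (\sum_(k < N.+1) 1)); last by rewrite sumr_const card_ord.
by apply: ler_sum => k _; rewrite lern1 leq_b1.
Qed.

(** Counterpart of [layer_le], whose levels are non-strict: strict superlevel sets of a continuous
    function are open and non-strict ones closed, as the two semicontinuity bounds require. The
    remainder is [Num.min y h] rather than [h], since it is integrated against measures of possibly
    infinite mass. *)
Lemma layer_ge (R : realType) (N : nat) (h y : R) : 0 < h -> 0 <= y -> y <= N.+1%:R * h ->
  y <= h * \sum_(k < N) ((k.+1%:R * h < y)%R%:R : R) + Num.min y h.
Proof.
move=> h0 y0; elim: N => [|N IH] yN.
  by rewrite big_ord0 mulr0 add0r; move: yN; rewrite mul1r => yh; rewrite min_l.
have [Ny|Ny] := ltP (N.+1%:R * h) y; last first.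
  apply: (le_trans (IH Ny)); rewrite lerD2r ler_pM2l// big_ord_recr/= lerDl.
  by case: ltP.
have hy k : (k < N.+1)%N -> k.+1%:R * h < y.
  by move=> kN; apply: le_lt_trans Ny; rewrite ler_pM2r// ler_nat.
rewrite min_r; last by apply/ltW; have := hy 0%N isT; rewrite mul1r.
rewrite (eq_bigr (fun=> 1)); last by move=> k _; rewrite hy.
rewrite sumr_const card_ord; apply: (le_trans yN).
by rewrite -[N.+2%:R]natr1 mulrDl mul1r lerD2r mulrC.
Qed.

Section VagueIntegral.
Variables (R : realType) (d : nat).
Local Notation Rd := 'rV[R]_d.
Local Notation Bd := (RdBorel R d).
Local Notation p := d.*2.+1.
Variable C : R.
Hypothesis C0 : 0 <= C.

Lemma integrable_decay_le (m : {measure set Bd -> \bar R}) (u : Rd -> R) (A : R) q :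
  (forall x : Rd, m (ball x 1) <= C%:E)%E -> measurable_fun setT (u : Bd -> R) ->
  (d.*2 < q)%N -> 0 <= A -> (forall x, `|u x| <= A * decay q x) ->
  m.-integrable setT (EFin \o (u : Bd -> R)).
Proof.
move=> Hm mu dq A0 uA; apply: (@le_integrable _ Bd R m setT measurableT _ (fun x => (A * decay q x)%:E)) => //.
- exact/measurable_EFinP.
- move=> x _ /=; rewrite lee_fin [leRHS]ger0_norm; first exact: uA.
  by rewrite mulr_ge0// decay_ge0.
apply: (@integrableZl _ Bd R m setT measurableT A (fun x => (decay q x)%:E)).
apply/integrableP; split.
  by apply/measurable_EFinP; exact: measurable_decay.
under eq_integral do rewrite /= ger0_norm ?decay_ge0//.
by apply: le_lt_trans (integral_decay C0 Hm dq) _; rewrite ltry.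
Qed.

Lemma decay_le1 q (x : Rd) : decay q x <= 1.
Proof.
by rewrite invf_le1 ?exprn_gt0 ?ltr_pwDl// exprn_ege1// lerDl.
Qed.

Lemma decayM q r (x : Rd) : decay q x * decay r x = decay (q + r) x.
Proof. by rewrite /decay exprD invfM. Qed.

Section Nonneg.
Variables (g : Rd -> R) (A : R).
Hypotheses (gc : continuous g) (g0 : forall x, 0 <= g x) (A0 : 0 <= A).
Hypothesis gA : forall x, g x <= A * decay (p + p) x.

Let mg : measurable_fun setT (g : Bd -> R).
Proof. exact: continuous_measurable. Qed.

Lemma superlevel_open c : open [set x | c < g x].
Proof. by apply: (@open_comp _ _ g [set y | c < y]) => // x _; exact: gc. Qed.

Lemma superlevel_closed c : closed [set x | c <= g x].
Proof. by apply: (@closed_comp _ _ g [set y | c <= y]) => // x _; exact: gc. Qed.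

Lemma superlevel_bounded c : 0 < c -> bounded_set [set x | c <= g x].
Proof.
move=> c0; exists (A / c); split; first exact: num_real.
move=> M MM x /= cg; apply/ltW/(le_lt_trans _ MM).
rewrite ler_pdivlMr//; apply: (@le_trans _ _ ((1 + `|x|) * g x)).
  by apply: ler_pM => //; [exact: ltW|rewrite lerDr].
apply: (@le_trans _ _ ((1 + `|x|) * (A * decay (p + p) x))).
  by rewrite ler_wpM2l// addr_ge0.
rewrite /decay addSn exprS invfM mulrCA -[leRHS]mulr1 ler_wpM2l// mulrA divff ?gt_eqF ?ltr_pwDl// mul1r.
exact: (decay_le1 (d.*2 + p)).
Qed.

Lemma superlevel_compact c : 0 < c -> compact [set x | c <= g x].
Proof.
by move=> c0; apply: bounded_closed_compact; [exact: superlevel_bounded|exact: superlevel_closed].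
Qed.

Lemma integral_levels (m : {measure set Bd -> \bar R}) (N : nat) (h : R) (D : nat -> set Rd) :
  0 <= h -> (forall k, measurable (D k : set Bd)) ->
  (\int[m]_x (h * \sum_(k < N) \1_(D k) x)%:E = \sum_(k < N) h%:E * m (D k))%E.
Proof.
move=> h0 mD.
under eq_integral do rewrite mulr_sumr -sumEFin.
rewrite ge0_integral_sum//; last 2 first.
- by move=> k; apply/measurable_EFinP; apply: measurable_funM => //; exact: measurable_indic.
- by move=> k x _; rewrite lee_fin mulr_ge0.
apply: eq_bigr => k _; under eq_integral do rewrite EFinM.
rewrite ge0_integralZl ?lee_fin//; last first.
  by apply/measurable_EFinP; exact: measurable_indic.
by rewrite integral_indic// setIT.
Qed.

(* With [w = decay p] and [g <= A w^2], either [w <= s] and [g <= A s w], or [s < w] and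
   [s^2 <= s w]. *)
Lemma min_decay (s : R) x : 0 < s -> Num.min (g x) (s ^+ 2) <= (A + 1) * s * decay p x.
Proof.
move=> s0; have gw := gA x; rewrite -decayM in gw.
have w0 := decay_ge0 p x; set w := decay p x in w0 gw *.
have sw0 : 0 <= s * w by rewrite mulr_ge0// ltW.
have -> : (A + 1) * s * w = A * (s * w) + s * w by ring.
have [ws|sw] := leP w s; rewrite ge_min; apply/orP.
  left; apply: (le_trans gw); apply: ler_wpDr => //.
  by rewrite ler_wpM2l// ler_wpM2r.
right; apply: ler_wpDl; first exact: mulr_ge0.
by rewrite expr2 ler_pM2l// ltW.
Qed.

(** Stated for two arbitrary measures and used twice, with the limit and the [n]-th measure
    exchanged. With layers of height [s ^+ 2], each of the [N] levels costs [s ^+ 2 * e], and the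
    remainder [Num.min (g x) (s ^+ 2)] costs a term linear in [s] by [min_decay]. *)
Lemma vague_compare (m m' : {measure set Bd -> \bar R}) (s e : R) (N : nat) :
  (forall x : Rd, m (ball x 1) <= C%:E)%E -> (forall x : Rd, m' (ball x 1) <= C%:E)%E ->
  0 < s -> 0 <= e -> A <= N.+1%:R * s ^+ 2 ->
  (forall k, (k < N)%N -> m [set x | (k.+1%:R * s ^+ 2 < g x)%R] <=
     m' [set x | (k.+1%:R * s ^+ 2 <= g x)%R] + e%:E)%E ->
  (\int[m]_x (g x)%:E <= \int[m']_x (g x)%:E +
     (N%:R * s ^+ 2 * e + (A + 1) * s * (2 ^+ p.+1 * C))%:E)%E.
Proof.
move=> Hm Hm' s0 e0 AN H; set h := s ^+ 2 in AN H *.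
have h0 : 0 < h by rewrite exprn_gt0.
pose D k : set Rd := [set x | k.+1%:R * h < g x].
pose D' k : set Rd := [set x | k.+1%:R * h <= g x].
have mD k : measurable (D k : set Bd) by apply: measurable_open; exact: superlevel_open.
have mD' k : measurable (D' k : set Bd) by apply: measurable_closed; exact: superlevel_closed.
have mS (B : nat -> set Rd) : (forall k, measurable (B k : set Bd)) ->
    measurable_fun setT ((fun x => h * \sum_(k < N) \1_(B k) x) : Bd -> R).
  by move=> mB; apply: measurable_funM => //; apply: measurable_sum => k; exact: measurable_indic.
apply: (@le_trans _ _ (\int[m]_x ((h * \sum_(k < N) \1_(D k) x)%:E + ((A + 1) * s * decay p x)%:E))%E).
  apply: ge0_le_integral => //.
  - by move=> x _; rewrite lee_fin.
  - exact/measurable_EFinP.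
  - apply: emeasurable_funD; apply/measurable_EFinP; first exact: mS.
    by apply: measurable_funM => //; exact: measurable_decay.
  - move=> x _; rewrite -EFinD lee_fin.
    apply: (le_trans (@layer_ge R N h (g x) h0 (g0 x) _)).
      apply: (le_trans (gA x)); apply: le_trans AN.
      by rewrite ler_piMr// decay_le1.
    apply: lerD; last exact: min_decay.
    rewrite ler_pM2l//; apply: ler_sum => k _; rewrite indicE.
    by rewrite ler_nat leq_b1 || (case: (boolP (_ < _)) => // kg; rewrite mem_set).
rewrite ge0_integralD//; last 4 first.
- by move=> x _; rewrite lee_fin mulr_ge0 ?sumr_ge0// ltW.
- by apply/measurable_EFinP; exact: mS.
- by move=> x _; rewrite lee_fin !mulr_ge0 ?decay_ge0 ?addr_ge0// ltW.
- by apply/measurable_EFinP/measurable_funM => //; exact: measurable_decay.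
rewrite integral_levels ?(ltW h0)//.
rewrite EFinD [leRHS]addeA; apply: leeD; last first.
  under eq_integral do rewrite EFinM.
  rewrite ge0_integralZl ?lee_fin ?mulr_ge0 ?addr_ge0 ?(ltW s0)//; last 2 first.
  - by apply/measurable_EFinP; exact: measurable_decay.
  - by move=> x _; rewrite lee_fin decay_ge0.
  rewrite [leRHS]EFinM; apply: lee_wpmul2l; last exact: integral_decay.
  by rewrite lee_fin mulr_ge0 ?addr_ge0 ?(ltW s0).
apply: (@le_trans _ _ (\sum_(k < N) (h%:E * m' (D' k) + (h * e)%:E))%E).
  apply: lee_sum => k _.
  have -> : (h%:E * m' (D' k) + (h * e)%:E = h%:E * (m' (D' k) + e%:E))%E.
    by rewrite ge0_muleDr ?lee_fin.
  by rewrite lee_wpmul2l ?lee_fin ?(ltW h0)//; exact: H.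
rewrite big_split/= sumEFin sumr_const card_ord.
apply: leeD; last by rewrite lee_fin -mulrA -[leLHS]mulr_natl.
rewrite -integral_levels ?(ltW h0)//; apply: ge0_le_integral => //.
- by move=> x _; rewrite lee_fin mulr_ge0 ?sumr_ge0// ltW.
- by apply/measurable_EFinP; exact: mS.
- exact/measurable_EFinP.
- move=> x _; rewrite lee_fin; apply: le_trans (@layer_le R N h (g x) h0 (g0 x)).
  rewrite ler_pM2l//; apply: ler_sum => k _; rewrite indicE ler_nat.
  by case: (boolP (x \in _)) => // /set_mem ->.
Qed.

End Nonneg.
End VagueIntegral.

(** * Convergence of integrals of continuous decaying functions *)

Section VagueConvergence.
Variables (R : realType) (d : nat).
Local Notation Rd := 'rV[R]_d.
Local Notation Bd := (RdBorel R d).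
Local Notation p := d.*2.+1.
Variables (F : set_system nat) (mu : nat -> {measure set Bd -> \bar R}) (C : R).
Hypothesis FU : UltraFilter F.
Hypothesis C0 : 0 <= C.
Hypothesis Hmu : forall n (x : Rd), (mu n (ball x 1) <= C%:E)%E.

Let nu := vague_limit FU C0 Hmu.
Let PF : ProperFilter F := @ultra_proper _ F FU.

Lemma vague_limit_ball (x : Rd) : (nu (ball x 1) <= C%:E)%E.
Proof.
apply: vague_limit_open; first exact: ball_open.
exact: filterE.
Qed.

Lemma vague_limit_lty (A : set Rd) : bounded_set A -> borel_set A -> (nu A < +oo)%E.
Proof.
move=> bA mA; exact: (@vague_lty R d (fun=> nu) C C0 (fun _ => vague_limit_ball) 0%N A bA mA).
Qed.

(** If the bound fails to be eventual then its negation is eventual, because [F] is an ultrafilter;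
    [vague_limit_open] would then give [nu U <= nu U - e]. The compact case is dual. *)
Lemma vague_open_near (U : set Rd) (e : R) : open U -> bounded_set U -> 0 < e ->
  \forall n \near F, (nu U <= mu n U + e%:E)%E.
Proof.
move=> oU bU e0; have mU := measurable_open oU.
have [//|H] := @in_ultra_setVsetC _ F [set n | (nu U <= mu n U + e%:E)%E] FU.
have Ufin : nu U \is a fin_num by rewrite ge0_fin_numE//; exact: vague_limit_lty.
suff : (nu U <= (fine (nu U) - e)%:E)%E.
  by rewrite -[X in (X <= _)%E](fineK Ufin) lee_fin => H'; exfalso; lra.
apply: vague_limit_open => //; apply: filterS H => n /negP; rewrite -ltNge => H.
by rewrite EFinB fineK// leeBrDr// ltW.
Qed.

Lemma vague_compact_near (K : set Rd) (e : R) : compact K -> 0 < e ->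
  \forall n \near F, (mu n K <= nu K + e%:E)%E.
Proof.
move=> cK e0; have mK := measurable_compact cK; have bK := bounded_compact cK.
have [//|H] := @in_ultra_setVsetC _ F [set n | (mu n K <= nu K + e%:E)%E] FU.
have Kfin : nu K \is a fin_num by rewrite ge0_fin_numE//; exact: vague_limit_lty.
suff : ((fine (nu K) + e)%:E <= nu K)%E.
  by rewrite -[X in (_ <= X)%E](fineK Kfin) lee_fin => H'; exfalso; lra.
apply: vague_limit_compact => //; apply: filterS H => n /negP; rewrite -ltNge => H.
by rewrite EFinD fineK// ltW.
Qed.

Lemma vague_cvg_nonneg (g : Rd -> R) (A : R) : continuous g -> (forall x, 0 <= g x) -> 0 <= A ->
  (forall x, g x <= A * decay (p + p) x) ->
  (fun n => fine (\int[mu n]_x (g x)%:E)%E) @ F --> fine (\int[nu]_x (g x)%:E)%E.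
Proof.
move=> gc g0 A0 gA; apply/cvgrPdist_le => e e0.
pose B := 2 ^+ p.+1 * C; have B0 : 0 <= B by rewrite mulr_ge0// exprn_ge0.
(* Makes the remainder term at most [e / 2]; [e'] below does the same for the levels, and [N] lets
   the layers reach [A], which bounds [g]. *)
pose s := e / 2 / ((A + 1) * B + 1).
have D0 : 0 < (A + 1) * B + 1 by rewrite ltr_wpDl// mulr_ge0// addr_ge0.
have s0 : 0 < s by rewrite !divr_gt0.
pose N := Num.truncn (A / s ^+ 2).
have AN : A <= N.+1%:R * s ^+ 2.
  by rewrite -ler_pdivrMr ?exprn_gt0// ltW// truncnS_gt.
pose e' := e / 2 / (N.+1%:R * s ^+ 2).
have Ns0 : 0 < N.+1%:R * s ^+ 2 by rewrite mulr_gt0// exprn_gt0.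
have e'0 : 0 < e' by rewrite !divr_gt0.
have err : N%:R * s ^+ 2 * e' + (A + 1) * s * B <= e.
  rewrite (splitr e); apply: lerD.
    rewrite /e' mulrA ler_pdivrMr// mulrC ler_wpM2l// ?divr_ge0 ?(ltW e0)//.
    by rewrite ler_wpM2r ?exprn_ge0 ?(ltW s0)// ler_nat.
  have -> : (A + 1) * s * B = e / 2 * (((A + 1) * B) / ((A + 1) * B + 1)).
    by rewrite /s; field; rewrite gt_eqF.
  by rewrite ler_piMr ?divr_ge0 ?(ltW e0)// ler_pdivrMr// mul1r lerDl.
have sub k : [set x | k.+1%:R * s ^+ 2 < g x] `<=` [set x | k.+1%:R * s ^+ 2 <= g x].
  by move=> x /= /ltW.
have ks0 (k : nat) : 0 < k.+1%:R * s ^+ 2 by rewrite mulr_gt0// exprn_gt0.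
have bK k := superlevel_bounded A0 gA (ks0 k).
have cK k := superlevel_compact gc A0 gA (ks0 k).
have oU (k : nat) := @superlevel_open _ _ g gc (k.+1%:R * s ^+ 2).
have subm (m : {measure set Bd -> \bar R}) k :
    (m [set x | (k.+1%:R * s ^+ 2 < g x)%R] <= m [set x | (k.+1%:R * s ^+ 2 <= g x)%R])%E.
  apply: (@measure_mono _ Bd R m) => //.
    exact: measurable_open.
  exact: measurable_compact.
have int_fin (m : {measure set Bd -> \bar R}) : (forall x : Rd, m (ball x 1) <= C%:E)%E ->
    (\int[m]_x (g x)%:E)%E \is a fin_num.
  move=> Hm; have dp : (d.*2 < p + p)%N by rewrite addSn ltnS leq_addr.
  apply: integrable_fin_num => //.
  apply: (integrable_decay_le C0 Hm (continuous_measurable gc) dp A0) => x.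
  by rewrite ger0_norm.
have H1 : \forall n \near F, forall k : 'I_N,
    (nu [set x | (k.+1%:R * s ^+ 2 < g x)%R] <= mu n [set x | (k.+1%:R * s ^+ 2 <= g x)%R] + e'%:E)%E.
  apply: filter_forall => k.
  have bU : bounded_set [set x | k.+1%:R * s ^+ 2 < g x] by exact: bounded_subset (bK k).
  apply: filterS (vague_open_near (oU k) bU e'0) => n H.
  by apply: (le_trans H); rewrite leeD2r.
have H2 : \forall n \near F, forall k : 'I_N,
    (mu n [set x | (k.+1%:R * s ^+ 2 < g x)%R] <= nu [set x | (k.+1%:R * s ^+ 2 <= g x)%R] + e'%:E)%E.
  apply: filter_forall => k.
  apply: filterS (vague_compact_near (cK k) e'0) => n H.
  by apply: le_trans H.
apply: filterS2 H1 H2 => n H1 H2.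
have F1 := int_fin _ (Hmu n); have F2 := int_fin _ vague_limit_ball.
have := @vague_compare R d C C0 g A gc g0 A0 gA nu (mu n) s e' N vague_limit_ball (Hmu n) s0 (ltW e'0) AN
  (fun k kN => H1 (Ordinal kN)).
have := @vague_compare R d C C0 g A gc g0 A0 gA (mu n) nu s e' N (Hmu n) vague_limit_ball s0 (ltW e'0) AN
  (fun k kN => H2 (Ordinal kN)).
rewrite -/B -(fineK F1) -(fineK F2) -!EFinD !lee_fin /= => K1 K2.
by rewrite ler_distl; apply/andP; split; lra.
Qed.

(** [u] is half the difference of the nonnegative continuous functions [|u| + u] and [|u| - u]. The
    weight [decay (p + p)] is the square of the integrable weight [decay p] of [min_decay]. *)
Lemma vague_cvg (u : Rd -> R) (A : R) : continuous u -> 0 <= A ->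
  (forall x, `|u x| <= A * decay (p + p) x) ->
  (fun n => Rintegral (mu n) setT u) @ F --> Rintegral nu setT u.
Proof.
move=> uc A0 uA.
pose f x := (`|u x| + u x); pose g x := (`|u x| - u x).
have nc : continuous (fun x => `|u x|).
  by move=> x; exact: (@continuous_comp Rd R R u (fun y => `|y|) x (uc x) (@norm_continuous R R (u x))).
have fc : continuous f by move=> x; exact: (@continuousD _ _ _ _ _ x (nc x) (uc x)).
have gc : continuous g by move=> x; exact: (@continuousB _ _ _ _ _ x (nc x) (uc x)).
have A20 : 0 <= 2 * A by rewrite mulr_ge0.
have f0 x : 0 <= f x by rewrite /f; have := ler_norm (- u x); rewrite normrN; lra.
have g0 x : 0 <= g x by rewrite /g subr_ge0 ler_norm.
have fA x : f x <= (2 * A) * decay (p + p) x.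
  by rewrite /f; have := uA x; have := ler_norm (u x); lra.
have gA x : g x <= (2 * A) * decay (p + p) x.
  by rewrite /g; have := uA x; have := ler_norm (- u x); rewrite normrN; lra.
have E (m : {measure set Bd -> \bar R}) : (forall x : Rd, m (ball x 1) <= C%:E)%E ->
    Rintegral m setT u = 2^-1 * (fine (\int[m]_x (f x)%:E)%E - fine (\int[m]_x (g x)%:E)%E).
  move=> Hm; have dp : (d.*2 < p + p)%N by rewrite addSn ltnS leq_addr.
  have If : m.-integrable setT (EFin \o (f : Bd -> R)).
    by apply: (integrable_decay_le C0 Hm (continuous_measurable fc) dp A20) => x; rewrite ger0_norm.
  have Ig : m.-integrable setT (EFin \o (g : Bd -> R)).
    by apply: (integrable_decay_le C0 Hm (continuous_measurable gc) dp A20) => x; rewrite ger0_norm.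
  have -> : fine (\int[m]_x (f x)%:E)%E - fine (\int[m]_x (g x)%:E)%E = Rintegral m setT (fun x => f x - g x).
    by rewrite RintegralB.
  rewrite -RintegralZl//; last exact: (@integrableB _ Bd R m setT measurableT _ _ If Ig).
  by apply: eq_Rintegral => x _; rewrite /f /g; lra.
rewrite (E nu vague_limit_ball).
rewrite (_ : (fun n => _) = (fun n => 2^-1 * (fine (\int[mu n]_x (f x)%:E)%E - fine (\int[mu n]_x (g x)%:E)%E))); last first.
  by apply/funext => n; exact: E.
apply: cvgM; first exact: cvg_cst.
by apply: cvgB; [exact: (vague_cvg_nonneg fc f0 A20 fA)|exact: (vague_cvg_nonneg gc g0 A20 gA)].
Qed.

End VagueConvergence.

(** * Mean value estimates along lines, and the inner product *)

Lemma mvt_le (R : realType) (f df : R -> R) (a b M : R) :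
  (forall x : R, is_derive x 1 f (df x)) ->
  (forall x, `|x - a| <= `|b - a| -> `|df x| <= M) -> `|f b - f a| <= M * `|b - a|.
Proof.
move=> Hf HM; have cf x : {for x, continuous f}.
  by apply/differentiable_continuous/derivable1_diffP; exact: (@ex_derive _ _ _ _ _ _ _ (Hf x)).
have H (x y : R) : x <= y -> exists2 c, c \in `[x, y]%R & f y - f x = df c * (y - x).
  move=> xy; apply: MVT_segment => //.
  exact: continuous_subspaceT.
have [ab|/ltW ba] := leP a b.
  have [c] := H _ _ ab; rewrite in_itv/= => /andP[ac cb] ->.
  by rewrite normrM ler_wpM2r// HM// !ger0_norm ?subr_ge0// lerD2r.
have [c] := H _ _ ba; rewrite in_itv/= => /andP[bc ca] E.
rewrite distrC E normrM [`|a - b|]distrC ler_wpM2r// HM// !ler0_norm ?subr_le0//.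
by rewrite !opprB lerD2l lerN2.
Qed.

Lemma cos_lip (R : realType) (a b : R) : `|cos b - cos a| <= `|b - a|.
Proof.
rewrite -[leRHS]mul1r; apply: (@mvt_le R _ (fun x => - sin x)) => // x _.
by rewrite normrN ler_norml sin_geN1 sin_le1.
Qed.

Lemma sin_lip (R : realType) (a b : R) : `|sin b - sin a| <= `|b - a|.
Proof.
rewrite -[leRHS]mul1r; apply: (@mvt_le R _ (fun x => cos x)) => // x _.
by rewrite ler_norml cos_geN1 cos_le1.
Qed.

Section Lines.
Variables (R : realType) (d : nat).
Local Notation Rd := 'rV[R]_d.
Local Notation e_ j := ('e_j : Rd).

Lemma is_derive_line (u : Rd -> R) (j : 'I_d) (x : Rd) (t : R) :
  (forall a : Rd, derivable u a 'e_j) ->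
  is_derive t 1 (fun t => u (x + t *: 'e_j)) (pderiv j u (x + t *: 'e_j)).
Proof.
move=> Hu; have H := Hu (x + t *: 'e_j).
have E : (fun h : R => h^-1 *: (((fun t => u (x + t *: 'e_j)) \o shift t) (h *: (1 : R)) - u (x + t *: 'e_j))) =
  (fun h : R => h^-1 *: ((u \o shift (x + t *: 'e_j)) (h *: 'e_j) - u (x + t *: 'e_j))).
  apply/funext => h /=; congr (_ *: (u _ - _)).
  by rewrite scalerDl addrCA [_ *: 1]mulr1.
split; first by rewrite /derivable E.
by rewrite /derive /pderiv /derive E.
Qed.

Lemma lipschitz_rV_continuous (u : Rd -> R) (L : R) :
  (forall x y : Rd, `|u x - u y| <= L * `|x - y|) -> continuous u.
Proof.
move=> H x; apply/(@cvgrPdist_le _ _ _ (nbhs (x : Rd)) (nbhs_filter (x : Rd))) => e e0.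
have L0 : 0 < `|L| + 1 by rewrite ltr_wpDl.
have del0 : 0 < e / (`|L| + 1) by rewrite divr_gt0.
apply: (@filterS _ (nbhs (x : Rd)) (nbhs_filter (x : Rd)) _ _ _ (nbhsx_ballx (x : Rd) _ del0)).
move=> y /ball_norm xy; apply: (le_trans (H x y)).
apply: (@le_trans _ _ ((`|L| + 1) * `|x - y|)).
  by rewrite ler_wpM2r// ler_wpDr// ler_norm.
by rewrite mulrC -ler_pdivlMr// ltW.
Qed.

Lemma continuous_abs_rV (u : Rd -> R) : continuous u -> continuous (fun x => `|u x|).
Proof.
by move=> cu x; exact: (@continuous_comp Rd R R u (fun y => `|y|) x (cu x) (@norm_continuous R R (u x))).
Qed.

Lemma norm_delta (j : 'I_d) : `|'e_j : Rd| <= 1.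
Proof.
apply/norm_leP => // i; rewrite mxE eqxx/=; case: eqP => _; by rewrite ?normr1 ?normr0.
Qed.

(** [schwartz] speaks of directional derivatives, so continuity has to be extracted from them.
    Changing one coordinate at a time gives the Lipschitz constant [B *+ d]. *)
Lemma bounded_partials_continuous (u : Rd -> R) (B : R) :
  (forall (a : Rd) j, derivable u a 'e_j) -> (forall j (a : Rd), `|pderiv j u a| <= B) -> continuous u.
Proof.
move=> Hu HB; apply: (@lipschitz_rV_continuous _ (B *+ d)) => x y.
have step j (a : Rd) (t : R) : `|u (a + t *: 'e_j) - u a| <= B * `|t|.
  have := @mvt_le R (fun t => u (a + t *: 'e_j)) _ 0 t B (fun s => is_derive_line a s (Hu^~ j)).
  by rewrite !subr0 scale0r addr0; apply => s _; exact: HB.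
have path (s : seq 'I_d) (a : Rd) (v : 'I_d -> R) :
    `|u (a + \sum_(j <- s) v j *: 'e_j) - u a| <= \sum_(j <- s) B * `|v j|.
  elim: s a => [|j s IH] a; first by rewrite !big_nil addr0 subrr normr0.
  rewrite !big_cons addrA.
  have -> : u (a + v j *: 'e_j + \sum_(j <- s) v j *: 'e_j) - u a =
    (u (a + v j *: 'e_j + \sum_(j <- s) v j *: 'e_j) - u (a + v j *: 'e_j)) + (u (a + v j *: 'e_j) - u a).
    by rewrite addrA subrK.
  by apply: (le_trans (ler_normD _ _)); rewrite addrC lerD.
have := path (index_enum _) y (fun j => (x - y) 0 j).
have -> : y + \sum_j (x - y) 0 j *: 'e_j = x by rewrite -row_sum_delta addrC subrK.
move=> /le_trans; apply.
have B0 : (0 < d)%N -> 0 <= B by move=> d0; exact: le_trans (HB (Ordinal d0) 0).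
apply: (@le_trans _ _ (\sum_(j < d) B * `|x - y|)).
  apply: ler_sum => j _; rewrite ler_wpM2l ?le_coord_norm// B0//.
  exact: leq_ltn_trans (ltn_ord j).
by rewrite sumr_const card_ord mulrnAl.
Qed.

End Lines.

Section Dot.
Variables (R : realType) (d : nat).
Local Notation Rd := 'rV[R]_d.
Implicit Types (t x y : Rd).

Lemma dotvDr t x y : dotv t (x + y) = dotv t x + dotv t y.
Proof. by rewrite /dotv -big_split; apply: eq_bigr => i _; rewrite mxE mulrDr. Qed.

Lemma dotvC t x : dotv t x = dotv x t.
Proof. by apply: eq_bigr => i _; rewrite mulrC. Qed.

Lemma dotvDl t x y : dotv (x + y) t = dotv x t + dotv y t.
Proof. by rewrite dotvC dotvDr !(dotvC t). Qed.

Lemma dotvZr t x (c : R) : dotv t (c *: x) = c * dotv t x.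
Proof. by rewrite /dotv mulr_sumr; apply: eq_bigr => i _; rewrite mxE mulrCA. Qed.

Lemma dotvNr t x : dotv t (- x) = - dotv t x.
Proof. by rewrite -scaleN1r dotvZr mulN1r. Qed.

Lemma dotvNl t x : dotv (- x) t = - dotv x t.
Proof. by rewrite dotvC dotvNr dotvC. Qed.

Lemma dotvBl t x y : dotv (x - y) t = dotv x t - dotv y t.
Proof. by rewrite dotvDl dotvNl. Qed.

Lemma dotvBr t x y : dotv t (x - y) = dotv t x - dotv t y.
Proof. by rewrite dotvDr dotvNr. Qed.

Lemma dotv_delta t j : dotv t ('e_j : Rd) = t 0 j.
Proof.
rewrite /dotv (bigD1 j)//= mxE !eqxx mulr1 big1 ?addr0// => i /negPf ij.
by rewrite mxE eqxx/= ij mulr0.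
Qed.

Lemma dotv0r t : dotv t 0 = 0.
Proof. by rewrite -[0 : Rd](scale0r 0) dotvZr mul0r. Qed.

Lemma dotv_le t x : `|dotv t x| <= d%:R * `|t| * `|x|.
Proof.
apply: (le_trans (ler_norm_sum _ _ _)).
apply: (@le_trans _ _ (\sum_(i < d) `|t| * `|x|)).
  by apply: ler_sum => i _; rewrite normrM ler_pM// le_coord_norm.
by rewrite sumr_const card_ord -mulrA mulr_natl.
Qed.

Lemma norm_le_normsq x : `|x| ^+ 2 <= normsq x.
Proof.
have [->|] := eqVneq `|x| 0.
  by rewrite expr0n/=; apply: sumr_ge0 => i _; rewrite -expr2 sqr_ge0.
rewrite -normr_gt0 normr_id => x0; have [j jx] := norm_geP x0 (lexx _).
apply: (@le_trans _ _ (`|x 0 j| ^+ 2)); first by rewrite lerXn2r// nnegrE.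
rewrite /normsq /dotv (bigD1 j)//= real_normK ?num_real// expr2 lerDl.
by apply: sumr_ge0 => i _; rewrite -expr2 sqr_ge0.
Qed.

Lemma dotv_continuous t : continuous (dotv t).
Proof.
apply: (@lipschitz_rV_continuous _ _ _ (d%:R * `|t|)) => x y.
by rewrite -dotvBr dotv_le.
Qed.

Lemma continuous_metric (u : Rd -> R) : continuous u -> forall x e, 0 < e ->
  exists2 del, 0 < del & forall y, `|x - y| < del -> `|u x - u y| < e.
Proof.
move=> cu x e e0.
have /(@cvgrPdist_lt _ _ _ (nbhs (x : Rd)) (nbhs_filter (x : Rd))) /(_ e e0) := cu x.
by move=> /nbhs_ballP[del /= del0 H]; exists del => // y xy; apply: H; exact/ball_norm.
Qed.

Lemma continuousM_rV (u v : Rd -> R) : continuous u -> continuous v -> continuous (fun x => u x * v x).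
Proof. by move=> cu cv x; exact: (@continuousM _ _ _ _ x (cu x) (cv x)). Qed.

Lemma continuousB_rV (u v : Rd -> R) : continuous u -> continuous v -> continuous (fun x => u x - v x).
Proof. by move=> cu cv x; exact: (@continuousB _ _ _ _ _ x (cu x) (cv x)). Qed.

Lemma continuousD_rV (u v : Rd -> R) : continuous u -> continuous v -> continuous (fun x => u x + v x).
Proof. by move=> cu cv x; exact: (@continuousD _ _ _ _ _ x (cu x) (cv x)). Qed.

Lemma continuous_cstM_rV (c : R) (u : Rd -> R) : continuous u -> continuous (fun x => c * u x).
Proof. by move=> cu; apply: continuousM_rV => // x; exact: cst_continuous. Qed.

Lemma cos_dotv_continuous t : continuous (fun x => cos (2 * pi * dotv t x)).
Proof.
move=> x; apply: (@continuous_comp Rd R R (fun x => 2 * pi * dotv t x) (@cos R) x).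
  exact: continuous_cstM_rV (@dotv_continuous t) x.
exact: continuous_cos.
Qed.

Lemma sin_dotv_continuous t : continuous (fun x => sin (2 * pi * dotv t x)).
Proof.
move=> x; apply: (@continuous_comp Rd R R (fun x => 2 * pi * dotv t x) (@sin R) x).
  exact: continuous_cstM_rV (@dotv_continuous t) x.
exact: continuous_sin.
Qed.

End Dot.

(** * Schwartz functions and translation-invariant integration *)

Section Schwartz.
Variables (R : realType) (d : nat).
Local Notation Rd := 'rV[R]_d.
Local Notation Bd := (RdBorel R d).

Lemma schwartz_pderiv (u : Rd -> R) j : schwartz u -> schwartz (pderiv j u).
Proof.
have E js : iter_pderiv js (pderiv j u) = iter_pderiv (rcons js j) u.
  by rewrite /iter_pderiv foldr_rcons.
by move=> [H1 H2]; split=> [js a i|js k]; rewrite E; [exact: H1|exact: H2].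
Qed.

(** Passage from the Euclidean weights of [schwartz] to the sup norm, by
    [1 + |x| <= 2 (1 + normsq x)]. *)
Lemma schwartz_decay (u : Rd -> R) q : schwartz u -> exists2 A, 0 <= A & forall x, `|u x| <= A * decay q x.
Proof.
move=> [_ /(_ [::] q)[C HC]].
have C0 : 0 <= C by apply: le_trans (HC 0); rewrite mulr_ge0// exprn_ge0// addr_ge0// -[normsq _]/(dotv 0 0) dotv0r.
exists (2 ^+ q * C) => [|x]; first by rewrite mulr_ge0// exprn_ge0.
have x0 : 0 < 1 + `|x| by rewrite ltr_pwDl.
rewrite /decay ler_pdivlMr ?exprn_gt0//.
have n0 : 0 <= normsq x by apply: le_trans (norm_le_normsq x); rewrite exprn_ge0.
apply: (@le_trans _ _ (2 ^+ q * ((1 + normsq x) ^+ q * `|u x|))); last first.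
  by rewrite ler_wpM2l ?exprn_ge0//; exact: HC.
rewrite mulrA mulrC ler_wpM2r// -exprMn lerXn2r ?nnegrE ?mulr_ge0 ?addr_ge0 ?(ltW x0)//.
have := norm_le_normsq x; have : 0 <= (`|x| - 1) ^+ 2 by exact: sqr_ge0.
by rewrite sqrrB; lra.
Qed.

Lemma schwartz_derivable (u : Rd -> R) : schwartz u -> forall (a : Rd) j, derivable u a 'e_j.
Proof. by move=> [H _] a j; exact: (H [::] a j). Qed.

Lemma schwartz_continuous (u : Rd -> R) : schwartz u -> continuous u.
Proof.
move=> su.
have H j : exists B, forall a, `|pderiv j u a| <= B.
  have [A A0 HA] := schwartz_decay 0 (schwartz_pderiv j su).
  by exists A => a; have := HA a; rewrite /decay expr0 invr1 mulr1.
have [B HB] := choice H.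
apply: (@bounded_partials_continuous R d u (\sum_j `|B j|)); first exact: schwartz_derivable.
move=> j a; apply: (le_trans (HB j a)); apply: (le_trans (ler_norm _)).
by rewrite (bigD1 j)//= lerDl sumr_ge0.
Qed.

Lemma decay_shift q (x v : Rd) : `|v| <= 1 -> decay q (x + v) <= 2 ^+ q * decay q x.
Proof.
move=> v1; have x0 : 0 < 1 + `|x| by rewrite ltr_pwDl.
have xv0 : 0 < 1 + `|x + v| by rewrite ltr_pwDl.
rewrite /decay ler_pdivlMr ?exprn_gt0// mulrC ler_pdivrMr ?exprn_gt0//.
rewrite -exprMn lerXn2r ?nnegrE ?mulr_ge0 ?(ltW x0) ?(ltW xv0)//.
have := ler_normB (x + v) v; rewrite addrK; have := normr_ge0 (x + v); lra.
Qed.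

Variables (mu : {measure set Bd -> \bar R}) (C : R).
Local Notation p := d.*2.+1.
Hypothesis C0 : 0 <= C.
Hypothesis Hball : forall x : Rd, (mu (ball x 1) <= C%:E)%E.
Hypothesis Hshift : translation_invariant mu.

Lemma integral_shift (f : Rd -> \bar R) (v : Rd) : measurable_fun setT (f : Bd -> \bar R) ->
  (\int[mu]_x f (x + v)%R = \int[mu]_x f x)%E.
Proof.
have H (g : Rd -> \bar R) : measurable_fun setT (g : Bd -> \bar R) -> (forall x, 0 <= g x)%E ->
  (\int[mu]_x g (x + v)%R = \int[mu]_x g x)%E.
  move=> mg g0.
  have := @ge0_integral_pushforward _ _ Bd Bd R (fun x => x + v) (measurable_shift v) mu setT g measurableT mg.
  rewrite preimage_setT => <-; last by move=> x _; exact: g0.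
  apply: eq_measure_integral => [|? A mA _]; [exact: measurable_shift|exact: Hshift].
move=> mf; rewrite integralE [RHS]integralE; congr (_ - _)%E.
  rewrite -(H (f^\+)%E); [by apply: eq_integral => x _; rewrite !funeposE|exact: measurable_funepos|by move=> x; exact: funepos_ge0].
rewrite -(H (f^\-)%E); [by apply: eq_integral => x _; rewrite !funenegE|exact: measurable_funeneg|by move=> x; exact: funeneg_ge0].
Qed.

Lemma Rintegral_shift (f : Rd -> R) (v : Rd) : measurable_fun setT (f : Bd -> R) ->
  Rintegral mu setT (fun x => f (x + v)) = Rintegral mu setT f.
Proof.
move=> mf; congr fine; apply: (integral_shift (f := EFin \o f) v).
exact/measurable_EFinP.
Qed.

Lemma measurable_fun_shift (f : Rd -> R) (v : Rd) : measurable_fun setT (f : Bd -> R) ->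
  measurable_fun setT ((fun x => f (x + v)) : Bd -> R).
Proof. by move=> mf; apply: (measurableT_comp mf (measurable_shift v)). Qed.

(* The integral of a difference quotient vanishes by translation invariance. *)
Lemma Rintegral_partial0 (phi psi : Rd -> R) (j : 'I_d) (A : R) :
  (forall x (t : R), is_derive t 1 (fun t => phi (x + t *: 'e_j)) (psi (x + t *: 'e_j))) ->
  continuous phi -> continuous psi -> 0 <= A ->
  (forall x, `|phi x| <= A * decay p x) -> (forall x, `|psi x| <= A * decay p x) ->
  Rintegral mu setT psi = 0.
Proof.
move=> Hd cphi cpsi A0 phiA psiA.
have mphi := continuous_measurable cphi.
have mpsi := continuous_measurable cpsi.
have dp : (d.*2 < p)%N by [].
have Iphi := integrable_decay_le C0 Hball mphi dp A0 phiA.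
pose h n : R := n.+1%:R^-1.
have h0 n : 0 < h n by rewrite invr_gt0.
have h1 n : h n <= 1 by rewrite invf_le1// ler1n.
pose f n (x : Rd) := (h n)^-1 * (phi (x + h n *: 'e_j) - phi x).
have mshift n : measurable_fun setT ((fun x => phi (x + h n *: 'e_j)) : Bd -> R).
  exact: measurable_fun_shift.
have mf n : measurable_fun setT (f n : Bd -> R).
  by apply: measurable_funM => //; apply: measurable_funB.
have nv (s : R) : `|s *: 'e_j : Rd| <= `|s|.
  by rewrite normrZ -[leRHS]mulr1 ler_wpM2l// norm_delta.
(* Steps [h n <= 1] change the weight by at most the factor [2 ^+ p], which yields one dominating
   function for all [n]. *)
have fle n x : `|f n x| <= A * 2 ^+ p * decay p x.
  rewrite /f normrM gtr0_norm ?invr_gt0// mulrC ler_pdivrMr//.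
  have := @mvt_le R (fun t => phi (x + t *: 'e_j)) _ 0 (h n) (A * 2 ^+ p * decay p x) (Hd x).
  rewrite !subr0 scale0r addr0 (gtr0_norm (h0 n)) => K; apply: K => s; rewrite subr0 => sh.
  apply: (le_trans (psiA _)); rewrite -mulrA ler_wpM2l// decay_shift//.
  exact: le_trans (nv s) (le_trans sh (h1 n)).
have int0 n : (\int[mu]_x (f n x)%:E = 0)%E.
  have Ish : mu.-integrable setT (EFin \o ((fun x => phi (x + h n *: 'e_j)) : Bd -> R)).
    apply: (integrable_decay_le C0 Hball _ dp (A := A * 2 ^+ p)) => //; first by rewrite mulr_ge0// exprn_ge0.
    move=> x; apply: (le_trans (phiA _)); rewrite -mulrA ler_wpM2l// decay_shift//.
    by apply: le_trans (nv _) _; rewrite gtr0_norm.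
  under eq_integral do rewrite /f EFinM EFinB.
  rewrite integralZl//; last exact: (@integrableB _ Bd).
  rewrite integralB// (@integral_shift (EFin \o phi)); last exact/measurable_EFinP.
  by rewrite subee ?mule0//; exact: integrable_fin_num.
have cvgf x : (fun n => (f n x)%:E) @ \oo --> (psi x)%:E.
  apply: cvg_EFin; first exact: nearW.
  apply/cvgrPdist_le => e e0.
  have [del del0 Hdel] := continuous_metric cpsi x e0.
  near=> n; have hdel : h n < del.
    near: n; exists (Num.truncn del^-1) => // n /= nn.
    rewrite invf_plt ?posrE//; apply: lt_le_trans (truncnS_gt _) _.
    by rewrite ler_nat.
  (* Subtracting the linear part leaves a derivative of size at most [e] near [x], by continuity of
     [psi]; the mean value estimate then controls the quotient minus [psi x]. *)
  have Hd' (t : R) : is_derive t 1 (fun t => phi (x + t *: 'e_j) - t * psi x) (psi (x + t *: 'e_j) - psi x).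
    have D1 : is_derive t (1 : R) ((id : R -> R) * cst (psi x)) (t *: 0 + psi x *: 1).
      by apply: is_deriveM.
    have D2 : is_derive t 1 ((fun t => phi (x + t *: 'e_j)) - (id : R -> R) * cst (psi x)) (psi (x + t *: 'e_j) - (t *: 0 + psi x *: 1)).
      by apply: is_deriveB; exact: Hd.
    by move: D2; rewrite scaler0 add0r [_ *: 1]mulr1.
  have := @mvt_le R _ _ 0 (h n) e Hd'.
  rewrite !subr0 scale0r addr0 mul0r subr0 (gtr0_norm (h0 n)) => K.
  have {}K := K _.
  have {}K : `|phi (x + h n *: 'e_j) - h n * psi x - phi x| <= e * h n.
    apply: K => s; rewrite subr0 => sh; rewrite distrC; apply/ltW/Hdel.
    rewrite opprD addrA subrr add0r normrN; apply: le_lt_trans (nv s) _.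
    exact: le_lt_trans hdel.
  change (`|psi x - f n x| <= e).
  rewrite -(ler_pM2r (h0 n)); apply: le_trans K.
  rewrite -[X in _ * X <= _](gtr0_norm (h0 n)) -normrM -normrN le_eqVlt; apply/orP; left; apply/eqP.
  congr (`|_|); rewrite /f; move: (phi (x + h n *: 'e_j : Rd)) (phi x) (psi x) (h n) (h0 n) => a b c k k0.
  by field; rewrite gt_eqF.
have := @dominated_cvg _ Bd R mu setT measurableT (fun n x => (f n x)%:E) (EFin \o psi)
  (fun x => (A * 2 ^+ p * decay p x)%:E).
move=> /(_ (fun n => (measurable_EFinP _ _).2 (mf n)) (fun x _ => cvgf x) (fun x _ => isT)) H.
have Ig : mu.-integrable setT (fun x : Bd => (A * 2 ^+ p * decay p x)%:E).
  apply: (integrable_decay_le C0 Hball (u := fun x => A * 2 ^+ p * decay p x) (A := A * 2 ^+ p) _ dp) => //.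
  - by apply: measurable_funM => //; exact: measurable_decay.
  - by rewrite mulr_ge0// exprn_ge0.
  - by move=> x; rewrite ger0_norm// !mulr_ge0 ?exprn_ge0 ?decay_ge0.
have {}H : (fun n => \int[mu]_x (f n x)%:E)%E @ \oo --> (\int[mu]_x (psi x)%:E)%E.
  by apply: H => [|n x _]; [exact: Ig|rewrite lee_fin].
have E : (fun n => \int[mu]_x (f n x)%:E)%E = (fun=> 0%E) by apply/funext => n; exact: int0.
rewrite E in H.
have {}H := cvg_unique (@ereal_hausdorff R) H (cvg_cst _).
by rewrite /Rintegral [X in fine X]H.
Unshelve. all: by end_near. Qed.

End Schwartz.

(** * Continuity and decay of the Fourier transform of a Schwartz function *)

Section SchwartzFourier.
Variables (R : realType) (d : nat).
Local Notation Rd := 'rV[R]_d.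
Local Notation Bd := (RdBorel R d).

Lemma is_derive_cos_affine (a b s : R) :
  is_derive s 1 (fun s => cos (a + s * b)) (- b * sin (a + s * b)).
Proof.
have H : is_derive s (1 : R) (fun s : R => a + s * b) b.
  have D1 : is_derive s (1 : R) (cst a + (id : R -> R) * cst b) (0 + (s *: 0 + b *: 1)).
    by apply: is_deriveD; apply: is_deriveM.
  by move: D1; rewrite scaler0 !add0r [_ *: 1]mulr1.
have := @is_derive1_comp R (@cos R) (fun s => a + s * b) s _ _ (is_derive_cos _) H.
by rewrite mulrC mulrN -mulNr.
Qed.

Lemma is_derive_sin_affine (a b s : R) :
  is_derive s 1 (fun s => sin (a + s * b)) (b * cos (a + s * b)).
Proof.
have H : is_derive s (1 : R) (fun s : R => a + s * b) b.
  have D1 : is_derive s (1 : R) (cst a + (id : R -> R) * cst b) (0 + (s *: 0 + b *: 1)).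
    by apply: is_deriveD; apply: is_deriveM.
  by move: D1; rewrite scaler0 !add0r [_ *: 1]mulr1.
have := @is_derive1_comp R (@sin R) (fun s => a + s * b) s _ _ (is_derive_sin _) H.
by rewrite mulrC.
Qed.

Lemma dotv_line (t x : Rd) (j : 'I_d) (s : R) :
  2 * pi * dotv t (x + s *: 'e_j) = 2 * pi * dotv t x + s * (2 * pi * t 0 j).
Proof. by rewrite dotvDr dotvZr dotv_delta; ring. Qed.

Variables (mu : {measure set Bd -> \bar R}) (C : R).
Local Notation p := d.*2.+1.
Hypothesis C0 : 0 <= C.
Hypothesis Hball : forall x : Rd, (mu (ball x 1) <= C%:E)%E.
Hypothesis Hshift : translation_invariant mu.

Definition ftcos (u : Rd -> R) (t : Rd) : R :=
  Rintegral mu setT (fun x : Bd => u x * cos (2 * pi * dotv t x)).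
Definition ftsin (u : Rd -> R) (t : Rd) : R :=
  Rintegral mu setT (fun x : Bd => u x * sin (2 * pi * dotv t x)).

Lemma le_mul_cos (a b : R) : `|a * cos b| <= `|a|.
Proof. by rewrite normrM ler_piMr// ler_norml cos_geN1 cos_le1. Qed.

Lemma le_mul_sin (a b : R) : `|a * sin b| <= `|a|.
Proof. by rewrite normrM ler_piMr// ler_norml sin_geN1 sin_le1. Qed.

Lemma integrable_mul_cos (u : Rd -> R) (t : Rd) : schwartz u ->
  mu.-integrable setT (EFin \o ((fun x => u x * cos (2 * pi * dotv t x)) : Bd -> R)).
Proof.
move=> su; have [A A0 uA] := schwartz_decay p su.
apply: (integrable_decay_le C0 Hball _ (ltnSn _) A0) => [|x].
  apply: continuous_measurable; apply: continuousM_rV; first exact: schwartz_continuous.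
  exact: cos_dotv_continuous.
exact: le_trans (le_mul_cos _ _) (uA x).
Qed.

Lemma integrable_mul_sin (u : Rd -> R) (t : Rd) : schwartz u ->
  mu.-integrable setT (EFin \o ((fun x => u x * sin (2 * pi * dotv t x)) : Bd -> R)).
Proof.
move=> su; have [A A0 uA] := schwartz_decay p su.
apply: (integrable_decay_le C0 Hball _ (ltnSn _) A0) => [|x].
  apply: continuous_measurable; apply: continuousM_rV; first exact: schwartz_continuous.
  exact: sin_dotv_continuous.
exact: le_trans (le_mul_sin _ _) (uA x).
Qed.

Lemma schwartz_decay_max (u : Rd -> R) j (c : R) : schwartz u ->
  exists2 A, 0 <= A & forall x, `|pderiv j u x| + `|c| * `|u x| <= A * decay p x /\ `|u x| <= A * decay p x.
Proof.
move=> su; have [A A0 uA] := schwartz_decay p su.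
have [B B0 uB] := schwartz_decay p (schwartz_pderiv j su).
exists (B + `|c| * A + A); first by rewrite !addr_ge0// mulr_ge0.
move=> x; have w0 := decay_ge0 p x.
have cA : `|c| * `|u x| <= `|c| * A * decay p x by rewrite -mulrA ler_wpM2l.
have cA0 : 0 <= `|c| * A * decay p x by rewrite !mulr_ge0.
have A0x : 0 <= A * decay p x by rewrite mulr_ge0.
have B0x : 0 <= B * decay p x by rewrite mulr_ge0.
have := uA x; have := uB x; rewrite !mulrDl; split; lra.
Qed.

(** Integration by parts: the partial derivative of [u x * cos (2 pi <t, x>)] has integral zero. A
    derivative of [u] thus becomes a factor [2 pi t_j], and the cosine and sine transforms are
    exchanged. *)
Lemma ftcos_pderiv (u : Rd -> R) j t : schwartz u ->
  ftcos (pderiv j u) t = 2 * pi * t 0 j * ftsin u t.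
Proof.
move=> su; set c := 2 * pi * t 0 j.
have cu := schwartz_continuous su; have cu' := schwartz_continuous (schwartz_pderiv j su).
have [A A0 HA] := schwartz_decay_max j c su.
have := @Rintegral_partial0 R d mu C C0 Hball Hshift (fun x => u x * cos (2 * pi * dotv t x))
  (fun x => pderiv j u x * cos (2 * pi * dotv t x) - c * (u x * sin (2 * pi * dotv t x))) j A.
move=> H; have {}H := H _ _ _ A0.
rewrite RintegralB// in H; last 2 first.
- exact: integrable_mul_cos (schwartz_pderiv j su).
- apply: (@integrableZl _ Bd R mu setT measurableT c (EFin \o (fun x => u x * sin (2 * pi * dotv t x)))).
  exact: integrable_mul_sin.
rewrite RintegralZl// in H; last exact: integrable_mul_sin.
apply/eqP; rewrite -subr_eq0; apply/eqP; apply: H.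
- move=> x s.
  have := @is_deriveM _ _ (fun s : R => u (x + s *: 'e_j)) (fun s : R => cos (2 * pi * dotv t x + s * c)) s 1 _ _
    (is_derive_line x s ((schwartz_derivable su)^~ j)) (is_derive_cos_affine (2 * pi * dotv t x) c s).
  have E : (fun s : R => u (x + s *: 'e_j)) * (fun s : R => cos (2 * pi * dotv t x + s * c)) =
      (fun s : R => u (x + s *: 'e_j) * cos (2 * pi * dotv t (x + s *: 'e_j))).
    by apply/funext => r; rewrite dotv_line.
  rewrite E => D; apply: (is_derive_eq D).
  by rewrite dotv_line -/c /GRing.scale/=; ring.
- by apply: continuousM_rV => //; exact: cos_dotv_continuous.
- apply: continuousB_rV; first by apply: continuousM_rV => //; exact: cos_dotv_continuous.
  by apply: continuous_cstM_rV; apply: continuousM_rV => //; exact: sin_dotv_continuous.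
- by move=> x; apply: le_trans (le_mul_cos _ _) (HA x).2.
- move=> x; apply: le_trans (HA x).1; apply: (le_trans (ler_normB _ _)).
  by apply: lerD; [exact: le_mul_cos|rewrite normrM ler_wpM2l//; exact: le_mul_sin].
Qed.

Lemma ftsin_pderiv (u : Rd -> R) j t : schwartz u ->
  ftsin (pderiv j u) t = - (2 * pi * t 0 j) * ftcos u t.
Proof.
move=> su; set c := 2 * pi * t 0 j.
have cu := schwartz_continuous su; have cu' := schwartz_continuous (schwartz_pderiv j su).
have [A A0 HA] := schwartz_decay_max j c su.
have := @Rintegral_partial0 R d mu C C0 Hball Hshift (fun x => u x * sin (2 * pi * dotv t x))
  (fun x => pderiv j u x * sin (2 * pi * dotv t x) + c * (u x * cos (2 * pi * dotv t x))) j A.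
move=> H; have {}H := H _ _ _ A0.
rewrite RintegralD// in H; last 2 first.
- exact: integrable_mul_sin (schwartz_pderiv j su).
- apply: (@integrableZl _ Bd R mu setT measurableT c (EFin \o (fun x => u x * cos (2 * pi * dotv t x)))).
  exact: integrable_mul_cos.
rewrite RintegralZl// in H; last exact: integrable_mul_cos.
apply/eqP; rewrite mulNr -addr_eq0; apply/eqP; apply: H.
- move=> x s.
  have := @is_deriveM _ _ (fun s : R => u (x + s *: 'e_j)) (fun s : R => sin (2 * pi * dotv t x + s * c)) s 1 _ _
    (is_derive_line x s ((schwartz_derivable su)^~ j)) (is_derive_sin_affine (2 * pi * dotv t x) c s).
  have E : (fun s : R => u (x + s *: 'e_j)) * (fun s : R => sin (2 * pi * dotv t x + s * c)) =
      (fun s : R => u (x + s *: 'e_j) * sin (2 * pi * dotv t (x + s *: 'e_j))).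
    by apply/funext => r; rewrite dotv_line.
  rewrite E => D; apply: (is_derive_eq D).
  by rewrite dotv_line -/c /GRing.scale/=; ring.
- by apply: continuousM_rV => //; exact: sin_dotv_continuous.
- apply: continuousD_rV; first by apply: continuousM_rV => //; exact: sin_dotv_continuous.
  by apply: continuous_cstM_rV; apply: continuousM_rV => //; exact: cos_dotv_continuous.
- by move=> x; apply: le_trans (le_mul_sin _ _) (HA x).2.
- move=> x; apply: le_trans (HA x).1; apply: (le_trans (ler_normD _ _)).
  by apply: lerD; [exact: le_mul_sin|rewrite normrM ler_wpM2l//; exact: le_mul_cos].
Qed.

Lemma ft_bounded (u : Rd -> R) : schwartz u ->
  exists B, forall t, `|ftcos u t| <= B /\ `|ftsin u t| <= B.
Proof.
move=> su; exists (Rintegral mu setT (fun x => `|u x|)) => t.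
have [A A0 uA] := schwartz_decay p su.
have Iu : mu.-integrable setT (EFin \o ((fun x => `|u x|) : Bd -> R)).
  apply: (integrable_decay_le C0 Hball _ (ltnSn _) A0) => [|x]; last by rewrite normr_id.
  by apply: measurableT_comp => //; apply: continuous_measurable; exact: schwartz_continuous.
split.
  apply: (le_trans (le_normr_Rintegral _ (integrable_mul_cos t su))) => //.
  apply: le_Rintegral => //; last by move=> x _; exact: le_mul_cos.
  exact: (@integrable_norm _ Bd R mu setT _ (integrable_mul_cos t su)).
apply: (le_trans (le_normr_Rintegral _ (integrable_mul_sin t su))) => //.
apply: le_Rintegral => //; last by move=> x _; exact: le_mul_sin.
exact: (@integrable_norm _ Bd R mu setT _ (integrable_mul_sin t su)).
Qed.

Lemma pi_ge1 : 1 <= 2 * pi :> R.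
Proof. by have := @pi_ge2 R; lra. Qed.

Lemma ft_coord_decay k j (u : Rd -> R) : schwartz u ->
  exists B, forall t : Rd, `|t 0 j| ^+ k * `|ftcos u t| <= B /\ `|t 0 j| ^+ k * `|ftsin u t| <= B.
Proof.
elim: k u => [|k IH] u su.
  by have [B HB] := ft_bounded su; exists B => t; rewrite expr0 !mul1r.
have [B HB] := IH _ (schwartz_pderiv j su); exists B => t.
have [H1 H2] := HB t; rewrite ftcos_pderiv// in H1; rewrite ftsin_pderiv// in H2.
have le (a : R) : `|t 0 j| ^+ k.+1 * `|a| <= `|t 0 j| ^+ k * `|2 * pi * t 0 j * a|.
  rewrite exprSr -mulrA ler_wpM2l ?exprn_ge0// normrM ler_wpM2r// normrM ler_peMl//.
  by rewrite ger0_norm ?pi_ge1//; have := pi_ge1; lra.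
split; first by apply: le_trans H2; rewrite mulNr normrN; exact: le.
by apply: le_trans H1; exact: le.
Qed.

(** For [|t| > 1] the coordinate that realises the sup norm supplies the decay, for [|t| <= 1] the
    plain bound does. Decay together with continuity is what [vague_cvg] asks of a test function. *)
Lemma ft_decay q (u : Rd -> R) : schwartz u ->
  exists2 A, 0 <= A & forall t, `|ftcos u t| <= A * decay q t /\ `|ftsin u t| <= A * decay q t.
Proof.
move=> su; have [B0 HB0] := ft_bounded su.
have [B HB] := choice (fun j => ft_coord_decay q j su).
pose M := `|B0| + \sum_j `|B j|.
have M0 : 0 <= M by rewrite addr_ge0// sumr_ge0.
have BM j : B j <= M.
  apply: (le_trans (ler_norm _)); rewrite /M (bigD1 j)//= addrCA lerDl addr_ge0//.
  exact: sumr_ge0.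
have key (a : R) (t : Rd) : `|a| <= B0 -> (forall j, `|t 0 j| ^+ q * `|a| <= B j) ->
    `|a| <= 2 ^+ q * M * decay q t.
  move=> aB0 aB; have t0 : 0 < 1 + `|t| by rewrite ltr_pwDl.
  rewrite /decay ler_pdivlMr ?exprn_gt0//.
  have [t1|t1] := leP `|t| 1.
    rewrite mulrC; apply: ler_pM.
    - by rewrite exprn_ge0// ltW.
    - exact: normr_ge0.
    - by rewrite lerXn2r ?nnegrE ?(ltW t0)//; lra.
    - by apply: (le_trans aB0); apply: (le_trans (ler_norm _)); rewrite /M lerDl sumr_ge0.
  have [j tj] := norm_geP (lt_trans ltr01 t1) (lexx `|t|).
  apply: (@le_trans _ _ (2 ^+ q * (`|t 0 j| ^+ q * `|a|))); last first.
    by rewrite ler_wpM2l ?exprn_ge0//; exact: le_trans (aB j) (BM j).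
  rewrite mulrA mulrC ler_wpM2r// -exprMn lerXn2r ?nnegrE ?(ltW t0) ?mulr_ge0//.
  by have := normr_ge0 (t 0 j); lra.
exists (2 ^+ q * M); first by rewrite mulr_ge0// exprn_ge0.
move=> t; have [h1 h2] := HB0 t.
by split; apply: key => // j; have [] := HB j t.
Qed.

(** Cosine and sine are 1-Lipschitz, and one more order of decay of [u] makes [|x| |u x|]
    integrable. *)
Lemma ft_lip (u : Rd -> R) : schwartz u -> exists L, forall t t',
  `|ftcos u t - ftcos u t'| <= L * `|t - t'| /\ `|ftsin u t - ftsin u t'| <= L * `|t - t'|.
Proof.
move=> su; have [A A0 uA] := schwartz_decay p.+1 su.
pose w (x : Rd) := `|x| * `|u x|.
have cw : continuous w.
  apply: continuousM_rV; first by move=> x; exact: norm_continuous.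
  by apply: continuous_abs_rV; exact: schwartz_continuous.
have wA x : `|w x| <= A * decay p x.
  rewrite ger0_norm ?mulr_ge0//; apply: (@le_trans _ _ ((1 + `|x|) * (A * decay p.+1 x))).
    by apply: ler_pM => //; rewrite lerDr.
  rewrite /decay exprS invfM mulrCA ler_wpM2l// mulrA divff ?mul1r// gt_eqF// ltr_pwDl//.
have Iw : mu.-integrable setT (EFin \o (w : Bd -> R)).
  by apply: (integrable_decay_le C0 Hball _ (ltnSn _) A0) => //; exact: continuous_measurable.
exists (2 * pi * d%:R * Rintegral mu setT w) => t t'.
have key (g : R -> R) : (forall a b, `|g b - g a| <= `|b - a|) -> forall x,
    `|u x * g (2 * pi * dotv t x) - u x * g (2 * pi * dotv t' x)| <= 2 * pi * d%:R * `|t - t'| * w x.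
  move=> Hg x; rewrite -mulrBr normrM.
  apply: (@le_trans _ _ (`|u x| * (2 * pi * (d%:R * `|t - t'| * `|x|)))).
    rewrite ler_wpM2l//; apply: (le_trans (Hg _ _)).
    rewrite -mulrBr -dotvBl normrM ger0_norm; last by have := pi_ge1; lra.
    by rewrite ler_wpM2l ?dotv_le//; have := pi_ge1; lra.
  by rewrite /w le_eqVlt; apply/orP; left; apply/eqP; ring.
have IZ (c : R) : mu.-integrable setT (EFin \o ((fun x => c * w x) : Bd -> R)).
  exact: (@integrableZl _ Bd R mu setT measurableT c (EFin \o w)).
split.
  rewrite -RintegralB//; try exact: integrable_mul_cos.
  have Id := @integrableB _ Bd R mu setT measurableT _ _ (integrable_mul_cos t su) (integrable_mul_cos t' su).
  apply: (le_trans (le_normr_Rintegral measurableT Id)).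
  rewrite mulrAC -RintegralZl//; apply: le_Rintegral => //; last by move=> x _; exact: key (@cos_lip R) x.
  exact: (@integrable_norm _ Bd R mu setT _ Id).
rewrite -RintegralB//; try exact: integrable_mul_sin.
have Id := @integrableB _ Bd R mu setT measurableT _ _ (integrable_mul_sin t su) (integrable_mul_sin t' su).
apply: (le_trans (le_normr_Rintegral measurableT Id)).
rewrite mulrAC -RintegralZl//; apply: le_Rintegral => //; last by move=> x _; exact: key (@sin_lip R) x.
exact: (@integrable_norm _ Bd R mu setT _ Id).
Qed.

Lemma ftcos_continuous (u : Rd -> R) : schwartz u -> continuous (ftcos u).
Proof.
move=> /ft_lip[L H]; apply: (@lipschitz_rV_continuous _ _ _ L) => x y; exact: (H x y).1.
Qed.

Lemma ftsin_continuous (u : Rd -> R) : schwartz u -> continuous (ftsin u).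
Proof.
move=> /ft_lip[L H]; apply: (@lipschitz_rV_continuous _ _ _ L) => x y; exact: (H x y).2.
Qed.

End SchwartzFourier.

(** * Bounded Borel functions on sets of finite measure *)

Section BoundedMeasurable.
Variables (R : realType) (d : nat).
Local Notation Rd := 'rV[R]_d.
Local Notation Bd := (RdBorel R d).

(** The class is stable under sums and products and contains the trigonometric functions and
    indicators, so that integrability over a set of finite measure holds throughout the computations
    with exponentials. *)
Definition bdd_meas (g : Rd -> R) :=
  measurable_fun setT (g : Bd -> R) /\ exists M, forall x, `|g x| <= M.

Lemma bdd_measD f g : bdd_meas f -> bdd_meas g -> bdd_meas (fun x => f x + g x).
Proof.
move=> [mf [M HM]] [mg [N HN]]; split; first exact: measurable_funD.
by exists (M + N) => x; apply: (le_trans (ler_normD _ _)); exact: lerD.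
Qed.

Lemma bdd_measM f g : bdd_meas f -> bdd_meas g -> bdd_meas (fun x => f x * g x).
Proof.
move=> [mf [M HM]] [mg [N HN]]; split; first exact: measurable_funM.
by exists (M * N) => x; rewrite normrM; exact: ler_pM.
Qed.

Lemma bdd_meas_cst c : bdd_meas (fun=> c).
Proof. by split; [exact: measurable_cst|exists `|c|]. Qed.

Lemma bdd_measN f : bdd_meas f -> bdd_meas (fun x => - f x).
Proof.
move=> [mf [M HM]]; split; first exact: measurableT_comp.
by exists M => x; rewrite normrN.
Qed.

Lemma bdd_measB f g : bdd_meas f -> bdd_meas g -> bdd_meas (fun x => f x - g x).
Proof. by move=> bf bg; apply: bdd_measD => //; exact: bdd_measN. Qed.

Lemma bdd_meas_sum (I : Type) (s : seq I) (f : I -> Rd -> R) :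
  (forall i, bdd_meas (f i)) -> bdd_meas (fun x => \sum_(i <- s) f i x).
Proof.
move=> H; elim: s => [|i s IH].
  by under [fun x => _]eq_fun do rewrite big_nil; exact: bdd_meas_cst.
by under [fun x => _]eq_fun do rewrite big_cons; exact: bdd_measD.
Qed.

Lemma bdd_meas_cos t : bdd_meas (fun x => cos (2 * pi * dotv t x)).
Proof.
split; first by apply: continuous_measurable; exact: cos_dotv_continuous.
by exists 1 => x; rewrite ler_norml cos_geN1 cos_le1.
Qed.

Lemma bdd_meas_sin t : bdd_meas (fun x => sin (2 * pi * dotv t x)).
Proof.
split; first by apply: continuous_measurable; exact: sin_dotv_continuous.
by exists 1 => x; rewrite ler_norml sin_geN1 sin_le1.
Qed.

Lemma bdd_meas_indic (E : set Rd) : borel_set E -> bdd_meas (\1_E).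
Proof.
move=> mE; split; first exact: measurable_indic.
by exists 1 => x; rewrite ger0_norm ?indicE// lern1 leq_b1.
Qed.

Variable mu : {measure set Bd -> \bar R}.

Lemma bdd_meas_integrable (E : set Rd) g : borel_set E -> (mu E < +oo)%E ->
  bdd_meas g -> mu.-integrable E (EFin \o (g : Bd -> R)).
Proof.
move=> mE Eoo [mg [M HM]]; apply: measurable_bounded_integrable => //.
  exact: measurable_funTS.
exists M; split; first exact: num_real.
by move=> N MN x _; apply: le_trans (HM x) (ltW MN).
Qed.

Variable E : set Rd.
Hypotheses (mE : borel_set E) (Eoo : (mu E < +oo)%E).

Lemma bm_RintegralD f g : bdd_meas f -> bdd_meas g ->
  Rintegral mu E (fun x => f x + g x) = Rintegral mu E f + Rintegral mu E g.
Proof. by move=> bf bg; rewrite RintegralD//; exact: bdd_meas_integrable. Qed.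

Lemma bm_RintegralB f g : bdd_meas f -> bdd_meas g ->
  Rintegral mu E (fun x => f x - g x) = Rintegral mu E f - Rintegral mu E g.
Proof. by move=> bf bg; rewrite RintegralB//; exact: bdd_meas_integrable. Qed.

Lemma bm_RintegralZ c f : bdd_meas f -> Rintegral mu E (fun x => c * f x) = c * Rintegral mu E f.
Proof. by move=> bf; rewrite RintegralZl//; exact: bdd_meas_integrable. Qed.

Lemma bm_Rintegral_sum (I : Type) (s : seq I) (f : I -> Rd -> R) : (forall i, bdd_meas (f i)) ->
  Rintegral mu E (fun x => \sum_(i <- s) f i x) = \sum_(i <- s) Rintegral mu E (f i).
Proof.
move=> H; elim: s => [|i s IH].
  under eq_Rintegral do rewrite big_nil.
  by rewrite big_nil Rintegral_cst// mul0r.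
under eq_Rintegral do rewrite big_cons.
by rewrite big_cons bm_RintegralD ?IH//; exact: bdd_meas_sum.
Qed.

Lemma Rintegral_indicM (D : set Rd) g : borel_set D -> D `<=` E ->
  Rintegral mu E (fun x => \1_D x * g x) = Rintegral mu D g.
Proof.
move=> mD DE; rewrite [RHS]Rintegral_mkcond [LHS]Rintegral_mkcond; congr fine.
apply: eq_integral => x _; rewrite !patchE indicE; congr EFin.
case: (boolP (x \in D)) => [xD|xD].
  by rewrite mul1r mem_set//; apply: DE; exact: set_mem.
by rewrite mul0r; case: ifP.
Qed.

Lemma Rintegral_1 : Rintegral mu E (fun=> 1) = fine (mu E).
Proof. by rewrite Rintegral_cst// mul1r. Qed.

End BoundedMeasurable.

Lemma sum_sqrD (R : comNzRingType) (I : Type) (s : seq I) (a b : I -> R) :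
  (\sum_(i <- s) a i) ^+ 2 + (\sum_(i <- s) b i) ^+ 2 =
  \sum_(i <- s) \sum_(j <- s) (a i * a j + b i * b j).
Proof.
rewrite !expr2 !mulr_suml -big_split/=; apply: eq_bigr => i _.
by rewrite !mulr_sumr -big_split.
Qed.

Lemma sum_mulD (R : comNzRingType) (I : Type) (s : seq I) (c e : R) (a b : I -> R) :
  c * (\sum_(i <- s) a i) + e * (\sum_(i <- s) b i) = \sum_(i <- s) (c * a i + e * b i).
Proof. by rewrite !mulr_sumr -big_split. Qed.

(** * Distances to trigonometric sums under orthogonality *)

Section Bessel.
Variables (R : realType) (d : nat).
Local Notation Rd := 'rV[R]_d.
Local Notation Bd := (RdBorel R d).
Variable mu : {measure set Bd -> \bar R}.
Implicit Types (E : set Rd).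

(** [icos - i isin] is the Fourier transform of the indicator of [E], and [spec] the square of its
    modulus. *)
Definition icos E t := Rintegral mu E (fun x : Bd => cos (2 * pi * dotv t x)).
Definition isin E t := Rintegral mu E (fun x : Bd => sin (2 * pi * dotv t x)).
Definition spec E t := icos E t ^+ 2 + isin E t ^+ 2.

Lemma spec_ge0 E t : 0 <= spec E t.
Proof. by rewrite addr_ge0// sqr_ge0. Qed.

Variables (Om : set Rd) (Lam : set Rd).
Hypotheses (mOm : borel_set Om) (Omoo : (mu Om < +oo)%E) (Om0 : (0 < mu Om)%E).
Hypothesis Horth : forall l l', Lam l -> Lam l' -> l <> l' -> icos Om (l - l') = 0 /\ isin Om (l - l') = 0.

Let m := fine (mu Om).

Lemma fine_Om_gt0 : 0 < m.
Proof. by rewrite fine_gt0// Om0 Omoo. Qed.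

Let m0 := fine_Om_gt0.

Variables (p q : Rd -> R).
Let f1 (S : seq Rd) x := \sum_(l <- S) (p l * cos (2 * pi * dotv l x) - q l * sin (2 * pi * dotv l x)).
Let f2 (S : seq Rd) x := \sum_(l <- S) (p l * sin (2 * pi * dotv l x) + q l * cos (2 * pi * dotv l x)).

Lemma bdd_meas_trig_sum1 S : bdd_meas (f1 S).
Proof.
apply: bdd_meas_sum => l; apply: bdd_measB; apply: bdd_measM; try exact: bdd_meas_cst.
  exact: bdd_meas_cos.
exact: bdd_meas_sin.
Qed.

Lemma bdd_meas_trig_sum2 S : bdd_meas (f2 S).
Proof.
apply: bdd_meas_sum => l; apply: bdd_measD; apply: bdd_measM; try exact: bdd_meas_cst.
  exact: bdd_meas_sin.
exact: bdd_meas_cos.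
Qed.

Let bmM (c : R) f : bdd_meas f -> bdd_meas (fun x : Rd => c * f x).
Proof. by move=> bf; apply: bdd_measM => //; exact: bdd_meas_cst. Qed.

Lemma trig_sum_norm S : uniq S -> (forall l, l \in S -> Lam l) ->
  Rintegral mu Om (fun x => f1 S x ^+ 2 + f2 S x ^+ 2) = m * \sum_(l <- S) (p l ^+ 2 + q l ^+ 2).
Proof.
move=> uS SL.
have E x : f1 S x ^+ 2 + f2 S x ^+ 2 = \sum_(l <- S) \sum_(k <- S)
   ((p l * p k + q l * q k) * cos (2 * pi * dotv (l - k) x) +
    (p l * q k - q l * p k) * sin (2 * pi * dotv (l - k) x)).
  rewrite sum_sqrD; apply: eq_bigr => l _; apply: eq_bigr => k _.
  have -> : 2 * pi * dotv (l - k) x = 2 * pi * dotv l x - 2 * pi * dotv k x by rewrite dotvBl mulrBr.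
  by rewrite cosB sinB; ring.
under eq_Rintegral do rewrite E.
have bmk l k : bdd_meas (fun x => (p l * p k + q l * q k) * cos (2 * pi * dotv (l - k) x) +
    (p l * q k - q l * p k) * sin (2 * pi * dotv (l - k) x)).
  by apply: bdd_measD; apply: bmM; [exact: bdd_meas_cos|exact: bdd_meas_sin].
rewrite bm_Rintegral_sum//; last by move=> l; exact: bdd_meas_sum.
rewrite mulr_sumr big_seq [RHS]big_seq; apply: eq_bigr => l lS.
rewrite bm_Rintegral_sum// (bigD1_seq l)//= big_seq_cond big1 ?addr0; last first.
  move=> k /andP[kS /eqP kl].
  rewrite bm_RintegralD//; [|by apply: bmM; exact: bdd_meas_cos|by apply: bmM; exact: bdd_meas_sin].
  rewrite !bm_RintegralZ//; [|exact: bdd_meas_sin|exact: bdd_meas_cos].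
  have [] := Horth (SL _ lS) (SL _ kS) (fun e => kl (esym e)).
  by rewrite /icos /isin => -> ->; rewrite !mulr0 addr0.
under eq_Rintegral => x _.
  rewrite subrr dotvC dotv0r mulr0 cos0 sin0 mulr0 addr0 mulr1.
  over.
by rewrite Rintegral_cst// mulrC -!expr2.
Qed.

(** Expansion of the squared distance in [L^2(Om)] between [1_E e_t] and the sum of the
    [(p l + i q l) e_l]. The coefficients are free: Fourier coefficients give Bessel's inequality,
    and those supplied by completeness give Parseval's identity. *)
Lemma trig_distance S E t : uniq S -> (forall l, l \in S -> Lam l) ->
  borel_set E -> E `<=` Om ->
  Rintegral mu Om (fun x => (\1_E x * cos (2 * pi * dotv t x) - f1 S x) ^+ 2 +
     (\1_E x * sin (2 * pi * dotv t x) - f2 S x) ^+ 2) =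
  fine (mu E) - 2 * \sum_(l <- S) (p l * icos E (t - l) + q l * isin E (t - l)) +
  m * \sum_(l <- S) (p l ^+ 2 + q l ^+ 2).
Proof.
move=> uS SL mE EO; rewrite -trig_sum_norm//.
have Eoo : (mu E < +oo)%E by apply: le_lt_trans Omoo; exact: measure_mono.
pose h x := 1 - 2 * \sum_(l <- S) (p l * cos (2 * pi * dotv (t - l) x) + q l * sin (2 * pi * dotv (t - l) x)).
have bl l : bdd_meas (fun x => p l * cos (2 * pi * dotv (t - l) x) + q l * sin (2 * pi * dotv (t - l) x)).
  by apply: bdd_measD; apply: bmM; [exact: bdd_meas_cos|exact: bdd_meas_sin].
have bs := bdd_meas_sum S bl.
have bh : bdd_meas h by apply: bdd_measB; [exact: bdd_meas_cst|exact: bmM].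
have Ex x : (\1_E x * cos (2 * pi * dotv t x) - f1 S x) ^+ 2 +
     (\1_E x * sin (2 * pi * dotv t x) - f2 S x) ^+ 2 = \1_E x * h x + (f1 S x ^+ 2 + f2 S x ^+ 2).
  have -> : h x = 1 - 2 * (cos (2 * pi * dotv t x) * f1 S x + sin (2 * pi * dotv t x) * f2 S x).
    rewrite /h sum_mulD; congr (1 - 2 * _); apply: eq_bigr => l _.
    have -> : 2 * pi * dotv (t - l) x = 2 * pi * dotv t x - 2 * pi * dotv l x by rewrite dotvBl mulrBr.
    by rewrite cosB sinB; ring.
  have := cos2Dsin2 (2 * pi * dotv t x).
  move: (cos _) (sin _) (f1 S x) (f2 S x) => c s a b cs.
  have i2 : \1_E x ^+ 2 = \1_E x :> R by rewrite indicE; case: (_ \in _); rewrite ?expr1n ?expr0n.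
  have -> : (\1_E x * c - a) ^+ 2 + (\1_E x * s - b) ^+ 2 =
    \1_E x ^+ 2 * (c ^+ 2 + s ^+ 2) - 2 * \1_E x * (c * a + s * b) + (a ^+ 2 + b ^+ 2) by ring.
  by rewrite i2 cs; ring.
under eq_Rintegral do rewrite Ex.
rewrite bm_RintegralD//; last 2 first.
- by apply: bdd_measM => //; exact: bdd_meas_indic.
- by apply: bdd_measD; apply: bdd_measM; (exact: bdd_meas_trig_sum1 || exact: bdd_meas_trig_sum2).
congr (_ + _); rewrite Rintegral_indicM// bm_RintegralB//; last 2 first.
- exact: bdd_meas_cst.
- exact: bmM.
rewrite Rintegral_1// bm_RintegralZ// bm_Rintegral_sum//; congr (_ - 2 * _).
apply: eq_bigr => l _; rewrite bm_RintegralD//; last 2 first.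
- by apply: bmM; exact: bdd_meas_cos.
- by apply: bmM; exact: bdd_meas_sin.
by rewrite !bm_RintegralZ//; [exact: bdd_meas_sin|exact: bdd_meas_cos].
Qed.

End Bessel.

Notation orthogonal_exp mu Om Lam := (forall l l', Lam l -> Lam l' -> l <> l' ->
  icos mu Om (l - l') = 0 /\ isin mu Om (l - l') = 0).
Notation complete_exp mu Om Lam := (forall t eps, 0 < eps -> exists s,
  (forall c, c \in s -> Lam c.1) /\
  (\int[mu]_(x in Om) ((cos (2 * pi * dotv t x) - lincomb_re s x) ^+ 2 +
     (sin (2 * pi * dotv t x) - lincomb_im s x) ^+ 2)%:E < (eps ^+ 2)%:E)%E).

(** A combination obtained from completeness may repeat a frequency; regrouping makes the
    frequencies distinct, as orthogonality requires. *)
Lemma sum_undup_partition (R : nmodType) (T U : eqType) (f : T -> U) (s : seq T) (G : T -> R) :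
  \sum_(l <- undup (map f s)) \sum_(c <- s | f c == l) G c = \sum_(c <- s) G c.
Proof.
under eq_bigr do rewrite big_mkcond.
rewrite exchange_big/= big_seq [RHS]big_seq; apply: eq_bigr => c cs.
rewrite -big_mkcond/= (eq_bigl (pred1 (f c))); last by move=> l /=; rewrite eq_sym.
by rewrite -big_filter filter_pred1_uniq ?undup_uniq ?mem_undup ?map_f// big_seq1.
Qed.

(** * Bessel's inequality, Parseval's identity and the effect of translations *)

Section Spectrum.
Variables (R : realType) (d : nat).
Local Notation Rd := 'rV[R]_d.
Local Notation Bd := (RdBorel R d).
Variable mu : {measure set Bd -> \bar R}.
Implicit Types (E : set Rd).
Hypothesis Hshift : translation_invariant mu.

Lemma icos_shift E v s : borel_set E -> (mu E < +oo)%E ->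
  icos mu [set y | E (y + v)] s =
  cos (2 * pi * dotv s v) * icos mu E s + sin (2 * pi * dotv s v) * isin mu E s.
Proof.
move=> mE Eoo; have mEv := measurable_shift_set v mE.
rewrite /icos -(@Rintegral_indicM _ _ _ setT)//.
pose g z := \1_E z * (cos (2 * pi * dotv s v) * cos (2 * pi * dotv s z) +
   sin (2 * pi * dotv s v) * sin (2 * pi * dotv s z)).
have b1 : bdd_meas (fun z => cos (2 * pi * dotv s v) * cos (2 * pi * dotv s z)).
  by apply: bdd_measM; [exact: bdd_meas_cst|exact: bdd_meas_cos].
have b2 : bdd_meas (fun z => sin (2 * pi * dotv s v) * sin (2 * pi * dotv s z)).
  by apply: bdd_measM; [exact: bdd_meas_cst|exact: bdd_meas_sin].
have [mg _] : bdd_meas g.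
  by apply: bdd_measM; [exact: bdd_meas_indic|exact: bdd_measD].
transitivity (Rintegral mu setT (fun y => g (y + v))).
  apply: eq_Rintegral => y _; rewrite /g; congr (_ * _).
  have -> : 2 * pi * dotv s y = 2 * pi * dotv s (y + v) - 2 * pi * dotv s v.
    by rewrite dotvDr; ring.
  by rewrite cosB; ring.
rewrite (Rintegral_shift Hshift)// /g Rintegral_indicM//.
rewrite bm_RintegralD// !bm_RintegralZ//; [exact: bdd_meas_sin|exact: bdd_meas_cos].
Qed.

Lemma isin_shift E v s : borel_set E -> (mu E < +oo)%E ->
  isin mu [set y | E (y + v)] s =
  cos (2 * pi * dotv s v) * isin mu E s - sin (2 * pi * dotv s v) * icos mu E s.
Proof.
move=> mE Eoo; have mEv := measurable_shift_set v mE.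
rewrite /isin -(@Rintegral_indicM _ _ _ setT)//.
pose g z := \1_E z * (cos (2 * pi * dotv s v) * sin (2 * pi * dotv s z) -
   sin (2 * pi * dotv s v) * cos (2 * pi * dotv s z)).
have b1 : bdd_meas (fun z => cos (2 * pi * dotv s v) * sin (2 * pi * dotv s z)).
  by apply: bdd_measM; [exact: bdd_meas_cst|exact: bdd_meas_sin].
have b2 : bdd_meas (fun z => sin (2 * pi * dotv s v) * cos (2 * pi * dotv s z)).
  by apply: bdd_measM; [exact: bdd_meas_cst|exact: bdd_meas_cos].
have [mg _] : bdd_meas g.
  by apply: bdd_measM; [exact: bdd_meas_indic|exact: bdd_measB].
transitivity (Rintegral mu setT (fun y => g (y + v))).
  apply: eq_Rintegral => y _; rewrite /g; congr (_ * _).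
  have -> : 2 * pi * dotv s y = 2 * pi * dotv s (y + v) - 2 * pi * dotv s v.
    by rewrite dotvDr; ring.
  by rewrite sinB; ring.
rewrite (Rintegral_shift Hshift)// /g Rintegral_indicM//.
rewrite bm_RintegralB// !bm_RintegralZ//; [exact: bdd_meas_cos|exact: bdd_meas_sin].
Qed.

Lemma spec_shift E v s : borel_set E -> (mu E < +oo)%E ->
  spec mu [set y | E (y + v)] s = spec mu E s.
Proof.
move=> mE Eoo; rewrite /spec icos_shift// isin_shift//.
have := cos2Dsin2 (2 * pi * dotv s v).
move: (cos _) (sin _) (icos _ _ _) (isin _ _ _) => c e a b ce.
have -> : (c * a + e * b) ^+ 2 + (c * b - e * a) ^+ 2 = (c ^+ 2 + e ^+ 2) * (a ^+ 2 + b ^+ 2) by ring.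
by rewrite ce mul1r.
Qed.

Lemma bm_Rintegral_setID A B g : borel_set A -> borel_set B ->
  (mu A < +oo)%E -> bdd_meas g ->
  Rintegral mu A g = Rintegral mu (A `\` B) g + Rintegral mu (A `&` B) g.
Proof.
move=> mA mB Aoo bg.
have E : (A `\` B) `|` (A `&` B) = A by rewrite setDE -setIUr setUC setUv setIT.
rewrite -{1}E Rintegral_setU//.
- exact: measurableD.
- exact: measurableI.
- by rewrite E; exact: bdd_meas_integrable.
- by apply/disj_setPS => x [[_ nB] [_ Bx]].
Qed.

Lemma icosD E D s : borel_set E -> borel_set D ->
  (mu E < +oo)%E -> (mu D < +oo)%E ->
  icos mu E s - icos mu D s = icos mu (E `\` D) s - icos mu (D `\` E) s.
Proof.
move=> mE mD Eoo Doo.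
rewrite /icos (bm_Rintegral_setID mE mD Eoo) ?(bm_Rintegral_setID mD mE Doo); try exact: bdd_meas_cos.
by rewrite [D `&` E]setIC; ring.
Qed.

Lemma isinD E D s : borel_set E -> borel_set D ->
  (mu E < +oo)%E -> (mu D < +oo)%E ->
  isin mu E s - isin mu D s = isin mu (E `\` D) s - isin mu (D `\` E) s.
Proof.
move=> mE mD Eoo Doo.
rewrite /isin (bm_Rintegral_setID mE mD Eoo) ?(bm_Rintegral_setID mD mE Doo); try exact: bdd_meas_sin.
by rewrite [D `&` E]setIC; ring.
Qed.

Variables (Om : set Rd) (Lam : set Rd).
Hypotheses (mOm : borel_set Om) (Omoo : (mu Om < +oo)%E) (Om0 : (0 < mu Om)%E).
Hypothesis Horth : orthogonal_exp mu Om Lam.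
Let m := fine (mu Om).
Let m0 : 0 < m := fine_Om_gt0 Omoo Om0.

(** Optimal coefficients in [trig_distance]. The factor [fine (mu E)] is what matters later: for a
    small piece [E] of [Om] the whole sum is small, uniformly in [S] and [t]. *)
Lemma bessel (S : seq Rd) E t : uniq S -> (forall l, l \in S -> Lam l) ->
  borel_set E -> E `<=` Om ->
  \sum_(l <- S) spec mu E (t - l) <= m * fine (mu E).
Proof.
move=> uS SL mE EO.
have := @trig_distance R d mu Om Lam mOm Omoo Horth
  (fun l => icos mu E (t - l) / m) (fun l => isin mu E (t - l) / m) S E t uS SL mE EO.
have E1 : \sum_(l <- S) (icos mu E (t - l) / m * icos mu E (t - l) + isin mu E (t - l) / m * isin mu E (t - l)) =
    m^-1 * \sum_(l <- S) spec mu E (t - l).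
  by rewrite mulr_sumr; apply: eq_bigr => l _; rewrite /spec; ring.
have E2 : \sum_(l <- S) ((icos mu E (t - l) / m) ^+ 2 + (isin mu E (t - l) / m) ^+ 2) =
    m^-1 * (m^-1 * \sum_(l <- S) spec mu E (t - l)).
  by rewrite !mulr_sumr; apply: eq_bigr => l _; rewrite /spec; ring.
rewrite E1 E2 -/m [m * (_ * _)]mulrA mulfV ?gt_eqF// mul1r => D.
have : 0 <= fine (mu E) - m^-1 * \sum_(l <- S) spec mu E (t - l).
  apply: le_trans (_ : fine (mu E) - 2 * (m^-1 * \sum_(l <- S) spec mu E (t - l)) +
     m^-1 * \sum_(l <- S) spec mu E (t - l) <= _); last by lra.
  by rewrite -D; apply: Rintegral_ge0 => x _; rewrite addr_ge0// sqr_ge0.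
by rewrite subr_ge0 -ler_pdivrMl ?invr_gt0// invrK.
Qed.

Hypothesis Hcompl : complete_exp mu Om Lam.

(** The coefficients supplied by completeness need not be the Fourier coefficients, but completing
    squares term by term shows that any coefficients bound the sum of [spec] from below. The
    tolerance [eta / m] on the squared distance becomes [eta] after multiplication by [m]. *)
Lemma parseval (t : Rd) (eta : R) : 0 < eta -> exists S : seq Rd,
  [/\ uniq S, forall l, l \in S -> Lam l & m ^+ 2 - eta <= \sum_(l <- S) spec mu Om (t - l)].
Proof.
move=> eta0.
pose e := Num.sqrt (eta / m); have e0 : 0 < e by rewrite sqrtr_gt0 divr_gt0.
have e2 : e ^+ 2 = eta / m by rewrite sqr_sqrtr// ltW// divr_gt0.
have [s [sL]] := Hcompl t e0; rewrite e2.
pose S := undup (map fst s).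
pose p l := \sum_(c <- s | c.1 == l) c.2.1; pose q l := \sum_(c <- s | c.1 == l) c.2.2.
have SL l : l \in S -> Lam l by rewrite mem_undup => /mapP[c /sL + ->].
have Ere x : lincomb_re s x = \sum_(l <- S) (p l * cos (2 * pi * dotv l x) - q l * sin (2 * pi * dotv l x)).
  rewrite /lincomb_re -(sum_undup_partition fst); apply: eq_bigr => l _.
  by rewrite !mulr_suml -sumrB; apply: eq_bigr => c /eqP ->.
have Eim x : lincomb_im s x = \sum_(l <- S) (p l * sin (2 * pi * dotv l x) + q l * cos (2 * pi * dotv l x)).
  rewrite /lincomb_im -(sum_undup_partition fst); apply: eq_bigr => l _.
  by rewrite !mulr_suml -big_split; apply: eq_bigr => c /eqP ->.
have uS : uniq S by exact: undup_uniq.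
have := @trig_distance R d mu Om Lam mOm Omoo Horth p q S Om t uS SL mOm (@subset_refl _ _).
rewrite -/m => D.
set I := Rintegral _ _ _ in D.
have bI : bdd_meas (fun x => (cos (2 * pi * dotv t x) - lincomb_re s x) ^+ 2 +
     (sin (2 * pi * dotv t x) - lincomb_im s x) ^+ 2).
  have b1 : bdd_meas (fun x => cos (2 * pi * dotv t x) - lincomb_re s x).
    apply: bdd_measB; first exact: bdd_meas_cos.
    by rewrite (funext Ere); exact: bdd_meas_trig_sum1.
  have b2 : bdd_meas (fun x => sin (2 * pi * dotv t x) - lincomb_im s x).
    apply: bdd_measB; first exact: bdd_meas_sin.
    by rewrite (funext Eim); exact: bdd_meas_trig_sum2.
  by apply: bdd_measD; apply: bdd_measM.
have II : I = Rintegral mu Om (fun x => (cos (2 * pi * dotv t x) - lincomb_re s x) ^+ 2 +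
     (sin (2 * pi * dotv t x) - lincomb_im s x) ^+ 2).
  by apply: eq_Rintegral => x xO; rewrite indicE xO !mul1r Ere Eim.
have fI := integrable_fin_num mOm (bdd_meas_integrable mOm Omoo bI).
rewrite -(fineK fI) lte_fin => lt; exists S; split=> //.
have {lt} : I < eta / m by rewrite II.
rewrite D ltr_pdivlMr// => lt.
have key l : 2 * m * (p l * icos mu Om (t - l) + q l * isin mu Om (t - l)) - m ^+ 2 * (p l ^+ 2 + q l ^+ 2) <= spec mu Om (t - l).
  rewrite /spec; set a := icos _ _ _; set b := isin _ _ _.
  have := sqr_ge0 (m * p l - a); have := sqr_ge0 (m * q l - b).
  rewrite !sqrrB; lra.
have : \sum_(l <- S) (2 * m * (p l * icos mu Om (t - l) + q l * isin mu Om (t - l)) -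
    m ^+ 2 * (p l ^+ 2 + q l ^+ 2)) <= \sum_(l <- S) spec mu Om (t - l).
  by apply: ler_sum => l _; exact: key.
rewrite sumrB -!mulr_sumr; move: lt.
move: (\sum_(l <- S) (p l * _ + _)) (\sum_(l <- S) (p l ^+ 2 + _)) (\sum_(l <- S) spec _ _ _) => X Y Z.
rewrite !mulrDl mulNr -!expr2 => lt le.
have : m ^+ 2 * Y = m * Y * m by ring.
by lra.
Qed.

(** With [A = Om - v], twice each summand is the squared modulus of the transform of [1_Om - 1_A],
    that is, of the indicator of [Om \ A] minus that of [A \ Om]. This is at most twice the sum of
    the two squared moduli, and Bessel's inequality bounds each. The set [A \ Om] is not inside
    [Om], but its translate [B] is, and translation preserves [spec]. *)
Lemma translation_sum (S : seq Rd) (t v : Rd) (e : R) : uniq S -> (forall l, l \in S -> Lam l) ->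
  (mu (Om `\` [set y : Rd | Om (y + v)%R]) <= e%:E)%E -> (mu (Om `\` [set y : Rd | Om (y - v)%R]) <= e%:E)%E ->
  \sum_(l <- S) spec mu Om (t - l) * (1 - cos (2 * pi * dotv (t - l) v)) <= 2 * m * e.
Proof.
move=> uS SL e1 e2.
set A := [set y : Rd | Om (y + v)%R] in e1; set B := Om `\` _ in e2.
have mA : borel_set A by exact: measurable_shift_set.
have mB : borel_set B by apply: measurableD => //; exact: measurable_shift_set.
have mOA : measurable (Om `\` A : set Bd) by exact: measurableD.
have Aoo : (mu A < +oo)%E by rewrite Hshift.
have BO : B `<=` Om by exact: subDsetl.
have OAO : Om `\` A `<=` Om by exact: subDsetl.
have Boo : (mu B < +oo)%E by apply: le_lt_trans Omoo; exact: measure_mono.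
have OAoo : (mu (Om `\` A) < +oo)%E by apply: le_lt_trans Omoo; exact: measure_mono.
have EB : A `\` Om = [set y | B (y + v)] by apply/seteqP; split=> y /=; rewrite /B/= addrK.
have key s : spec mu Om s * (1 - cos (2 * pi * dotv s v)) <= spec mu (Om `\` A) s + spec mu B s.
  have h1 := icosD s mOm mA Omoo Aoo; have h2 := isinD s mOm mA Omoo Aoo.
  rewrite -(spec_shift v s mB Boo) -EB /spec.
  rewrite icos_shift// in h1; rewrite isin_shift// in h2.
  move: h1 h2 (cos2Dsin2 (2 * pi * dotv s v)).
  move: (cos _) (sin _) (icos mu Om s) (isin mu Om s) (icos mu (Om `\` A) s) (isin mu (Om `\` A) s)
    (icos mu (A `\` Om) s) (isin mu (A `\` Om) s).
  move=> c n a b a1 b1 a2 b2 h1 h2 cn.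
  have E1 : (a - (c * a + n * b)) ^+ 2 + (b - (c * b - n * a)) ^+ 2 = 2 * ((a ^+ 2 + b ^+ 2) * (1 - c)).
    have -> : (a - (c * a + n * b)) ^+ 2 + (b - (c * b - n * a)) ^+ 2 = (1 - 2 * c + (c ^+ 2 + n ^+ 2)) * (a ^+ 2 + b ^+ 2) by ring.
    by rewrite cn; ring.
  rewrite h1 h2 in E1; have := sqr_ge0 (a1 + a2); have := sqr_ge0 (b1 + b2).
  move: E1; rewrite !sqrrB !sqrrD; lra.
apply: (@le_trans _ _ (\sum_(l <- S) (spec mu (Om `\` A) (t - l) + spec mu B (t - l)))).
  by apply: ler_sum => l _; exact: key.
rewrite big_split/=; have := bessel t uS SL mOA OAO; have := bessel t uS SL mB BO.
have f1 : fine (mu (Om `\` A)) <= e by rewrite -lee_fin fineK// ge0_fin_numE.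
have f2 : fine (mu B) <= e by rewrite -lee_fin fineK// ge0_fin_numE.
have := ler_wpM2l (ltW m0) f1; have := ler_wpM2l (ltW m0) f2.
by lra.
Qed.

End Spectrum.

(** * Slow steps in sequences of polynomial growth *)

Section Folner.
Variables (R : realType).

Lemma bernoulli_ge (eta : R) n : 0 <= eta -> 1 + n%:R * eta <= (1 + eta) ^+ n.
Proof.
move=> e0; elim: n => [|n IH]; first by rewrite mul0r addr0 expr0.
rewrite exprSr; apply: (@le_trans _ _ ((1 + n%:R * eta) * (1 + eta))).
  have : 0 <= n%:R * eta * eta by rewrite !mulr_ge0.
  rewrite -natr1 !mulrDl !mulrDr !mul1r !mulr1; lra.
by rewrite ler_wpM2r// addr_ge0.
Qed.

(* Polynomial growth along the scales [2 ^ j] excludes exponential growth. *)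
Lemma subexponential_step (N : nat -> nat) (Q k0 : nat) (c eta : R) :
  0 < c -> 0 < eta -> (0 < N k0)%N -> (0 < Q)%N ->
  (forall k j, k%:R <= c * 2 ^+ j -> (N k <= Q ^ j)%N) ->
  exists k, (k0 <= k)%N /\ (N k.+1)%:R <= (1 + eta) * (N k)%:R.
Proof.
move=> c0 eta0 N0 Q0 HQ; apply: contrapT => /forallNP H.
have step k : (k0 <= k)%N -> (1 + eta) * (N k)%:R < (N k.+1)%:R.
  by move=> kk; rewrite ltNge; apply/negP => le; exact: (H k).
have b0 : 0 < 1 + eta by rewrite addr_gt0.
have iter k i : (k0 <= k)%N -> (1 + eta) ^+ i * (N k)%:R <= (N (k + i)%N)%:R.
  move=> kk; elim: i => [|i IH]; first by rewrite expr0 mul1r addn0.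
  rewrite exprS -mulrA addnS; apply: le_trans (ltW (step (k + i)%N _)).
    by rewrite ler_pM2l.
  exact: leq_trans (leq_addr _ _).
pose i0 := (Num.truncn ((2 * Q)%:R / eta)).+1.
have bi0 : (2 * Q)%:R <= (1 + eta) ^+ i0.
  apply: le_trans (bernoulli_ge i0 (ltW eta0)).
  by apply: ler_wpDl => //; rewrite -ler_pdivrMr// ltW// truncnS_gt.
pose k1 := maxn k0 i0.
have k1k0 : (k0 <= k1)%N by exact: leq_maxl.
have k1i0 : (i0 <= k1)%N by exact: leq_maxr.
(* Growth by the factor [1 + eta] at each step multiplies [N] by at least [2 Q] when [k] is doubled,
   against the factor [Q] that the hypothesis allows. *)
have dbl k : (k1 <= k)%N -> ((2 * Q) * N k <= N (2 * k))%N.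
  move=> kk; rewrite -(ler_nat R) natrM [(2 * k)%N]mul2n -addnn.
  apply: le_trans (iter k k (leq_trans k1k0 kk)); rewrite ler_wpM2r//.
  apply: (le_trans bi0); apply: ler_weXn2l; first by rewrite lerDl ltW.
  exact: leq_trans kk.
have N1 : (0 < N k1)%N.
  have := iter k0 (k1 - k0)%N (leqnn _); rewrite subnKC// => le.
  by rewrite -(ltr_nat R); apply: lt_le_trans le; rewrite mulr_gt0 ?exprn_gt0 ?ltr0n.
have low j : ((2 * Q) ^ j <= N (2 ^ j * k1))%N.
  elim: j => [|j IH]; first by rewrite !expn0 mul1n.
  rewrite !expnS -[in leqRHS]mulnA; apply: leq_trans (dbl _ _); first by rewrite leq_mul2l IH orbT.
  by rewrite leq_pmull// expn_gt0.
pose j0 := Num.truncn (k1%:R / c).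
have kj0 : k1%:R <= c * 2 ^+ j0.+1.
  rewrite mulrC -ler_pdivrMr//; apply: (le_trans (ltW (truncnS_gt _))).
  by rewrite -natrX ler_nat ltnW// ltn_expl.
have up j : (N (2 ^ j * k1) <= Q ^ (j + j0.+1))%N.
  apply: HQ; rewrite exprD mulrCA natrM natrX ler_wpM2l// exprn_ge0//.
(* After cancellation the two bounds give [2 ^ j <= Q ^ j0.+1], which is false for
   [j = Q ^ j0.+1]. *)
have := leq_trans (low (Q ^ j0.+1)%N) (up (Q ^ j0.+1)%N).
rewrite expnMn expnD mulnC leq_pmul2l ?expn_gt0 ?Q0//.
by rewrite leqNgt ltn_expl.
Qed.

End Folner.

(** * Uniformly small tails in Parseval's identity *)

Section Concentration.
Variables (R : realType) (d : nat).
Local Notation Rd := 'rV[R]_d.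
Local Notation Bd := (RdBorel R d).
Variable mu : {measure set Bd -> \bar R}.
Hypothesis Hshift : translation_invariant mu.
Variables (Om : set Rd) (Lam : set Rd).
Hypotheses (mOm : borel_set Om) (Omoo : (mu Om < +oo)%E) (Om0 : (0 < mu Om)%E).
Hypothesis Ombd : bounded_set Om.
Hypothesis Horth : orthogonal_exp mu Om Lam.
Hypothesis Hcompl : complete_exp mu Om Lam.
Hypothesis Hcont : shift_continuous mu Om.

Let m := fine (mu Om).
Let m0 : 0 < m := fine_Om_gt0 Omoo Om0.

Lemma is_derive_bigsum (I : Type) (s : seq I) (f df : I -> R -> R) (x : R) :
  (forall i, is_derive x 1 (f i) (df i x)) ->
  is_derive x 1 (fun y => \sum_(i <- s) f i y) (\sum_(i <- s) df i x).
Proof.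
move=> H; elim: s => [|i s IH].
  rewrite big_nil (_ : (fun y => _) = cst 0); first exact: is_derive_cst.
  by apply/funext => y; rewrite big_nil.
rewrite big_cons (_ : (fun y => _) = f i + (fun y => \sum_(i <- s) f i y)).
  exact: is_deriveD.
by apply/funext => y; rewrite big_cons.
Qed.

(** An antiderivative of [K (1 - cos (a x))]: averages over [x] are then obtained from the mean
    value estimate. *)
Lemma is_derive_sin_defect (K a x : R) : a != 0 ->
  is_derive x 1 (fun y => K * (y - sin (0 + y * a) / a)) (K * (1 - cos (0 + x * a))).
Proof.
move=> a0.
have D1 : is_derive x (1 : R) (a^-1 *: (fun y : R => sin (0 + y * a))) (a^-1 *: (a * cos (0 + x * a))).
  by apply: is_deriveZ; exact: is_derive_sin_affine.
have D2 : is_derive x (1 : R) (K *: ((id : R -> R) - a^-1 *: (fun y : R => sin (0 + y * a))))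
    (K *: (1 - a^-1 *: (a * cos (0 + x * a)))).
  by apply: is_deriveZ; apply: is_deriveB.
have E : K *: ((id : R -> R) - a^-1 *: (fun y : R => sin (0 + y * a))) =
    (fun y => K * (y - sin (0 + y * a) / a)).
  by apply/funext => y; rewrite [sin _ / a]mulrC.
rewrite -E; apply: (is_derive_eq D2).
by rewrite /GRing.scale/= mulrA mulVf// mul1r.
Qed.

(** [translation_sum] is averaged over the translations [x *: 'e_j] with [0 <= x <= z]. The average
    of [1 - cos (a x)] is [1 - sin (a z) / (a z)], at least [1/2] when [|a| z >= 2], and this holds
    as soon as the [j]-th coordinate of [t - l] is at least [1 / z] in absolute value. The tolerance
    [eta / (4 m)] bounds the averaged sum by [eta / 2]. *)
Lemma spec_tail_coord (j : 'I_d) (eta : R) : 0 < eta -> exists2 L : R, 0 < L &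
  forall (S : seq Rd) (t : Rd), uniq S -> (forall l, l \in S -> Lam l) ->
  \sum_(l <- S | L <= `|(t - l) 0 j|) spec mu Om (t - l) <= eta.
Proof.
move=> eta0; have e0 : 0 < eta / (4 * m) by rewrite divr_gt0// mulr_gt0.
have [del del0 Hdel] := Hcont e0.
pose z := del / 2; have z0 : 0 < z by rewrite divr_gt0.
have zdel : z < del by rewrite /z; lra.
exists z^-1; first by rewrite invr_gt0.
move=> S t uS SL; rewrite -big_filter; set S' := seq.filter _ S.
have uS' : uniq S' by exact: filter_uniq.
have S'L l : l \in S' -> Lam l by rewrite mem_filter => /andP[_ /SL].
have S'z l : l \in S' -> z^-1 <= `|(t - l) 0 j| by rewrite mem_filter => /andP[].
(* The value [1] is a dummy that keeps [a l] nonzero for every [l]; on [S'] the second branch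
   applies. *)
pose a (l : Rd) : R := if `|(t - l) 0 j| == 0 then 1 else 2 * pi * (t - l) 0 j.
have pi4 : 4 <= 2 * pi :> R by have := @pi_ge2 R; lra.
have a0 l : a l != 0.
  rewrite /a; case: ifPn => [|n0]; first by rewrite oner_neq0.
  by apply: mulf_neq0; [rewrite gt_eqF//; lra|rewrite -normr_eq0].
have aS l : l \in S' -> a l = 2 * pi * (t - l) 0 j /\ 2 <= `|a l| * z.
  move=> /S'z H; rewrite /a gt_eqF; last by apply: lt_le_trans H; rewrite invr_gt0.
  split=> //; rewrite normrM ger0_norm; last by lra.
  rewrite -mulrA; apply: (@le_trans _ _ (4 * (z^-1 * z))); first by rewrite mulVf ?gt_eqF//; lra.
  apply: ler_pM => //; first by rewrite mulVf ?gt_eqF.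
  by rewrite ler_wpM2r// ltW.
pose G (x : R) := \sum_(l <- S') spec mu Om (t - l) * (x - sin (0 + x * a l) / a l).
have DG (x : R) : is_derive x 1 G (\sum_(l <- S') spec mu Om (t - l) * (1 - cos (0 + x * a l))).
  by apply: (is_derive_bigsum S' (df := fun (l : Rd) (x : R) => spec mu Om (t - l) * (1 - cos (0 + x * a l)))) => l;
    exact: is_derive_sin_defect.
have G0 : G 0 = 0 by rewrite /G big1// => l _; rewrite mul0r addr0 sin0 mul0r subr0 mulr0.
have := @mvt_le R G _ 0 z (2 * m * (eta / (4 * m))) DG.
rewrite G0 !subr0 => H; have {}H : `|G z| <= 2 * m * (eta / (4 * m)) * `|z|.
  apply: H => x; rewrite subr0 (gtr0_norm z0) => xz.
  have nv : `|x *: 'e_j : Rd| < del.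
    rewrite normrZ; apply: le_lt_trans zdel; apply: le_trans xz.
    by rewrite ler_piMr// norm_delta.
  rewrite ger0_norm; last first.
    by apply: sumr_ge0 => l _; rewrite mulr_ge0 ?spec_ge0// subr_ge0 cos_le1.
  have := @translation_sum R d mu Hshift Om Lam mOm Omoo Om0 Horth S' t (x *: 'e_j) _ uS' S'L (Hdel _ nv).
  move=> T; have {}T := T (Hdel (- (x *: 'e_j)) _); rewrite normrN in T; have {}T := T nv.
  apply: le_trans T; rewrite big_seq [leRHS]big_seq; apply: ler_sum => l lS.
  by rewrite (aS l lS).1 dotvZr dotv_delta add0r mulrCA.
have : (z / 2) * \sum_(l <- S') spec mu Om (t - l) <= G z.
  rewrite mulr_sumr /G big_seq [leRHS]big_seq; apply: ler_sum => l lS.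
  rewrite mulrC ler_wpM2l ?spec_ge0//.
  have [_ az] := aS l lS; have na : 0 < `|a l| by rewrite normr_gt0.
  have : `|sin (0 + z * a l) / a l| <= z / 2.
    rewrite normrM normfV ler_pdivrMr//; apply: (@le_trans _ _ 1); last by lra.
    by rewrite ler_norml sin_geN1 sin_le1.
  by rewrite ler_norml => /andP[_]; lra.
have Gz := ler_norm (G z); rewrite (gtr0_norm z0) in H => le.
have {}le := le_trans le (le_trans Gz H).
have E : 2 * m * (eta / (4 * m)) * z = (z / 2) * eta by field; rewrite gt_eqF.
by rewrite E ler_pM2l ?divr_gt0 in le.
Qed.

(** The sup norm is reached in one coordinate, so the coordinate tails cover the whole tail; the
    radius is a sum and hence exceeds each [L j]. *)
Lemma spec_tail (eta : R) : 0 < eta -> exists2 L : R, 0 < L &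
  forall (S : seq Rd) (t : Rd), uniq S -> (forall l, l \in S -> Lam l) ->
  \sum_(l <- S | L <= `|t - l|) spec mu Om (t - l) <= eta.
Proof.
move=> eta0; have e0 : 0 < eta / (d%:R + 1) by rewrite divr_gt0// ltr_wpDl.
have H j : exists L, 0 < L /\ forall (S : seq Rd) (t : Rd), uniq S -> (forall l, l \in S -> Lam l) ->
  \sum_(l <- S | L <= `|(t - l) 0 j|) spec mu Om (t - l) <= eta / (d%:R + 1).
  by have [L L0 HL] := spec_tail_coord j e0; exists L.
have [L HL] := choice H.
exists (\sum_j L j + 1).
  by rewrite ltr_wpDl// sumr_ge0// => j _; apply/ltW; have [] := HL j.
move=> S t uS SL.
apply: (@le_trans _ _ (\sum_j \sum_(l <- S | L j <= `|(t - l) 0 j|) spec mu Om (t - l))).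
  under [leRHS]eq_bigr do rewrite big_mkcond.
  rewrite exchange_big/= big_mkcond; apply: ler_sum => l _.
  have nn j : 0 <= (if L j <= `|(t - l) 0 j| then spec mu Om (t - l) else 0).
    by case: ifP => // _; exact: spec_ge0.
  case: ifPn => [le|_]; last by apply: sumr_ge0.
  have L0 : 0 < \sum_j L j + 1 by rewrite ltr_wpDl// sumr_ge0// => j _; apply/ltW; have [] := HL j.
  have [j jle] := norm_geP L0 le.
  rewrite (bigD1 j)//= ifT.
    by rewrite lerDl sumr_ge0.
  apply: le_trans jle; rewrite (bigD1 j)//= -addrA lerDl addr_ge0// sumr_ge0// => i _.
  by apply/ltW; have [] := HL i.
apply: (@le_trans _ _ (\sum_(j < d) eta / (d%:R + 1))).
  by apply: ler_sum => j _; apply: (HL j).2.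
rewrite sumr_const card_ord -[leLHS]mulr_natr mulrAC ler_pdivrMr ?ltr_wpDl//.
by rewrite ler_pM2l// lerDl.
Qed.

(** The point is a radius independent of [t]: Parseval's identity gives a finite set without control
    of its extent, and the uniform tail bound allows its far part to be discarded. *)
Lemma local_parseval (eta : R) : 0 < eta -> exists2 L : R, 0 < L & forall t : Rd, exists S : seq Rd,
  [/\ uniq S, forall l, l \in S -> Lam l, forall l, l \in S -> `|t - l| < L &
    m ^+ 2 - eta <= \sum_(l <- S) spec mu Om (t - l)].
Proof.
move=> eta0; have e0 : 0 < eta / 2 by rewrite divr_gt0.
have [L L0 HL] := spec_tail e0; exists L => // t.
have [S [uS SL HS]] := parseval mOm Omoo Om0 Horth Hcompl t e0.
exists (seq.filter (fun l => `|t - l| < L) S); split.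
- exact: filter_uniq.
- by move=> l; rewrite mem_filter => /andP[_ /SL].
- by move=> l; rewrite mem_filter => /andP[].
have T := HL S t uS SL.
have E : \sum_(l <- S) spec mu Om (t - l) =
    \sum_(l <- S | `|t - l| < L) spec mu Om (t - l) + \sum_(l <- S | L <= `|t - l|) spec mu Om (t - l).
  rewrite (bigID (fun l => `|t - l| < L))/=; congr (_ + _).
  by apply: eq_bigl => l; rewrite leNgt.
by rewrite big_filter; rewrite E in HS; rewrite -/m in HS; lra.
Qed.

Lemma spec0 : spec mu Om 0 = m ^+ 2.
Proof.
rewrite /spec /icos /isin.
under eq_Rintegral do rewrite dotvC dotv0r mulr0 cos0.
under [X in _ + X ^+ 2]eq_Rintegral do rewrite dotvC dotv0r mulr0 sin0.
by rewrite !Rintegral_cst// mul0r expr0n addr0 mul1r.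
Qed.

Lemma icos_continuous : continuous (icos mu Om).
Proof.
have [M [Mr HM]] := Ombd.
have {}HM x : Om x -> `|x| <= `|M| + 1.
  by apply: HM; apply: le_lt_trans (ler_norm _) _; rewrite ltrDl.
apply: (@lipschitz_rV_continuous _ _ _ (2 * pi * d%:R * (`|M| + 1) * m)) => s s'.
have I u := bdd_meas_integrable mOm Omoo (@bdd_meas_cos R d u).
have Id := @integrableB _ Bd R mu Om mOm _ _ (I s) (I s').
rewrite /icos -RintegralB//.
apply: (le_trans (le_normr_Rintegral mOm Id)).
apply: (@le_trans _ _ (Rintegral mu Om (fun=> 2 * pi * d%:R * (`|M| + 1) * `|s - s'|))).
  apply: le_Rintegral => //.
  - exact: (@integrable_norm _ Bd R mu Om _ Id).
  - by apply: bdd_meas_integrable => //; exact: bdd_meas_cst.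
  move=> x Ox; apply: (le_trans (cos_lip _ _)); rewrite -mulrBr -dotvBl normrM.
  have p0 : 0 <= 2 * pi :> R by have := @pi_ge2 R; lra.
  rewrite ger0_norm// -!mulrA ler_wpM2l ?pi_ge0 ?mulr_ge0//.
  rewrite ler_wpM2l ?pi_ge0//.
  apply: (le_trans (dotv_le _ _)); rewrite -mulrA ler_wpM2l// mulrC ler_wpM2r//.
  exact: HM.
by rewrite Rintegral_cst// -/m le_eqVlt; apply/orP; left; apply/eqP; ring.
Qed.

End Concentration.

(** * Separation of the spectrum and Folner sets *)

Section FolnerSets.
Variables (R : realType) (d : nat).
Local Notation Rd := 'rV[R]_d.
Local Notation Bd := (RdBorel R d).

(** A duplicate-free list of maximal length must contain every point of [P]. This turns the part of
    [Lam] in a ball into a list. *)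
Lemma bounded_enum (T : eqType) (P : T -> Prop) (N : nat) :
  (forall s : seq T, uniq s -> (forall x, x \in s -> P x) -> (size s <= N)%N) ->
  exists s : seq T, uniq s /\ forall x, x \in s <-> P x.
Proof.
move=> HN.
pose p n := `[< exists s : seq T, [/\ uniq s, forall x, x \in s -> P x & size s = n] >].
have exp : exists n, p n by exists 0%N; apply/asboolP; exists [::].
have pb n : p n -> (n <= N)%N by move=> /asboolP[s [us sP <-]]; exact: HN.
case: (ex_maxnP exp pb) => n /asboolP[s [us sP sn]] nmax.
exists s; split=> // x; split=> [|Px]; first exact: sP.
case: (boolP (x \in s)) => // xs.
have : (n.+1 <= n)%N; last by rewrite ltnn.
apply: nmax; apply/asboolP; exists (x :: s); split; rewrite /= ?xs ?sn//.
by move=> y; rewrite inE => /orP[/eqP->//|/sP].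
Qed.

Lemma ler_sum_uniq_sub (T : eqType) (s1 s2 : seq T) (f : T -> R) :
  uniq s1 -> uniq s2 -> {subset s1 <= s2} -> (forall x, 0 <= f x) ->
  \sum_(x <- s1) f x <= \sum_(x <- s2) f x.
Proof.
move=> u1 u2 s12 f0; rewrite [leRHS](bigID (mem s1))/= -[X in X + _]big_filter.
rewrite [X in _ <= X + _](perm_big s1).
  by rewrite lerDl sumr_ge0.
apply: uniq_perm => //; first exact: filter_uniq.
by move=> x; rewrite mem_filter /=; apply/andP/idP => [[]//|xs]; rewrite s12.
Qed.

Variable mu : {measure set Bd -> \bar R}.
Hypothesis Hshift : translation_invariant mu.
Variables (Om : set Rd) (Lam : set Rd).
Hypotheses (mOm : borel_set Om) (Omoo : (mu Om < +oo)%E) (Om0 : (0 < mu Om)%E).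
Hypothesis Ombd : bounded_set Om.

Lemma isin_continuous : continuous (isin mu Om).
Proof.
have [M [Mr HM]] := Ombd.
have {}HM x : Om x -> `|x| <= `|M| + 1.
  by apply: HM; apply: le_lt_trans (ler_norm _) _; rewrite ltrDl.
apply: (@lipschitz_rV_continuous _ _ _ (2 * pi * d%:R * (`|M| + 1) * fine (mu Om))) => s s'.
have I u := bdd_meas_integrable mOm Omoo (@bdd_meas_sin R d u).
have Id := @integrableB _ Bd R mu Om mOm _ _ (I s) (I s').
rewrite /isin -RintegralB//.
apply: (le_trans (le_normr_Rintegral mOm Id)).
apply: (@le_trans _ _ (Rintegral mu Om (fun=> 2 * pi * d%:R * (`|M| + 1) * `|s - s'|))).
  apply: le_Rintegral => //.
  - exact: (@integrable_norm _ Bd R mu Om _ Id).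
  - by apply: bdd_meas_integrable => //; exact: bdd_meas_cst.
  move=> x Ox; apply: (le_trans (sin_lip _ _)); rewrite -mulrBr -dotvBl normrM.
  have p0 : 0 <= 2 * pi :> R by have := @pi_ge2 R; lra.
  rewrite ger0_norm// -!mulrA ler_wpM2l ?pi_ge0 ?mulr_ge0//.
  rewrite ler_wpM2l ?pi_ge0//.
  apply: (le_trans (dotv_le _ _)); rewrite -mulrA ler_wpM2l// mulrC ler_wpM2r//.
  exact: HM.
by rewrite Rintegral_cst// le_eqVlt; apply/orP; left; apply/eqP; ring.
Qed.

Lemma spec_continuous : continuous (spec mu Om).
Proof.
have ci := icos_continuous mOm Omoo Ombd; have si := isin_continuous.
by apply: continuousD_rV; apply: continuousM_rV.
Qed.

Let m := fine (mu Om).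
Let m0 : 0 < m := fine_Om_gt0 Omoo Om0.

Lemma spec_pos_near0 : exists2 del : R, 0 < del & forall s, `|s| < del -> 0 < spec mu Om s.
Proof.
have m2 : 0 < m ^+ 2 by rewrite exprn_gt0.
have [del del0 H] := continuous_metric spec_continuous 0 m2.
exists del => // s sd; have := H s; rewrite sub0r normrN (spec0 mu mOm) => /(_ sd).
by rewrite -/m ltr_distlC => /andP[]; lra.
Qed.

Hypothesis Horth : orthogonal_exp mu Om Lam.

Lemma spec_orth l l' : Lam l -> Lam l' -> l <> l' -> spec mu Om (l - l') = 0.
Proof. by move=> Ll Ll' ll'; rewrite /spec; have [-> ->] := Horth Ll Ll' ll'; rewrite expr0n addr0. Qed.

(** [spec] is continuous with value [m ^+ 2] at the origin, and it vanishes at the difference of two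
    distinct points of the spectrum. *)
Lemma spectrum_separated : exists2 del : R, 0 < del &
  forall l l', Lam l -> Lam l' -> l <> l' -> del <= `|l - l'|.
Proof.
have [del del0 H] := spec_pos_near0; exists del => // l l' Ll Ll' ll'.
rewrite leNgt; apply/negP => /H; rewrite spec_orth// ltxx//.
Qed.

Hypothesis Hcompl : complete_exp mu Om Lam.
Hypothesis Hcont : shift_continuous mu Om.

(* By polynomial growth some ball [B] satisfies [#(Lam & (B + L)) <= (1 + eta) #(Lam & B)],
   and local completeness holds around each point of [Lam & B] inside [B + L]. *)
Lemma folner (eta : R) : 0 < eta -> exists s : seq Rd,
  [/\ uniq s, forall l, l \in s -> Lam l, (0 < size s)%N &
    forall v : Rd, `|v| <= 1 ->
      (m ^+ 2 - eta) * (size s)%:R <= \sum_(l <- s) \sum_(l' <- s) spec mu Om (l + v - l')].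
Proof.
move=> eta0.
have [del del0 Hdel] := spectrum_separated.
have e20 : 0 < eta / 2 by rewrite divr_gt0.
have [L L0 HL] := local_parseval Hshift mOm Omoo Om0 Horth Hcompl Hcont e20.
(* One unit more than the radius of local completeness, since [v] moves the centre by up to one. *)
pose L' := L + 1; have L'0 : 0 < L' by rewrite addr_gt0.
have cnt k j (s : seq Rd) : k%:R * L' <= del / 2 * 2 ^+ j -> uniq s ->
    (forall x, x \in s -> Lam x /\ `|x| < k%:R * L') -> (size s <= (3 ^ d) ^ j)%N.
  move=> kj us sP.
  have sep : separated del s by move=> x y /sP[xL _] /sP[yL _]; exact: Hdel.
  apply: leq_trans (separated_count_ball del0 sep us j 0).
  rewrite -size_filter (_ : seq.filter _ s = s)//; apply/all_filterP/allP => x /sP[_ xk].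
  by rewrite sub0r normrN; exact: lt_le_trans kj.
have enum k : exists s : seq Rd, uniq s /\ forall x, x \in s <-> (Lam x /\ `|x| < k%:R * L').
  pose j := (Num.truncn (k%:R * L' / (del / 2))).+1.
  apply: (@bounded_enum _ _ ((3 ^ d) ^ j)%N) => s us sP; apply: (cnt k) => //.
  rewrite [leRHS]mulrC -ler_pdivrMr ?divr_gt0//; apply: (le_trans (ltW (truncnS_gt _))).
  by rewrite -natrX ler_nat ltnW// ltn_expl.
have [S HS] := choice enum.
have m2 : 0 < m ^+ 2 by rewrite exprn_gt0.
(* The spectrum is not empty: an empty sum cannot reach [m ^+ 2 / 2] in Parseval's identity. *)
have [k0 N0] : exists k0, (0 < size (S k0))%N.
  have m22 : 0 < m ^+ 2 / 2 by rewrite divr_gt0.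
  have [[|l T] [uT TL]] := parseval mOm Omoo Om0 Horth Hcompl 0 m22.
    by rewrite big_nil -/m; lra.
  move=> _; exists (Num.truncn (`|l| / L')).+1.
  have : l \in S (Num.truncn (`|l| / L')).+1.
    apply/(HS _).2; split; first by apply: TL; rewrite mem_head.
    by rewrite -ltr_pdivrMr// truncnS_gt.
  by case: (S _).
have sub k k' : (k <= k')%N -> {subset S k <= S k'}.
  move=> kk' x /(HS _).2[xL xk]; apply/(HS _).2; split=> //.
  by apply: (lt_le_trans xk); apply: ler_wpM2r; [exact: ltW|rewrite ler_nat].
have c0 : 0 < del / 2 / L' by rewrite !divr_gt0.
(* The boundary ratio [rho = eta / (2 m^2)] satisfies [(m^2 - eta) (1 + rho) <= m^2 - eta / 2]; the
   other half of [eta] is spent on local completeness. *)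
have e2 : 0 < eta / (2 * m ^+ 2) by rewrite divr_gt0// mulr_gt0.
have Q0 : (0 < 3 ^ d)%N by rewrite expn_gt0.
have [k j|k [k0k Nk]] := subexponential_step (N := fun k => size (S k)) c0 e2 N0 Q0.
  move=> kj; apply: (cnt k).
  - by rewrite mulrAC ler_pdivlMr// in kj.
  - exact: (HS k).1.
  - by move=> x /(HS _).2.
exists (S k.+1); split.
- exact: (HS _).1.
- by move=> l /(HS _).2[].
- apply: leq_trans N0 _; apply: uniq_leq_size; first exact: (HS _).1.
  by apply: sub; exact: leqW.
move=> v v1.
have inner l : l \in S k -> m ^+ 2 - eta / 2 <= \sum_(l' <- S k.+1) spec mu Om (l + v - l').
  move=> /(HS _).2[lL lk]; have [S0 [uS0 S0L S0n /le_trans]] := HL (l + v); apply.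
  apply: ler_sum_uniq_sub => //; first exact: (HS _).1.
    move=> l' l'S; apply/(HS _).2; split; first exact: S0L.
    have := S0n _ l'S => ln; have -> : l' = l + v - (l + v - l') by rewrite opprB addrC subrK.
    apply: (le_lt_trans (ler_normB _ _)); have := ler_normD l v.
    by rewrite -natr1 mulrDl mul1r /L'; rewrite /L' in lk; lra.
  by move=> x; exact: spec_ge0.
have nn l : 0 <= \sum_(l' <- S k.+1) spec mu Om (l + v - l') by apply: sumr_ge0 => l' _; exact: spec_ge0.
have low : (m ^+ 2 - eta / 2) * (size (S k))%:R <= \sum_(l <- S k.+1) \sum_(l' <- S k.+1) spec mu Om (l + v - l').
  apply: (@le_trans _ _ (\sum_(l <- S k) \sum_(l' <- S k.+1) spec mu Om (l + v - l'))); last first.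
    by apply: ler_sum_uniq_sub => //; [exact: (HS _).1|exact: (HS _).1|exact: sub].
  rewrite mulr_natr.
  apply: (@le_trans _ _ (\sum_(l <- S k) (m ^+ 2 - eta / 2))).
    by rewrite big_const_seq count_predT iter_addr addr0.
  by rewrite big_seq [leRHS]big_seq; apply: ler_sum => l lS; exact: inner.
have T0 : 0 <= \sum_(l <- S k.+1) \sum_(l' <- S k.+1) spec mu Om (l + v - l') by apply: sumr_ge0.
have [me|em] := leP (m ^+ 2) eta.
  by apply: le_trans T0; rewrite mulr_le0_ge0// subr_le0.
apply: le_trans low.
apply: (@le_trans _ _ ((m ^+ 2 - eta) * ((1 + eta / (2 * m ^+ 2)) * (size (S k))%:R))).
  by rewrite ler_wpM2l// subr_ge0 ltW.
rewrite mulrA ler_wpM2r//.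
have -> : (m ^+ 2 - eta) * (1 + eta / (2 * m ^+ 2)) = m ^+ 2 - eta / 2 - eta * (eta / (2 * m ^+ 2)).
  by field; rewrite gt_eqF.
by rewrite gerBl mulr_ge0// ltW.
Qed.

End FolnerSets.

(** * Double integrals and the autocorrelation of a set *)

Section Autocorrelation.
Variables (R : realType) (d : nat).
Local Notation Rd := 'rV[R]_d.
Local Notation Bd := (RdBorel R d).

(** [Bd * Bd] carries the product sigma-algebra, so the argument goes through the coordinates, which
    are sums of measurable functions. *)
Lemma measurable_add_pair : measurable_fun setT ((fun xy => xy.1 + xy.2) : Bd * Bd -> Bd).
Proof.
apply: measurable_fun_borel => U oU.
apply: (@measurable_preimage_open R d _ (Bd * Bd)%type (fun xy => xy.1 + xy.2)) => // i.
rewrite (_ : (fun x => _) = (fun xy : Bd * Bd => (xy.1 : Rd) 0 i + (xy.2 : Rd) 0 i)).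
  apply: measurable_funD.
    by apply: (measurableT_comp (@measurable_coord R d i) measurable_fst).
  by apply: (measurableT_comp (@measurable_coord R d i) measurable_snd).
by apply/funext => xy; rewrite mxE.
Qed.

Variable mu : {measure set Bd -> \bar R}.
Hypothesis Hshift : translation_invariant mu.
Hypothesis Hbd : forall A : set Rd, borel_set A -> bounded_set A -> (mu A < +oo)%E.

Lemma bounded_ball (x : Rd) r : bounded_set (ball x r).
Proof.
exists (`|x| + r); split; first exact: num_real.
move=> M MM y /ball_norm xy; apply/ltW/(lt_trans _ MM).
by have := ler_normB x (x - y); rewrite opprB addrC subrK; lra.
Qed.

Lemma mu_sigma_finite : sigma_finite setT mu.
Proof.
exists (fun n => ball (0 : Rd) n.+1%:R).
  apply/seteqP; split=> // x _; exists (Num.truncn `|x : Rd|) => //.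
  by apply/ball_norm; rewrite sub0r normrN truncnS_gt.
move=> n; split; first exact: measurable_ball_borel.
by apply: Hbd; [exact: measurable_ball_borel|exact: bounded_ball].
Qed.

Let sfmu := isSFinite.Build _ _ _ _ (sfinite_measure_sigma_finite mu_sigma_finite).
Let sgmu := isSigmaFinite.Build _ _ _ _ mu_sigma_finite.
Let mus := HB.pack_for (SigmaFiniteMeasure.type Bd R) (Measure.sort mu) sfmu sgmu.

Variable Om : set Rd.
Hypotheses (mOm : borel_set Om).

(** The intersection is with [Om - x]; translation by [x] gives the same value for [Om + x]. *)
Definition autocorr (x : Rd) : \bar R := mu (Om `&` [set y : Rd | Om (y + x)%R]).

(** Tonelli's theorem with the substitution [z = x + y]. Integrals against the autocorrelation
    become double integrals over [Om], where orthogonality can act. *)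
Lemma tonelli_autocorr (phi : Rd -> R) : measurable_fun setT (phi : Bd -> R) -> (forall x, 0 <= phi x) ->
  (\int[mu]_(y in Om) \int[mu]_(z in Om) (phi (z - y)%R)%:E = \int[mu]_x ((phi x)%:E * autocorr x))%E.
Proof.
move=> mphi phi0.
pose h (xy : Bd * Bd) : \bar R := (\1_Om xy.2 * (\1_Om (xy.1 + xy.2 : Rd)%R * phi xy.1))%:E.
have mIO : measurable_fun setT (\1_Om : Bd -> R) by exact: measurable_indic.
have mh : measurable_fun setT h.
  apply/measurable_EFinP; apply: measurable_funM.
    exact: (measurableT_comp mIO (measurable_snd : measurable_fun setT (snd : Bd * Bd -> Bd))).
  apply: measurable_funM.
    exact: (measurableT_comp mIO measurable_add_pair).
  exact: (measurableT_comp mphi (measurable_fst : measurable_fun setT (fst : Bd * Bd -> Bd))).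
have h0 xy : (0 <= h xy)%E by rewrite lee_fin !mulr_ge0.
have := @fubini_tonelli _ _ Bd Bd R mus mus h mh h0.
have E1 x : (\int[mu]_y h (x, y) = (phi x)%:E * autocorr x)%E.
  have mOx : borel_set [set y : Rd | Om (y + x)%R] by exact: measurable_shift_set.
  rewrite /autocorr.
  transitivity (\int[mu]_y ((phi x)%:E * (\1_(Om `&` [set y : Rd | Om (y + x)%R]) y)%:E))%E.
    apply: eq_integral => y _; rewrite /h/= -EFinM; congr EFin.
    rewrite indicI/= [RHS]mulrC mulrA; congr (_ * _ * _).
    rewrite !indicE; congr (_%:R); congr nat_of_bool.
    by apply/idP/idP => /set_mem H; apply/mem_set; move: H => /=; rewrite addrC.
  rewrite (@ge0_integralZl _ Bd R mu setT measurableT (EFin \o \1_(Om `&` [set y : Rd | Om (y + x)%R]))).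
  - by rewrite integral_indic ?setIT//; exact: measurableI.
  - by apply/measurable_EFinP; apply: measurable_indic; exact: measurableI.
  - by move=> y _; rewrite lee_fin.
  - by rewrite lee_fin.
have E2 y : (\int[mu]_x h (x, y) = (\1_Om y)%:E * \int[mu]_(z in Om) (phi (z - y)%R)%:E)%E.
  have mg : measurable_fun setT ((fun z => \1_Om z * phi (z - y)) : Bd -> R).
    by apply: measurable_funM => //; exact: (measurable_fun_shift (- y) mphi).
  have mgE : measurable_fun setT ((fun z => (\1_Om z * phi (z - y))%:E) : Bd -> \bar R).
    exact/measurable_EFinP.
  have -> : (\int[mu]_(z in Om) (phi (z - y)%R)%:E = \int[mu]_z (\1_Om z * phi (z - y)%R)%:E)%E.
    rewrite integral_mkcond; apply: eq_integral => z _; rewrite patchE indicE.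
    by case: (boolP (z \in Om)) => _; rewrite ?mul1r ?mul0r.
  rewrite -(integral_shift Hshift y mgE).
  rewrite -(@ge0_integralZl _ Bd R mu setT measurableT (fun x => (\1_Om (x + y) * phi (x + y - y))%:E)).
  - by apply: eq_integral => x _; rewrite /h/= addrK -EFinM.
  - by apply/measurable_EFinP; exact: (measurable_fun_shift y mg).
  - by move=> x _; rewrite lee_fin mulr_ge0.
  - by rewrite lee_fin.
under eq_integral do rewrite E1.
under [in X in _ = X -> _]eq_integral do rewrite E2.
move=> ->; rewrite [LHS]integral_mkcond; apply: eq_integral => y _; rewrite patchE indicE.
by case: (boolP (y \in Om)) => _; rewrite ?mul1e ?mul0e.
Qed.

End Autocorrelation.

(** * Measures given by a density *)

Section Density.
Variables (R : realType) (dT : measure_display) (T : measurableType dT).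
Variable mu : {measure set T -> \bar R}.
Variable q : T -> R.
Hypotheses (mq : measurable_fun setT q) (q0 : forall x, 0 <= q x).

(** The proofs of measurability and nonnegativity are arguments so that the measure structure can be
    attached to the term itself. *)
Definition density_of (_ : measurable_fun setT q) (_ : forall x, 0 <= q x) (A : set T) : \bar R :=
  (\int[mu]_(x in A) (q x)%:E)%E.
Local Notation dens := (density_of mq q0).

Let dens0 : dens set0 = 0%E.
Proof. by rewrite /density_of integral_set0. Qed.

Let dens_ge0 A : (0 <= dens A)%E.
Proof. by apply: integral_ge0 => x _; rewrite lee_fin. Qed.

Let mqE : measurable_fun setT (EFin \o q).
Proof. exact/measurable_EFinP. Qed.

Let dens_sigma_additive : semi_sigma_additive dens.
Proof.
move=> F mF tF mUF; rewrite /density_of; apply: cvg_toP.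
  apply: ereal_nondecreasing_is_cvgn => m n mn.
  apply: lee_sum_nneg_natr => // k _ _.
  by apply: integral_ge0 => x _; rewrite lee_fin.
rewrite ge0_integral_bigcup//=; first by apply: measurable_funTS.
by move=> x _; rewrite lee_fin.
Qed.

HB.instance Definition _ := isMeasure.Build _ _ _ dens dens0 dens_ge0 dens_sigma_additive.

Import HBNNSimple.

Let integral_density_nnsfun (f : {nnsfun T >-> R}) :
  (\int[dens]_x (f x)%:E = \int[mu]_x ((f x)%:E * (q x)%:E))%E.
Proof.
under [LHS]eq_integral do rewrite fimfunE -fsumEFin//.
rewrite [LHS]ge0_integral_fsum//; last 2 first.
  - by move=> r; exact/measurable_EFinP/measurableT_comp.
  - by move=> n x _; rewrite EFinM nnfun_muleindic_ge0.
under [RHS]eq_integral.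
  move=> x xD; rewrite fimfunE -fsumEFin// ge0_mule_fsuml; last first.
    by move=> r; rewrite EFinM nnfun_muleindic_ge0.
  over.
rewrite [RHS]ge0_integral_fsum//; last 2 first.
  - move=> r; apply/measurable_EFinP/measurable_funM => //.
    exact/measurable_funM.
  - move=> n x _; rewrite mule_ge0//; last by rewrite lee_fin.
    by rewrite EFinM nnfun_muleindic_ge0.
apply: eq_fsbigr => r _.
have mI : measurable (f @^-1` [set r]) by [].
rewrite integralZl_indic_nnsfun// integral_indic// setIT.
under [RHS]eq_integral do rewrite EFinM -muleA.
have [r0|r0] := ltP r 0.
  rewrite preimage_nnfun0// measure0 mule0.
  under [RHS]eq_integral do rewrite indicE in_set0 mul0e mule0.
  by rewrite integral0.
rewrite ge0_integralZl//; last 2 first.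
- by apply/measurable_EFinP/measurable_funM.
- by move=> x _; rewrite mule_ge0// lee_fin.
congr (_ * _)%E; rewrite [LHS]integral_mkcond; apply: eq_integral => x _.
by rewrite patchE indicE; case: ifPn => _; rewrite ?mul1e ?mul0e.
Qed.

Lemma ge0_integral_density (f : T -> \bar R) : measurable_fun setT f -> (forall x, 0 <= f x)%E ->
  (\int[dens]_x f x = \int[mu]_x (f x * (q x)%:E))%E.
Proof.
move=> mf f0.
pose h := nnsfun_approx measurableT mf.
have -> : (\int[dens]_x f x = lim (\int[dens]_x (EFin \o h n) x @[n --> \oo]))%E.
  rewrite -monotone_convergence//=.
  - by apply: eq_integral => x _; apply/esym/cvg_lim => //; exact: cvg_nnsfun_approx.
  - by move=> n; exact/measurable_EFinP/measurable_funTS.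
  - by move=> n x _; rewrite lee_fin.
  - by move=> x _ a b ab; rewrite lee_fin; exact/lefP/nd_nnsfun_approx.
have -> : (\int[mu]_x (f x * (q x)%:E) =
    lim (\int[mu]_x ((EFin \o h n) x * (q x)%:E) @[n --> \oo]))%E.
  rewrite -monotone_convergence//=.
  - apply: eq_integral => x _; apply/esym/cvg_lim => //; apply: cvgeZr => //.
    exact: cvg_nnsfun_approx.
  - by move=> n; apply: emeasurable_funM => //; exact/measurable_EFinP/measurable_funTS.
  - by move=> n x _; rewrite mule_ge0 ?lee_fin.
  - by move=> x _ a b ab; rewrite lee_wpmul2r ?lee_fin//; exact/lefP/nd_nnsfun_approx.
by apply: congr_lim; apply/funext => n /=; exact: integral_density_nnsfun.
Qed.

Lemma Rintegral_density (f : T -> R) : measurable_fun setT f ->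
  Rintegral dens setT f = Rintegral mu setT (fun x => f x * q x).
Proof.
move=> mf; rewrite /Rintegral; congr fine.
have mfE : measurable_fun setT (EFin \o f) by exact/measurable_EFinP.
rewrite integralE [RHS]integralE.
rewrite !ge0_integral_density//; last 2 first.
- exact: measurable_funeneg.
- exact: measurable_funepos.
congr (_ - _)%E; apply: eq_integral => x _.
  by rewrite !funeposE /= EFinM maxe_pMl ?lee_fin// mul0e.
rewrite !funenegE [X in _ = Order.max X _](_ : _ = - (f x)%:E * (q x)%:E)%E.
  by rewrite maxe_pMl ?lee_fin// mul0e.
by rewrite /= -EFinM mulNr.
Qed.

End Density.

(** * Integrals of the periodogram against the autocorrelation *)

Section Periodogram.
Variables (R : realType) (d : nat).
Local Notation Rd := 'rV[R]_d.
Local Notation Bd := (RdBorel R d).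

(* [|sum_(l in s) e_l(x)|^2 / #s] *)
Definition periodogram (s : seq Rd) (x : Rd) : R :=
  (size s)%:R^-1 * ((\sum_(l <- s) cos (2 * pi * dotv l x)) ^+ 2 +
                    (\sum_(l <- s) sin (2 * pi * dotv l x)) ^+ 2).

Lemma periodogram_ge0 s x : 0 <= periodogram s x.
Proof. by rewrite mulr_ge0 ?invr_ge0// addr_ge0// sqr_ge0. Qed.

Lemma periodogramE s x : periodogram s x =
  (size s)%:R^-1 * \sum_(l <- s) \sum_(l' <- s) cos (2 * pi * dotv (l - l') x).
Proof.
rewrite /periodogram sum_sqrD; congr (_ * _).
apply: eq_bigr => l _; apply: eq_bigr => l' _.
by rewrite dotvBl mulrBr cosB.
Qed.

(** The double sum of sines changes sign when [l] and [l'] are exchanged, hence vanishes;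
    multiplication by a cosine therefore only shifts every frequency by [v]. *)
Lemma cos_periodogram s v x : cos (2 * pi * dotv v x) * periodogram s x =
  (size s)%:R^-1 * \sum_(l <- s) \sum_(l' <- s) cos (2 * pi * dotv (l - l' + v) x).
Proof.
rewrite periodogramE mulrCA; congr (_ * _).
have S0 : \sum_(l <- s) \sum_(l' <- s) sin (2 * pi * dotv (l - l') x) = 0.
  set S := LHS; suff : S = - S by lra.
  rewrite {1}/S exchange_big/= /S -sumrN; apply: eq_bigr => l _; rewrite -sumrN; apply: eq_bigr => l' _.
  by rewrite -sinN -mulrN -dotvNl opprB.
transitivity (cos (2 * pi * dotv v x) * (\sum_(l <- s) \sum_(l' <- s) cos (2 * pi * dotv (l - l') x)) -
  sin (2 * pi * dotv v x) * (\sum_(l <- s) \sum_(l' <- s) sin (2 * pi * dotv (l - l') x))).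
  by rewrite S0 mulr0 subr0.
rewrite [cos _ * _]mulr_sumr [sin _ * _]mulr_sumr -sumrB.
apply: eq_bigr => l _; rewrite [cos _ * _]mulr_sumr [sin _ * _]mulr_sumr -sumrB; apply: eq_bigr => l' _.
by rewrite [dotv (l - l' + v) x]dotvDl [2 * pi * (_ + _)]mulrDr cosD mulrC [X in _ - X]mulrC.
Qed.

Lemma measurable_periodogram s : measurable_fun setT (periodogram s : Bd -> R).
Proof.
have [M1 _] : bdd_meas (fun x : Rd => \sum_(l <- s) cos (2 * pi * dotv l x)).
  by apply: bdd_meas_sum => l; exact: bdd_meas_cos.
have [M2 _] : bdd_meas (fun x : Rd => \sum_(l <- s) sin (2 * pi * dotv l x)).
  by apply: bdd_meas_sum => l; exact: bdd_meas_sin.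
apply: measurable_funM => //; apply: measurable_funD; exact: measurable_funX.
Qed.

Variable mu : {measure set Bd -> \bar R}.
Hypothesis Hshift : translation_invariant mu.
Hypothesis Hbd : forall A : set Rd, borel_set A -> bounded_set A -> (mu A < +oo)%E.
Variables (Om Lam : set Rd).
Hypotheses (mOm : borel_set Om) (Omoo : (mu Om < +oo)%E) (Om0 : (0 < mu Om)%E).
Hypothesis Ombd : bounded_set Om.
Hypothesis Horth : orthogonal_exp mu Om Lam.
Local Notation m := (fine (mu Om)).

(** The triples are amplitude, frequency and phase. This form covers both the translated periodogram
    and its product with [1 - cos (2 pi <v, x>)]. *)
Definition trig_poly (r : seq (R * Rd * R)) (w : Rd) : R :=
  \sum_(i <- r) i.1.1 * cos (2 * pi * dotv i.1.2 w + i.2).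

Lemma integral_bdd_meas (g : Rd -> R) : bdd_meas g ->
  (\int[mu]_(x in Om) (g x)%:E = (Rintegral mu Om g)%:E)%E.
Proof.
move=> bg; rewrite /Rintegral fineK//; apply: integrable_fin_num => //.
exact: bdd_meas_integrable.
Qed.

Let bmZ (c : R) f : bdd_meas f -> bdd_meas (fun x : Rd => c * f x).
Proof. by move=> bf; apply: bdd_measM => //; exact: bdd_meas_cst. Qed.

Let dcos (t : Rd) (th : R) (y : Rd) : R :=
  (icos mu Om t * cos th - isin mu Om t * sin th) * cos (2 * pi * dotv t y) +
  (icos mu Om t * sin th + isin mu Om t * cos th) * sin (2 * pi * dotv t y).

Let bm_dcos t th : bdd_meas (dcos t th).
Proof. by apply: bdd_measD; apply: bmZ; [exact: bdd_meas_cos|exact: bdd_meas_sin]. Qed.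

Let cos_diff (t : Rd) (th : R) (y z : Rd) : cos (2 * pi * dotv t (z - y) + th) =
  cos (2 * pi * dotv t y - th) * cos (2 * pi * dotv t z) +
  sin (2 * pi * dotv t y - th) * sin (2 * pi * dotv t z).
Proof.
have -> : 2 * pi * dotv t (z - y) + th = 2 * pi * dotv t z - (2 * pi * dotv t y - th).
  by rewrite dotvBr; ring.
by rewrite cosB mulrC [X in _ + X]mulrC.
Qed.

(** The double integral of [e^{2 pi i <t, z - y>}] over [Om] is [spec mu Om t], a real number, so
    that a phase contributes its cosine alone. *)
Lemma double_integral_trig_poly r :
  (\int[mu]_(y in Om) \int[mu]_(z in Om) (trig_poly r (z - y)%R)%:E =
   (\sum_(i <- r) i.1.1 * cos i.2 * spec mu Om i.1.2)%:E)%E.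
Proof.
have inner y : (\int[mu]_(z in Om) (trig_poly r (z - y)%R)%:E =
  (\sum_(i <- r) i.1.1 * dcos i.1.2 i.2 y)%:E)%E.
  have bmi (i : R * Rd * R) : bdd_meas (fun z => i.1.1 * cos (2 * pi * dotv i.1.2 (z - y) + i.2)).
    apply: bmZ; under [fun x => _]eq_fun do rewrite cos_diff.
    by apply: bdd_measD; apply: bmZ; [exact: bdd_meas_cos|exact: bdd_meas_sin].
  rewrite integral_bdd_meas; last exact: bdd_meas_sum.
  rewrite bm_Rintegral_sum//; congr EFin; apply: eq_bigr => i _.
  under eq_Rintegral do rewrite cos_diff.
  rewrite bm_RintegralZ//; last first.
    by apply: bdd_measD; apply: bmZ; [exact: bdd_meas_cos|exact: bdd_meas_sin].
  rewrite bm_RintegralD//; [|by apply: bmZ; exact: bdd_meas_cos|by apply: bmZ; exact: bdd_meas_sin].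
  rewrite !bm_RintegralZ//; [|exact: bdd_meas_sin|exact: bdd_meas_cos].
  by rewrite -[Rintegral _ _ _]/(icos mu Om i.1.2) -/(isin mu Om i.1.2) cosB sinB /dcos; congr (_ * _); ring.
under eq_integral do rewrite inner.
rewrite integral_bdd_meas; last by apply: bdd_meas_sum => i; exact: bmZ.
rewrite bm_Rintegral_sum//; last by move=> i; exact: bmZ.
congr EFin; apply: eq_bigr => i _.
rewrite bm_RintegralZ// bm_RintegralD//; [|by apply: bmZ; exact: bdd_meas_cos|by apply: bmZ; exact: bdd_meas_sin].
rewrite !bm_RintegralZ//; [|exact: bdd_meas_sin|exact: bdd_meas_cos].
by rewrite -[Rintegral _ _ _]/(icos mu Om i.1.2) -/(isin mu Om i.1.2) /spec; ring.
Qed.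

Lemma sum_spec_diag (s : seq Rd) (c : Rd -> Rd -> R) : uniq s -> (forall l, l \in s -> Lam l) ->
  \sum_(l <- s) \sum_(l' <- s) c l l' * spec mu Om (l - l') = m ^+ 2 * \sum_(l <- s) c l l.
Proof.
move=> us sL; rewrite mulr_sumr big_seq [RHS]big_seq; apply: eq_bigr => l ls.
rewrite (bigD1_seq l)//= subrr spec0// big_seq_cond big1 ?addr0 1?mulrC//.
move=> l' /andP[l's /eqP ll']; rewrite (spec_orth (Lam := Lam))// ?mulr0//; [exact: sL|exact: sL|exact: nesym].
Qed.

(** On the diagonal [l = l'], the part that survives orthogonality, the phase introduced by [a]
    vanishes. *)
Lemma integral_periodogram_shift (s : seq Rd) (a : Rd) : uniq s -> (forall l, l \in s -> Lam l) ->
  (0 < size s)%N ->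
  (\int[mu]_x ((periodogram s (x + a)%R)%:E * autocorr mu Om x) = (m ^+ 2)%:E)%E.
Proof.
move=> us sL s0; have sn0 : (size s)%:R != 0 :> R by rewrite pnatr_eq0 -lt0n.
have T := @tonelli_autocorr R d mu Hshift Hbd Om mOm (fun x => periodogram s (x + a)).
rewrite -T; last 2 first.
- by apply: (measurable_fun_shift a); exact: measurable_periodogram.
- by move=> x; exact: periodogram_ge0.
pose r : seq (R * Rd * R) := [seq ((size s)%:R^-1 : R, l - l', 2 * pi * dotv (l - l') a) | l <- s, l' <- s].
have E w : periodogram s (w + a) = trig_poly r w.
  rewrite /trig_poly big_allpairs_dep/= periodogramE mulr_sumr; apply: eq_bigr => l _.
  by rewrite mulr_sumr; apply: eq_bigr => l' _; rewrite dotvDr mulrDr.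
under eq_integral do under eq_integral do rewrite E.
rewrite double_integral_trig_poly; congr EFin; rewrite big_allpairs_dep/= sum_spec_diag//.
rewrite (_ : \sum_(l <- s) _ = 1) ?mulr1//.
under eq_bigr do rewrite subrr dotvC dotv0r mulr0 cos0 mulr1.
by rewrite big_const_seq count_predT iter_addr_0 -[LHS]mulr_natr mulVf.
Qed.

(** The first term is again the diagonal; in the second, the frequencies shifted by [v] produce the
    very double sum that [folner] bounds from below. *)
Lemma integral_periodogram_defect (s : seq Rd) (v : Rd) : uniq s -> (forall l, l \in s -> Lam l) ->
  (0 < size s)%N ->
  (\int[mu]_x (((1 - cos (2 * pi * dotv v x)) * periodogram s x)%:E * autocorr mu Om x) =
   (m ^+ 2 - (size s)%:R^-1 * \sum_(l <- s) \sum_(l' <- s) spec mu Om (l + v - l'))%:E)%E.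
Proof.
move=> us sL s0; have sn0 : (size s)%:R != 0 :> R by rewrite pnatr_eq0 -lt0n.
have T := @tonelli_autocorr R d mu Hshift Hbd Om mOm
  (fun x => (1 - cos (2 * pi * dotv v x)) * periodogram s x).
rewrite -T; last 2 first.
- apply: measurable_funM; last exact: measurable_periodogram.
  by apply: measurable_funB => //; have [] := bdd_meas_cos v.
- by move=> x; rewrite mulr_ge0 ?periodogram_ge0// subr_ge0 cos_le1.
pose r1 : seq (R * Rd * R) := [seq ((size s)%:R^-1 : R, l - l', 0 : R) | l <- s, l' <- s].
pose r2 : seq (R * Rd * R) := [seq (- (size s)%:R^-1 : R, l - l' + v, 0 : R) | l <- s, l' <- s].
have E w : (1 - cos (2 * pi * dotv v w)) * periodogram s w = trig_poly (r1 ++ r2) w.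
  rewrite mulrBl mul1r cos_periodogram periodogramE /trig_poly big_cat !big_allpairs_dep/=.
  congr (_ + _); rewrite -?mulNr mulr_sumr; apply: eq_bigr => l _;
  by rewrite mulr_sumr; apply: eq_bigr => l' _; rewrite addr0.
under eq_integral do under eq_integral do rewrite E.
rewrite double_integral_trig_poly; congr EFin; rewrite big_cat !big_allpairs_dep/= cos0 !mulr1; congr (_ + _).
  by rewrite sum_spec_diag// big_const_seq count_predT iter_addr_0 -[X in _ * X]mulr_natr mulVf// mulr1.
rewrite -mulNr mulr_sumr; apply: eq_bigr => l _; rewrite mulr_sumr; apply: eq_bigr => l' _.
by rewrite addrAC.
Qed.

End Periodogram.

(** * The normalised counting measure of differences *)

Section DifferenceMeasure.
Variables (R : realType) (d : nat).
Local Notation Rd := 'rV[R]_d.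
Local Notation Bd := (RdBorel R d).
Implicit Type s : seq Rd.

Definition differences s : seq Rd := [seq x - y | x <- s, y <- s].

(** Differences are listed with multiplicity, so for a nonempty [s] the diagonal puts mass at least
    one at the origin. The default of [nth] lies beyond the range of the sum. *)
Definition diff_meas s : {measure set Bd -> \bar R} :=
  mscale ((size s)%:R^-1)%:nng
    (msum (fun k => dirac (nth (0 : Rd) (differences s) k : Bd)) (size (differences s))).

Let ge0_integral_diff_meas s (f : Bd -> \bar R) : measurable_fun setT f -> (forall x, 0 <= f x)%E ->
  (\int[diff_meas s]_x f x = (size s)%:R^-1%:E * \sum_(x <- differences s) f x)%E.
Proof.
move=> mf f0; rewrite ge0_integral_mscale// ge0_integral_measure_sum//; congr (_ * _)%E.
rewrite (big_nth (0 : Rd)) big_mkord; apply: eq_bigr => i _.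
by rewrite integral_dirac// diracT mul1e.
Qed.

Lemma Rintegral_diff_meas s (f : Rd -> R) : measurable_fun setT (f : Bd -> R) ->
  Rintegral (diff_meas s) setT f = (size s)%:R^-1 * \sum_(l <- s) \sum_(l' <- s) f (l - l').
Proof.
move=> mf; rewrite /Rintegral integralE.
have mfE : measurable_fun setT (EFin \o (f : Bd -> R)) by exact/measurable_EFinP.
rewrite !ge0_integral_diff_meas//; [|exact: measurable_funeneg|exact: measurable_funepos].
have P x : ((EFin \o f)^\+ x = (Num.max (f x) 0)%:E)%E by rewrite funeposE EFin_max.
have N x : ((EFin \o f)^\- x = (Num.max (- f x) 0)%:E)%E by rewrite funenegE EFin_max.
under eq_bigr do rewrite P.
under [X in (_ - _ * X)%E]eq_bigr do rewrite N.
rewrite !sumEFin -!EFinM -EFinB/= -mulrBr -sumrB; congr (_ * _).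
rewrite big_allpairs_dep/=; apply: eq_bigr => l _; apply: eq_bigr => l' _.
by case: (leP (f _) 0) => f0; case: leP; rewrite ?subr0 ?sub0r ?opprK//; lra.
Qed.

Lemma diff_measE s (A : set Rd) : borel_set A ->
  diff_meas s A = ((size s)%:R^-1 * \sum_(l <- s) \sum_(l' <- s) \1_A (l - l'))%:E.
Proof.
move=> mA; rewrite -[LHS](_ : (\int[diff_meas s]_x (\1_A x)%:E = _)%E); last first.
  by rewrite integral_indic// setIT.
rewrite (@ge0_integral_diff_meas s (EFin \o (\1_A : Bd -> R))).
- by rewrite sumEFin -EFinM big_allpairs_dep.
- by apply/measurable_EFinP; exact: measurable_indic.
- by move=> x; rewrite lee_fin.
Qed.

Lemma diff_meas_le s (A : set Rd) (c : R) : borel_set A -> (0 < size s)%N ->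
  (forall l, l \in s -> \sum_(l' <- s) \1_A (l - l') <= c) -> (diff_meas s A <= c%:E)%E.
Proof.
move=> mA s0 H; rewrite diff_measE// lee_fin ler_pdivrMl ?ltr0n//.
apply: (@le_trans _ _ (\sum_(l <- s) c)).
  by rewrite big_seq [leRHS]big_seq; exact: ler_sum.
by rewrite big_const_seq count_predT iter_addr_0 -[leLHS]mulr_natl.
Qed.

(** For fixed [l] the points [l'] that count lie in the unit ball about [l - x], and separation
    bounds their number independently of [s]; the measure is the average over [l]. *)
Lemma diff_meas_ball s (del : R) k (x : Rd) : separated del s -> 0 < del -> uniq s -> (0 < size s)%N ->
  1 <= del / 2 * 2 ^+ k -> (diff_meas s (ball x 1%R) <= (((3 ^ d) ^ k)%N%:R)%:E)%E.
Proof.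
move=> sep del0 us s0 k1; apply: diff_meas_le => //; first exact: measurable_ball_borel.
move=> l ls; have := separated_count_ball del0 sep us k (l - x).
rewrite -(ler_nat R); apply: le_trans.
rewrite -sum1_count natr_sum [leRHS]big_mkcond/=; apply: ler_sum => l' _.
rewrite indicE; case: (boolP (_ \in _)) => [/set_mem/ball_norm H|_]; last by case: ifP.
rewrite (_ : `|_| < _)//; apply: lt_le_trans k1; rewrite (_ : l - x - l' = - (x - (l - l'))) ?normrN//.
by rewrite !opprB addrC addrAC addrC.
Qed.

Lemma diff_meas_near0 s (del : R) (U : set Rd) : separated del s -> uniq s -> (0 < size s)%N ->
  borel_set U -> U `<=` ball (0%R : Rd) del -> (diff_meas s U <= 1%:E)%E.
Proof.
move=> sep us s0 mU Ud; apply: diff_meas_le => // l ls.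
rewrite (bigD1_seq l)//= big_seq_cond big1 ?addr0.
  by rewrite indicE lern1 leq_b1.
move=> l' /andP[l's /eqP ll']; rewrite indicE; case: (boolP (_ \in _)) => // /set_mem/Ud/ball_norm.
by rewrite sub0r normrN => /(le_lt_trans (sep _ _ ls l's (nesym ll'))); rewrite ltxx.
Qed.

Lemma diff_meas_set0 s : uniq s -> (0 < size s)%N -> (1%:E <= diff_meas s [set (0%R : Rd)])%E.
Proof.
move=> us s0; rewrite diff_measE; last first.
  by apply: measurable_compact; exact: compact_set1.
rewrite lee_fin ler_pdivlMl ?ltr0n// mulr1.
apply: (@le_trans _ _ (\sum_(l <- s) 1)).
  by rewrite big_const_seq count_predT iter_addr_0.
rewrite big_seq [leRHS]big_seq; apply: ler_sum => l ls.
rewrite (bigD1_seq l)//= subrr indicE mem_set// lerDl.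
by apply: sumr_ge0 => l' _; rewrite indicE.
Qed.

Lemma diff_meas_notin s (U : set Rd) : borel_set U ->
  (forall l l', l \in s -> l' \in s -> ~ U (l - l')) -> diff_meas s U = 0%E.
Proof.
move=> mU H; rewrite diff_measE// big_seq big1 ?mulr0// => l ls.
by rewrite big_seq big1// => l' l's; rewrite indicE memNset//; exact: H.
Qed.

End DifferenceMeasure.

(** * Continuity of the autocorrelation and concentration at the origin *)

Section AutocorrelationFunction.
Variables (R : realType) (d : nat).
Local Notation Rd := 'rV[R]_d.
Local Notation Bd := (RdBorel R d).
Variable mu : {measure set Bd -> \bar R}.
Hypothesis Hshift : translation_invariant mu.
Hypothesis Hbd : forall A : set Rd, borel_set A -> bounded_set A -> (mu A < +oo)%E.
Variables (Om Lam : set Rd).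
Hypotheses (mOm : borel_set Om) (Omoo : (mu Om < +oo)%E) (Om0 : (0 < mu Om)%E).
Hypothesis Ombd : bounded_set Om.
Hypothesis Horth : orthogonal_exp mu Om Lam.
Hypothesis Hcont : shift_continuous mu Om.
Let m := fine (mu Om).

Definition rautocorr (x : Rd) : R := fine (autocorr mu Om x).

Let mOx (x : Rd) : borel_set [set y : Rd | Om (y + x)%R].
Proof. exact: measurable_shift_set. Qed.

Lemma autocorr_le (x : Rd) : (autocorr mu Om x <= mu Om)%E.
Proof.
apply: (@measure_mono _ Bd R mu); [exact: measurableI|by []|exact: subIsetl].
Qed.

Lemma rautocorrE x : (rautocorr x)%:E = autocorr mu Om x.
Proof.
rewrite fineK// ge0_fin_numE; last exact: measure_ge0.
exact: le_lt_trans (autocorr_le x) Omoo.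
Qed.

Lemma rautocorr_ge0 x : 0 <= rautocorr x.
Proof. by rewrite -lee_fin rautocorrE measure_ge0. Qed.

Lemma rautocorr_le x : rautocorr x <= m.
Proof.
rewrite -lee_fin rautocorrE fineK ?autocorr_le//.
by rewrite ge0_fin_numE ?measure_ge0.
Qed.

Lemma rautocorr0 : rautocorr 0 = m.
Proof.
rewrite /rautocorr /autocorr; congr (fine (mu _)).
by apply/seteqP; split=> y /=; rewrite addr0; tauto.
Qed.

(** A point of [Om - x] outside [Om - y] becomes, after translation by [x], a point of [Om] outside
    [Om - (y - x)]. The one-sided estimate is used for both orders of [x] and [y]. *)
Lemma rautocorr_lip x y :
  ((rautocorr x - rautocorr y)%:E <= mu (Om `\` [set z : Rd | Om (z + (y - x))%R]))%E.
Proof.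
rewrite EFinB !rautocorrE leeBlDr -?rautocorrE// rautocorrE rautocorrE.
pose A := [set z : Rd | Om (z + x)%R] `\` [set z : Rd | Om (z + y)%R].
have -> : mu (Om `\` [set z : Rd | Om (z + (y - x))%R]) = mu A.
  rewrite -(Hshift x); last by apply: measurableD => //.
  have E z : z + x + (y - x) = z + y by rewrite [y - x]addrC addrA addrK.
  by congr (mu _); apply/seteqP; split=> z /=; rewrite /A/= E.
have mA : borel_set A by exact: measurableD.
apply: (@le_trans _ _ (mu (A `|` (Om `&` [set z : Rd | Om (z + y)%R])))).
  apply: (@measure_mono _ Bd R mu); first exact: measurableI.
    by apply: measurableU => //; exact: measurableI.
  by move=> z [Oz Oxz]; have [Oyz|Oyz] := pselect (Om (z + y)); [right|left].
by apply: measureU2 => //; exact: measurableI.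
Qed.

Lemma rautocorr_continuous : continuous (rautocorr : Rd -> R).
Proof.
move=> x; apply/(@cvgrPdist_le _ _ _ (nbhs (x : Rd)) (nbhs_filter (x : Rd))) => e e0.
have [del del0 H] := Hcont e0.
apply/nbhs_ballP; exists del => // y /ball_norm xy.
have H1 := le_trans (rautocorr_lip x y) (H _ _); have H2 := le_trans (rautocorr_lip y x) (H _ _).
rewrite !lee_fin in H1 H2.
have {}H1 : rautocorr x - rautocorr y <= e by apply: H1; rewrite -normrN opprB.
have {}H2 := H2 xy.
by rewrite ler_norml; apply/andP; split; lra.
Qed.

Lemma measurable_autocorr : measurable_fun setT (autocorr mu Om : Bd -> \bar R).
Proof.
have -> : autocorr mu Om = EFin \o rautocorr by apply/funext => x; rewrite /= rautocorrE.
apply/(@measurable_EFinP _ Bd); apply: continuous_measurable; exact: rautocorr_continuous.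
Qed.

Lemma rautocorr_supp : exists2 D : R, 1 <= D & forall x, rautocorr x != 0 -> `|x| <= D.
Proof.
have [M [Mr HM]] := Ombd.
have {}HM x : Om x -> `|x| <= `|M| + 1.
  by apply: HM; rewrite (le_lt_trans (ler_norm M))// ltrDl.
exists (2 * (`|M| + 1)); first by have := normr_ge0 M; lra.
move=> x; apply: contraNT; rewrite -ltNge => xM; apply/eqP.
rewrite /rautocorr /autocorr (_ : _ `&` _ = set0) ?measure0//.
apply/seteqP; split=> // y /= [/HM Oy /HM Oyx].
have := ler_normB (y + x) y; rewrite [y + x]addrC addrK => H.
by move: Oyx; rewrite addrC => Oyx; lra.
Qed.

(* [1 - cos (pi x_j / D)] stays away from zero for [r <= |x_j| <= D]. *)
Lemma periodogram_concentration (r : R) : 0 < r -> exists2 K : R, 0 <= K &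
  forall (s : seq Rd) (eta : R), uniq s -> (forall l, l \in s -> Lam l) -> (0 < size s)%N ->
  (forall v : Rd, `|v| <= 1 ->
     (m ^+ 2 - eta) * (size s)%:R <= \sum_(l <- s) \sum_(l' <- s) spec mu Om (l + v - l')) ->
  (\int[mu]_(x in [set x : Rd | (r <= `|x|)%R]) ((periodogram s x)%:E * autocorr mu Om x) <= (K * eta)%:E)%E.
Proof.
move=> r0; have [D D1 HD] := rautocorr_supp.
have D0 : 0 < D by apply: lt_le_trans D1.
(* Cutting [r] at [D] keeps [2 pi tau r'] inside the interval where the cosine decreases. *)
pose r' := Num.min r D; have r'0 : 0 < r' by rewrite lt_min r0.
(* Then [2 pi tau |x_j| <= pi] on the support of the autocorrelation, and [D >= 1] makes
   [tau *: 'e_j] of norm at most one, as the Folner bound requires. *)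
pose tau := (2 * D)^-1; have tau0 : 0 < tau by rewrite invr_gt0 mulr_gt0.
have p0 := pi_gt0 R.
have tauD : 2 * pi * (tau * D) = pi :> R by rewrite /tau; field; rewrite gt_eqF.
pose kap := 1 - cos (2 * pi * (tau * r')).
have arg_le y : 0 <= y <= D -> 2 * pi * (tau * y) \in `[0, pi].
  move=> /andP[y0 yD]; rewrite in_itv/=; apply/andP; split.
    by rewrite !mulr_ge0// ltW.
  by rewrite -[leRHS]tauD ler_pM2l ?mulr_gt0// ler_pM2l.
have kap0 : 0 < kap.
  rewrite subr_gt0 -[ltRHS](@cos0 R) ltr_cos.
  - by rewrite !mulr_gt0.
  - by rewrite in_itv/= lexx ltW.
  - by apply: arg_le; rewrite ltW//= ge_min lexx orbT.
have key y : r' <= `|y| -> `|y| <= D -> kap <= 1 - cos (2 * pi * (tau * y)).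
  move=> ry yD; rewrite lerD2l lerN2.
  have -> : cos (2 * pi * (tau * y)) = cos (2 * pi * (tau * `|y|)).
    by case: (ger0P y) => // _; rewrite !mulrN cosN.
  rewrite leNgt ltr_cos -?leNgt; first by rewrite ler_pM2l ?mulr_gt0// ler_pM2l.
    by apply: arg_le; rewrite normr_ge0.
  by apply: arg_le; rewrite ltW//= ge_min lexx orbT.
exists (kap^-1 * d%:R) => [|s eta us sL s0 Hs]; first by rewrite mulr_ge0// invr_ge0 ltW.
have sn0 : 0 < (size s)%:R :> R by rewrite ltr0n.
pose v (j : 'I_d) : Rd := tau *: 'e_j.
have dv j x : dotv (v j) x = tau * x 0 j by rewrite dotvC dotvZr dotv_delta.
have v1 j : `|v j| <= 1.
  apply/norm_leP => // i; rewrite !mxE eqxx/= normrM gtr0_norm// ger0_norm ?ler0n//.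
  apply: (@le_trans _ _ tau); first by apply: ler_piMr; [exact: ltW|rewrite lern1 leq_b1].
  by rewrite invf_le1 ?mulr_gt0//; lra.
pose h j (x : Rd) := (1 - cos (2 * pi * dotv (v j) x)) * periodogram s x * rautocorr x.
have h0 j x : 0 <= h j x.
  apply: mulr_ge0; last exact: rautocorr_ge0.
  by apply: mulr_ge0; [rewrite subr_ge0 cos_le1|exact: periodogram_ge0].
have mf : measurable_fun setT (rautocorr : Bd -> R).
  by apply: continuous_measurable; exact: rautocorr_continuous.
have mQ := measurable_periodogram s.
have mh j : measurable_fun setT ((fun x => (h j x)%:E) : Bd -> \bar R).
  apply/(@measurable_EFinP _ Bd); apply: measurable_funM => //; apply: measurable_funM => //.
  by apply: measurable_funB => //; have [] := bdd_meas_cos (v j).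
have mr : borel_set [set x : Rd | (r <= `|x|)%R].
  rewrite (_ : [set _ | _] = ~` ball 0 r).
    by apply: measurableC; exact: measurable_ball_borel.
  apply/seteqP; split=> x /=; rewrite -ball_normE /= sub0r normrN leNgt; first by move/negP.
  by move=> H; apply/negP.
(* Where the autocorrelation is nonzero and [|x| >= r], some coordinate is at least [r'] in absolute
   value, and the corresponding [h j] alone dominates. *)
apply: (@le_trans _ _ (\int[mu]_x (kap^-1%:E * \sum_(j < d) (h j x)%:E))%E).
  rewrite integral_mkcond; apply: ge0_le_integral => //.
  - move=> x _; rewrite patchE; case: ifP => // _.
    by rewrite mule_ge0 ?lee_fin ?periodogram_ge0// measure_ge0.
  - apply/(measurable_restrictT _ mr)/measurable_funTS; apply: emeasurable_funM.
      exact/(@measurable_EFinP _ Bd).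
    exact: measurable_autocorr.
  - by apply: emeasurable_funM => //; exact: emeasurable_sum.
  - move=> x _; rewrite patchE sumEFin -EFinM; case: ifPn => [/set_mem/= rx|_]; last first.
      by rewrite lee_fin; apply: mulr_ge0; [rewrite invr_ge0 ltW|exact: sumr_ge0].
    rewrite -rautocorrE -EFinM lee_fin ler_pdivlMl//.
    have [->|fx] := eqVneq (rautocorr x) 0; first by rewrite !mulr0 sumr_ge0.
    have r'x : r' <= `|x| by rewrite ge_min rx.
    have [j jx] := norm_geP r'0 r'x.
    rewrite (bigD1 j)//=; apply: (@le_trans _ _ (h j x)); last by rewrite lerDl sumr_ge0.
    rewrite mulrA ler_wpM2r ?rautocorr_ge0// ler_wpM2r ?periodogram_ge0// dv key//.
    exact: le_trans (le_coord_norm _ _) (HD _ fx).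
rewrite ge0_integralZl//; last 3 first.
- exact: emeasurable_sum.
- by move=> x _; rewrite sumEFin lee_fin sumr_ge0.
- by rewrite lee_fin invr_ge0 ltW.
rewrite ge0_integral_sum//; last by move=> j x _; rewrite lee_fin.
rewrite -mulrA EFinM; apply: lee_wpmul2l; first by rewrite lee_fin invr_ge0 ltW.
apply: (@le_trans _ _ (\sum_(j < d) eta%:E)%E); last first.
  by rewrite sumEFin lee_fin big_const_ord iter_addr_0 mulr_natl.
apply: lee_sum => j _.
rewrite (_ : integral _ _ _ = (m ^+ 2 - (size s)%:R^-1 * \sum_(l <- s) \sum_(l' <- s) spec mu Om (l + v j - l'))%:E).
  rewrite lee_fin lerBlDr -lerBlDl ler_pdivlMl// mulrC; exact: Hs.
rewrite -(integral_periodogram_defect Hshift Hbd mOm Omoo Horth)//.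
by apply: eq_integral => x _; rewrite -rautocorrE -EFinM.
Qed.

End AutocorrelationFunction.

(** * Bounds on the measures with periodogram density *)

Section PeriodogramMeasure.
Variables (R : realType) (d : nat).
Local Notation Rd := 'rV[R]_d.
Local Notation Bd := (RdBorel R d).
Variable mu : {measure set Bd -> \bar R}.

Definition periodogram_meas (s : seq Rd) : {measure set Bd -> \bar R} :=
  density_of mu (measurable_periodogram s) (periodogram_ge0 s).

Lemma Rintegral_periodogram_meas (s : seq Rd) (f : Rd -> R) : measurable_fun setT (f : Bd -> R) ->
  Rintegral (periodogram_meas s) setT f = Rintegral mu setT (fun x => f x * periodogram s x).
Proof. exact: Rintegral_density. Qed.

Hypothesis Hshift : translation_invariant mu.
Hypothesis Hbd : forall A : set Rd, borel_set A -> bounded_set A -> (mu A < +oo)%E.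
Variables (Om Lam : set Rd).
Hypotheses (mOm : borel_set Om) (Omoo : (mu Om < +oo)%E) (Om0 : (0 < mu Om)%E).
Hypothesis Ombd : bounded_set Om.
Hypothesis Horth : orthogonal_exp mu Om Lam.
Hypothesis Hcont : shift_continuous mu Om.
Let m := fine (mu Om).
Let m0 : 0 < m := fine_Om_gt0 Omoo Om0.
Local Notation f := (rautocorr mu Om).

Let mf : measurable_fun setT (autocorr mu Om : Bd -> \bar R).
Proof. exact: measurable_autocorr. Qed.

Let mQ s : measurable_fun setT ((fun x => (periodogram s x)%:E) : Bd -> \bar R).
Proof. by apply/measurable_EFinP; exact: measurable_periodogram. Qed.

Let mQf s (a : Rd) : measurable_fun setT ((fun x => (periodogram s (x + a)%R)%:E * autocorr mu Om x)%E : Bd -> \bar R).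
Proof.
apply: emeasurable_funM => //; apply/measurable_EFinP; apply: (measurable_fun_shift a).
exact: measurable_periodogram.
Qed.

Let mQf0 s : measurable_fun setT ((fun x => (periodogram s x)%:E * autocorr mu Om x)%E : Bd -> \bar R).
Proof. exact: emeasurable_funM. Qed.

Let Qf0 s a x : (0 <= (periodogram s (x + a)%R)%:E * autocorr mu Om x)%E.
Proof. by rewrite mule_ge0 ?lee_fin ?periodogram_ge0// measure_ge0. Qed.

Let Qf00 s x : (0 <= (periodogram s x)%:E * autocorr mu Om x)%E.
Proof. by rewrite mule_ge0 ?lee_fin ?periodogram_ge0// measure_ge0. Qed.

Let cQ (A : set Rd) s c : borel_set A -> 0 <= c ->
  (\int[mu]_(x in A) (c%:E * (periodogram s x)%:E) = c%:E * periodogram_meas s A)%E.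
Proof.
move=> mA c0; rewrite ge0_integralZl//; last by move=> x _; rewrite lee_fin periodogram_ge0.
exact: measurable_funTS.
Qed.

Lemma periodogram_meas_lower (A : set Rd) s c : borel_set A -> 0 <= c ->
  (forall x, A x -> c <= f x) ->
  (c%:E * periodogram_meas s A <= \int[mu]_(x in A) ((periodogram s x)%:E * autocorr mu Om x))%E.
Proof.
move=> mA c0 H; rewrite -cQ//; apply: ge0_le_integral => //.
- by move=> x _; rewrite mule_ge0 ?lee_fin ?periodogram_ge0.
- by apply: measurable_funTS; exact: emeasurable_funM.
- exact: measurable_funTS.
- move=> x /H cf; rewrite -rautocorrE// -!EFinM lee_fin mulrC.
  by apply: ler_wpM2l => //; exact: periodogram_ge0.
Qed.

Lemma periodogram_meas_upper (A : set Rd) s : borel_set A ->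
  (\int[mu]_(x in A) ((periodogram s x)%:E * autocorr mu Om x) <= m%:E * periodogram_meas s A)%E.
Proof.
move=> mA; rewrite -(cQ s mA (ltW m0)); apply: ge0_le_integral => //.
- exact: measurable_funTS.
- by apply: measurable_funTS; exact: emeasurable_funM.
- move=> x _; rewrite -rautocorrE// -!EFinM lee_fin [leRHS]mulrC.
  by apply: ler_wpM2l; [exact: periodogram_ge0|exact: rautocorr_le].
Qed.

Definition admissible (s : seq Rd) := [/\ uniq s, forall l, l \in s -> Lam l & (0 < size s)%N].

Let total s : admissible s ->
  (\int[mu]_x ((periodogram s x)%:E * autocorr mu Om x) = (m ^+ 2)%:E)%E.
Proof.
move=> [us sL s0].
rewrite -(integral_periodogram_shift Hshift Hbd mOm Omoo Horth 0 us sL s0).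
by apply: eq_integral => x _; rewrite addr0.
Qed.

(** Markov's inequality for the total mass [m ^+ 2] of [f nu_s]. *)
Lemma periodogram_meas_superlevel (A : set Rd) s c : borel_set A -> 0 < c ->
  (forall x, A x -> c <= f x) -> admissible s -> (periodogram_meas s A <= (m ^+ 2 / c)%:E)%E.
Proof.
move=> mA c0 H As; rewrite EFinM lee_pdivlMr// muleC.
apply: (le_trans (periodogram_meas_lower s mA (ltW c0) H)); rewrite -(total As).
by apply: ge0_subset_integral.
Qed.

(** [f] is at least [m / 2] on a ball of radius [del]. Translating the periodogram brings any ball
    of this radius to the origin, whence mass at most [2 m]; a number of doublings that depends only
    on [del] leads to radius one. *)
Lemma periodogram_meas_ball : exists2 C, 0 <= C &
  forall s, admissible s -> forall x : Rd, (periodogram_meas s (ball x 1%R) <= C%:E)%E.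
Proof.
have m20 : 0 < m / 2 by rewrite divr_gt0.
have [del del0 H] := continuous_metric (rautocorr_continuous Hshift mOm Omoo Hcont) 0 m20.
have {}H (x : Rd) : ball (0 : Rd) del x -> m / 2 <= f x.
  by move=> /ball_norm/H; rewrite rautocorr0 -/m ltr_distlC => /andP[? _]; lra.
have B s : admissible s -> forall x : Rd, (periodogram_meas s (ball x del) <= (2 * m)%:E)%E.
  move=> [us sL s0] a.
  pose h (x : Rd) : \bar R := (\1_(ball a del) x * periodogram s x)%:E.
  have mI : measurable (ball a del : set Bd) by exact: measurable_ball_borel.
  have mh : measurable_fun setT (h : Bd -> \bar R).
    apply/(@measurable_EFinP _ Bd); apply: measurable_funM; last exact: measurable_periodogram.
    exact: measurable_indic.
  have -> : periodogram_meas s (ball a del) = (\int[mu]_x h x)%E.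
    rewrite [LHS]integral_mkcond; apply: eq_integral => x _; rewrite patchE /h indicE.
    by case: ifP; rewrite ?mul1r ?mul0r.
  rewrite -(integral_shift Hshift a mh).
  apply: (@le_trans _ _ (\int[mu]_x ((2 / m)%:E * ((periodogram s (x + a)%R)%:E * autocorr mu Om x)))%E).
    apply: ge0_le_integral => //.
    - by move=> x _; rewrite lee_fin mulr_ge0 ?periodogram_ge0.
    - have mb : measurable_fun setT ((fun x => \1_(ball a del) x * periodogram s x) : Bd -> R).
        apply: measurable_funM; last exact: measurable_periodogram.
        exact: measurable_indic.
      by apply/measurable_EFinP; exact: (measurable_fun_shift a mb).
    - exact: emeasurable_funM.
    - move=> x _; rewrite /h -rautocorrE// -!EFinM lee_fin indicE.
      case: (boolP (_ \in _)) => [/set_mem/ball_norm xa|_]; last first.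
        rewrite mul0r; apply: mulr_ge0; first by rewrite divr_ge0// ltW.
        by apply: mulr_ge0; [exact: periodogram_ge0|exact: rautocorr_ge0].
      rewrite mul1r [leRHS]mulrCA -[leLHS]mulr1; apply: ler_wpM2l; first exact: periodogram_ge0.
      rewrite mulrAC ler_pdivlMr// mul1r -ler_pdivrMl// mulrC; apply: H.
      by apply/ball_norm; move: xa; rewrite opprD addrCA subrr addr0 sub0r.
  rewrite ge0_integralZl//; last by rewrite lee_fin divr_ge0// ltW.
  rewrite (integral_periodogram_shift Hshift Hbd mOm Omoo Horth)// -EFinM lee_fin.
  by rewrite expr2 mulrA divfK// gt_eqF.
pose k := Num.truncn del^-1.
exists ((3 ^ d)%:R ^+ k * (2 * m)) => [|s As x].
  by rewrite mulr_ge0 ?exprn_ge0// mulr_ge0// ltW.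
apply: le_trans (measure_ball_growth (mu := periodogram_meas s) del0 _ (B s As) k x); last first.
  by rewrite mulr_ge0// ltW.
apply: (@measure_mono _ Bd R (periodogram_meas s)); [exact: measurable_ball_borel|exact: measurable_ball_borel|].
apply: le_ball; rewrite mulrC -ler_pdivrMr// mul1r.
apply: (@le_trans _ _ k.+1%:R); first by rewrite ltW// truncnS_gt.
by rewrite -natrX ler_nat ltn_expl.
Qed.

Definition folner_bound (eta : R) (s : seq Rd) := forall v : Rd, `|v| <= 1 ->
  (m ^+ 2 - eta) * (size s)%:R <= \sum_(l <- s) \sum_(l' <- s) spec mu Om (l + v - l').

(** Far away, [f >= c] turns the concentration of [f nu_s] into a bound on [nu_s]. Near the origin,
    [f <= m] turns the remaining mass [m^2 - K eta] of [f nu_s] into a mass of at least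
    [m - K eta / m]. *)
Lemma periodogram_meas_far (r : R) : 0 < r -> exists2 K : R, 0 <= K & forall s eta,
  admissible s -> folner_bound eta s ->
  (forall (A : set Rd) c, borel_set A -> 0 < c ->
     (forall x, A x -> c <= f x /\ r <= `|x|) -> (periodogram_meas s A <= (K * eta / c)%:E)%E) /\
  ((m - K * eta / m)%:E <= periodogram_meas s (ball (0%R : Rd) r))%E.
Proof.
move=> r0; have [K K0 H] := periodogram_concentration Hshift Hbd mOm Omoo Ombd Horth Hcont r0.
exists K => // s eta As Fs; have [us sL s0] := As.
have {}H := H s eta us sL s0 Fs.
have mr : borel_set [set x : Rd | (r <= `|x|)%R].
  apply: measurable_closed; rewrite (_ : [set _ | _] = (fun x : Rd => `|x|) @^-1` [set y | r <= y])//.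
  by apply: closed_comp; [move=> x _; exact: norm_continuous|exact: closed_ge].
have mb : measurable (ball (0 : Rd) r : set Bd) by exact: measurable_ball_borel.
split=> [A c mA c0 HA|].
  rewrite EFinM lee_pdivlMr// muleC.
  apply: (le_trans (periodogram_meas_lower s mA (ltW c0) _)); first by move=> x /HA[].
  apply: le_trans H; apply: ge0_subset_integral => //; first exact: measurable_funTS.
  by move=> x /HA[].
have U : ball (0 : Rd) r `|` [set x : Rd | r <= `|x|] = setT.
  apply/seteqP; split=> // x _; have [xr|rx] := ltP `|x| r; last by right.
  by left; apply/ball_norm; rewrite sub0r normrN.
have := total As; rewrite -U ge0_integral_setU//; last 2 first.
- by rewrite U.
- rewrite disj_set2E; apply/eqP/seteqP; split=> // x [] /ball_norm.
  by rewrite sub0r normrN /= ltNge => /negP.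
move=> I12; have E : ((m ^+ 2)%:E <= m%:E * periodogram_meas s (ball (0%R : Rd) r) + (K * eta)%:E)%E.
  by rewrite -I12; apply: leeD => //; exact: periodogram_meas_upper.
have N0 : (0 <= periodogram_meas s (ball (0%R : Rd) r))%E by exact: measure_ge0.
case: (periodogram_meas s _) N0 E => [x _| _ _|//]; last exact: leey.
rewrite -EFinM -EFinD !lee_fin => E.
by rewrite lerBlDr -(ler_pM2l m0) mulrDr [m * (_ / _)]mulrC divfK ?gt_eqF// -expr2.
Qed.

End PeriodogramMeasure.

(** * The vague limit is a point mass where the autocorrelation is positive *)

Section PeriodogramLimit.
Variables (R : realType) (d : nat).
Local Notation Rd := 'rV[R]_d.
Local Notation Bd := (RdBorel R d).
Variable mu : {measure set Bd -> \bar R}.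
Hypothesis Hshift : translation_invariant mu.
Hypothesis Hbd : forall A : set Rd, borel_set A -> bounded_set A -> (mu A < +oo)%E.
Variables (Om Lam : set Rd).
Hypotheses (mOm : borel_set Om) (Omoo : (mu Om < +oo)%E) (Om0 : (0 < mu Om)%E).
Hypothesis Ombd : bounded_set Om.
Hypothesis Horth : orthogonal_exp mu Om Lam.
Hypothesis Hcont : shift_continuous mu Om.
Let m := fine (mu Om).
Let m0 : 0 < m := fine_Om_gt0 Omoo Om0.
Local Notation f := (rautocorr mu Om).

Variable s : nat -> seq Rd.
Hypothesis Hs : forall n, admissible Lam (s n).
Hypothesis Hf : forall n, folner_bound mu Om n.+1%:R^-1 (s n).
Variables (F : set_system nat) (FU : UltraFilter F) (C : R) (C0 : 0 <= C).
Hypothesis FF : \oo `<=` F.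
Hypothesis HC : forall n (x : Rd), (periodogram_meas mu (s n) (ball x 1%R) <= C%:E)%E.
Let nu := vague_limit FU C0 HC.
Let PF : ProperFilter F := @ultra_proper _ F FU.

Let cf : continuous (f : Rd -> R).
Proof. exact: rautocorr_continuous. Qed.

Let near_small (K e : R) : 0 <= K -> 0 < e -> \forall n \near F, K * n.+1%:R^-1 <= e.
Proof.
move=> K0 e0; apply: FF.
have e1 : 0 < e / (K + 1) by rewrite divr_gt0// ltr_wpDl.
apply: filterS (near_infty_natSinv_lt (PosNum e1)) => n /= H.
apply: (@le_trans _ _ (K * (e / (K + 1)))); first by apply: ler_wpM2l => //; exact: ltW.
by rewrite mulrCA -[leRHS]mulr1 ler_pM2l// ler_pdivrMr ?ltr_wpDl// mul1r lerDl.
Qed.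

Let open_superlevel c : open [set x : Rd | c < f x].
Proof.
rewrite (_ : [set _ | _] = (f : Rd -> R) @^-1` [set y | c < y])//.
by apply: open_comp; [move=> x _; exact: cf|exact: open_gt].
Qed.

Let open_far (r : R) : open [set x : Rd | r < `|x|].
Proof.
rewrite (_ : [set _ | _] = (fun x : Rd => `|x|) @^-1` [set y | r < y])//.
by apply: open_comp; [move=> x _; exact: norm_continuous|exact: open_gt].
Qed.

(** On this open set the masses along the sequence are at most [K / (c (n + 1))], which tends to
    zero along [F]. *)
Let limit_far c r : 0 < c -> 0 < r -> nu [set x : Rd | c < f x /\ r < `|x|] = 0%E.
Proof.
move=> c0 r0; pose E := [set x : Rd | c < f x] `&` [set x : Rd | r < `|x|].
have oE : open E by apply: openI; [exact: open_superlevel|exact: open_far].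
have [K K0 H] := periodogram_meas_far Hshift Hbd mOm Omoo Om0 Ombd Horth Hcont r0.
apply/eqP; rewrite eq_le measure_ge0 andbT; apply/lee_addgt0Pr => e e0; rewrite add0e.
apply: vague_limit_open => //.
have := near_small (divr_ge0 K0 (ltW c0)) e0; apply: filterS => n Hn.
have [H1 _] := H (s n) _ (Hs n) (Hf n).
apply: (le_trans (H1 E c (measurable_open oE) c0 _)).
  by move=> x [/ltW ? /ltW ?].
by rewrite lee_fin mulrAC.
Qed.

Let m1 : borel_set [set (0 : Rd)].
Proof. by apply: measurable_compact; exact: compact_set1. Qed.

(** For [c < m] the open set where [f > c] contains the origin and has mass at most [m ^+ 2 / c]
    along the sequence; [c] is chosen to make this [m + e]. *)
Let limit0_le : (nu [set (0%R : Rd)] <= m%:E)%E.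
Proof.
apply/lee_addgt0Pr => e e0; rewrite -EFinD.
have me0 : 0 < m + e by rewrite addr_gt0.
pose c := m ^+ 2 / (m + e).
have c0 : 0 < c by rewrite divr_gt0// exprn_gt0.
have cm : c < m by rewrite ltr_pdivrMr// expr2 ltr_pM2l// ltrDl.
apply: (@le_trans _ _ (nu [set x : Rd | c < f x])).
  apply: (@measure_mono _ Bd R nu) => //; first by apply: measurable_open; exact: open_superlevel.
  by move=> x ->; rewrite /= rautocorr0.
apply: vague_limit_open; first exact: open_superlevel.
apply: filterE => n.
have -> : m + e = m ^+ 2 / c by rewrite /c invf_div mulrCA divff ?mulr1// gt_eqF// exprn_gt0.
apply: (periodogram_meas_superlevel Hshift Hbd mOm Omoo Horth Hcont _ c0 _ (Hs n)).
  by apply: measurable_open; exact: open_superlevel.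
by move=> x /ltW.
Qed.

Let cball (r : R) : set Rd := [set x : Rd | `|x| <= r].

Let compact_cball r : compact (cball r).
Proof.
apply: bounded_closed_compact.
  exists r; split; first exact: num_real.
  by move=> M rM x xr; exact: le_trans xr (ltW rM).
rewrite (_ : cball r = (fun x : Rd => `|x|) @^-1` [set y | y <= r])//.
by apply: closed_comp; [move=> x _; exact: norm_continuous|exact: closed_le].
Qed.

Let limit_cball (r : R) : 0 < r -> (m%:E <= nu (cball r))%E.
Proof.
move=> r0; apply/lee_addgt0Pr => e e0; rewrite -leeBlDr// -EFinB.
have [K K0 H] := periodogram_meas_far Hshift Hbd mOm Omoo Om0 Ombd Horth Hcont r0.
apply: vague_limit_compact; first exact: compact_cball.
have := near_small (divr_ge0 K0 (ltW m0)) e0; apply: filterS => n Hn.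
have [_ H1] := H (s n) _ (Hs n) (Hf n).
apply: (@le_trans _ _ (m - K * n.+1%:R^-1 / m)%:E).
  by rewrite lee_fin lerD2l lerN2 mulrAC.
apply: (le_trans H1); apply: (@measure_mono _ Bd R (periodogram_meas mu (s n))).
- exact: measurable_ball_borel.
- by apply: measurable_compact; exact: compact_cball.
- by move=> x /ball_norm; rewrite sub0r normrN => /ltW.
Qed.

(** Closed balls are compact and keep the lower bound in the limit. They shrink to the origin with
    finite mass, so continuity from above applies. *)
Let limit0_ge : (m%:E <= nu [set (0%R : Rd)])%E.
Proof.
rewrite leNgt; apply/negP => H.
have E : \bigcap_n cball n.+1%:R^-1 = [set 0].
  apply/seteqP; split=> x; last by move=> -> n _; rewrite /cball/= normr0 invr_ge0.
  move=> Hx; apply/eqP; rewrite -normr_le0; apply/ler_addgt0Pr => e e0; rewrite add0r.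
  have [N _ HN] := near_infty_natSinv_lt (PosNum e0).
  exact: le_trans (Hx N I) (ltW (HN N (leqnn N))).
rewrite -E in H.
have [||||n] := @nonincreasing_measure_lt _ Bd R nu (fun n => cball n.+1%:R^-1) m%:E.
- by apply: vague_limit_lty; [exact: bounded_compact|exact: measurable_compact].
- by move=> n; exact: measurable_compact.
- move=> i j ij; apply/subsetPset => x; rewrite /cball /= => /le_trans; apply.
  by rewrite lef_pV2 ?posrE ?ltr0n// ler_nat.
- exact: H.
by apply/negP; rewrite -leNgt limit_cball// invr_gt0.
Qed.

(** Apart from the origin, [A] is covered by the countably many sets where both [f] and the norm
    exceed [1 / (n + 1)], each null by [limit_far]. *)
Lemma limit_dirac (A : set Rd) : borel_set A -> A `<=` [set x | 0 < f x] ->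
  nu A = (m%:E * (\1_A (0%R : Rd))%:E)%E.
Proof.
move=> mA Af.
have N : nu (A `\` [set (0%R : Rd)]) = 0%E.
  pose E n := [set x : Rd | n.+1%:R^-1 < f x /\ n.+1%:R^-1 < `|x|].
  apply/negligibleP; first exact: measurableD.
  apply: (@negligibleS _ Bd R nu (\bigcup_n E n)).
    move=> x [/Af fx /eqP x0].
    have e0 : 0 < Num.min (f x) `|x| by rewrite lt_min fx normr_gt0.
    have [n _ Hn] := near_infty_natSinv_lt (PosNum e0).
    by have := Hn n (leqnn n); rewrite /= lt_min => /andP[? ?]; exists n.
  apply: negligible_bigcup => n; apply/negligibleP; last exact: limit_far.
  by apply: measurable_open; apply: openI; [exact: open_superlevel|exact: open_far].
have E0 : nu [set (0%R : Rd)] = m%:E by apply/eqP; rewrite eq_le limit0_le limit0_ge.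
rewrite indicE; case: (boolP ((0 : Rd) \in A)) => [/set_mem A0|/negP A0].
  have AE : A = [set (0 : Rd)] `|` A `\` [set (0 : Rd)].
    apply/seteqP; split=> [x Ax|x [->|[]]//].
    by have [->|/eqP x0] := eqVneq (x : Rd) 0; [left|right; split].
  rewrite mule1 {1}AE measureU//.
  - by rewrite -[RHS]adde0; congr (_ + _)%E.
  - exact: measurableD.
  - by apply/seteqP; split=> // x [-> [_ /(_ erefl)]].
rewrite mule0 -N; congr (nu _); apply/seteqP; split=> [x Ax|x []//].
by split=> // x0; apply: A0; rewrite inE -x0.
Qed.

End PeriodogramLimit.

(** * Fourier duality for finite sets and in the limit *)

Section FourierPairing.
Variables (R : realType) (d : nat).
Local Notation Rd := 'rV[R]_d.
Local Notation Bd := (RdBorel R d).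
Variables (mu : {measure set Bd -> \bar R}) (C : R).
Hypothesis C0 : 0 <= C.
Hypothesis Hball : forall x : Rd, (mu (ball x 1) <= C%:E)%E.

Let integrable_trig_sum (u : Rd -> R) (r : seq Rd) : schwartz u ->
  mu.-integrable setT (fun x : Bd => (\sum_(t <- r) u x * cos (2 * pi * dotv t x))%:E).
Proof.
move=> su; rewrite (_ : (fun x : Bd => _) =
    (fun x : Bd => \sum_(t <- r) (u x * cos (2 * pi * dotv t x))%:E)%E); last first.
  by apply/funext => x; rewrite sumEFin.
by apply: integrable_sum => // t _; exact: (integrable_mul_cos C0 Hball).
Qed.

Lemma Rintegral_mul_periodogram (u : Rd -> R) (s : seq Rd) : schwartz u ->
  Rintegral mu setT (fun x => u x * periodogram s x) =
  (size s)%:R^-1 * \sum_(l <- s) \sum_(l' <- s) ftcos mu u (l - l').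
Proof.
move=> su.
have E x : u x * periodogram s x =
    (size s)%:R^-1 * \sum_(t <- differences s) u x * cos (2 * pi * dotv t x).
  rewrite periodogramE mulrCA; congr (_ * _); rewrite big_allpairs_dep/= mulr_sumr.
  by apply: eq_bigr => l _; rewrite mulr_sumr.
under eq_Rintegral do rewrite E.
rewrite RintegralZl//; last exact: integrable_trig_sum.
congr (_ * _); rewrite -[RHS]big_allpairs_dep/= -/(differences s).
elim: (differences s) => [|t r IH].
  under eq_Rintegral do rewrite big_nil.
  by rewrite big_nil /Rintegral integral0.
under eq_Rintegral do rewrite big_cons.
rewrite big_cons -IH RintegralD//; last exact: integrable_trig_sum.
exact: (integrable_mul_cos C0 Hball).
Qed.

(** [ftsin] is odd and the differences come in opposite pairs. A multiple of the sine transform may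
    therefore be added in the pairing with [diff_meas]. *)
Lemma sum_ftsin_diff (u : Rd -> R) (s : seq Rd) : schwartz u ->
  \sum_(l <- s) \sum_(l' <- s) ftsin mu u (l - l') = 0.
Proof.
move=> su; have N t : ftsin mu u (- t) = - ftsin mu u t.
  rewrite /ftsin -[RHS]mulN1r -RintegralZl//; last exact: (integrable_mul_sin C0 Hball).
  by apply: eq_Rintegral => x _; rewrite dotvNl mulrN sinN mulrN mulN1r.
set S := LHS; suff : S = - S by lra.
rewrite {1}/S exchange_big/= /S -sumrN; apply: eq_bigr => l _; rewrite -sumrN; apply: eq_bigr => l' _.
by rewrite -N opprB.
Qed.

Hypothesis Hshift : translation_invariant mu.
Local Notation p := d.*2.+1.

(** For each [n] the identity is exact, and both sides converge along the same ultrafilter. The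
    choice [c = 1] gives the real part of the transform of [u + i v]; [c = -1] with [u] and [v]
    exchanged gives the imaginary part. *)
Lemma pairing_limit (F : set_system nat) (FU : UltraFilter F) (s : nat -> seq Rd) (C1 C2 : R)
  (C10 : 0 <= C1) (C20 : 0 <= C2)
  (H1 : forall n (x : Rd), (periodogram_meas mu (s n) (ball x 1%R) <= C1%:E)%E)
  (H2 : forall n (x : Rd), (diff_meas (s n) (ball x 1%R) <= C2%:E)%E) (u v : Rd -> R) (c : R) :
  schwartz u -> schwartz v ->
  Rintegral (vague_limit FU C10 H1) setT (u : Bd -> R) =
  Rintegral (vague_limit FU C20 H2) setT ((fun t => ftcos mu u t + c * ftsin mu v t) : Bd -> R).
Proof.
move=> su sv; have PF : ProperFilter F := @ultra_proper _ F FU.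
have cfu := ftcos_continuous C0 Hball su; have cfv := ftsin_continuous C0 Hball sv.
have cg : continuous (fun t => ftcos mu u t + c * ftsin mu v t).
  by apply: continuousD_rV => //; exact: continuous_cstM_rV.
have [A A0 uA] := schwartz_decay (p + p) su.
have [A1 A10 H3] := ft_decay C0 Hball Hshift (p + p) su.
have [A2 A20 H4] := ft_decay C0 Hball Hshift (p + p) sv.
have L1 := vague_cvg (FU := FU) (C0 := C10) (Hmu := H1) (schwartz_continuous su) A0 uA.
have B0 : 0 <= A1 + `|c| * A2 by rewrite addr_ge0// mulr_ge0.
have L2 := vague_cvg (FU := FU) (C0 := C20) (Hmu := H2) cg B0.
have E n : Rintegral (periodogram_meas mu (s n)) setT u =
    Rintegral (diff_meas (s n)) setT ((fun t => ftcos mu u t + c * ftsin mu v t) : Bd -> R).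
  rewrite Rintegral_periodogram_meas; last by apply: continuous_measurable; exact: schwartz_continuous.
  rewrite Rintegral_mul_periodogram// Rintegral_diff_meas; last exact: continuous_measurable.
  congr (_ * _).
  transitivity (\sum_(l <- s n) \sum_(l' <- s n) ftcos mu u (l - l') +
                c * \sum_(l <- s n) \sum_(l' <- s n) ftsin mu v (l - l')).
    by rewrite sum_ftsin_diff// mulr0 addr0.
  rewrite mulr_sumr -big_split; apply: eq_bigr => l _.
  by rewrite mulr_sumr -big_split.
rewrite (_ : (fun n => _) = (fun n =>
  Rintegral (diff_meas (s n)) setT ((fun t => ftcos mu u t + c * ftsin mu v t) : Bd -> R))) in L1; last first.
  exact/funext.
apply: (cvg_unique (@norm_hausdorff _ R) L1); apply: L2 => t.
apply: (le_trans (ler_normD _ _)); rewrite mulrDl; apply: lerD; first exact: (H3 t).1.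
by rewrite normrM -mulrA; apply: ler_wpM2l => //; exact: (H4 t).2.
Qed.

End FourierPairing.

(** * Support and local form of the limit of the difference measures *)

Section DifferenceLimit.
Variables (R : realType) (d : nat).
Local Notation Rd := 'rV[R]_d.
Local Notation Bd := (RdBorel R d).
Variables (F : set_system nat) (FU : UltraFilter F) (s : nat -> seq Rd) (C : R) (C0 : 0 <= C).
Hypothesis HC : forall n (x : Rd), (diff_meas (s n) (ball x 1%R) <= C%:E)%E.
Let gam := vague_limit FU C0 HC.
Let PF : ProperFilter F := @ultra_proper _ F FU.

Lemma diff_limit_notin (U : set Rd) : open U ->
  (forall n l l', l \in s n -> l' \in s n -> ~ U (l - l')) -> gam U = 0%E.
Proof.
move=> oU H; apply/eqP; rewrite eq_le measure_ge0 andbT.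
apply: vague_limit_open => //; apply: filterE => n.
by rewrite diff_meas_notin//; [exact: measurable_open|exact: H].
Qed.

(** The ball has mass at most one and the origin alone at least one, so nothing is left for a subset
    of the ball that avoids the origin. *)
Lemma diff_limit_dirac (del : R) : (forall n, separated del (s n)) -> (forall n, uniq (s n)) ->
  (forall n, (0 < size (s n))%N) -> 0 < del -> eq_dirac_on gam 1%E (ball (0 : Rd) del).
Proof.
move=> sep us s0 del0 A mA AU; rewrite mul1e.
have mU : measurable (ball (0 : Rd) del : set Bd) by exact: measurable_ball_borel.
have U1 : (gam (ball (0%R : Rd) del) <= 1%:E)%E.
  apply: vague_limit_open; first exact: ball_open.
  by apply: filterE => n; apply: diff_meas_near0 (sep n) _ _ _ _.
have m1 : borel_set [set (0 : Rd)].
  by apply: measurable_compact; exact: compact_set1.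
have G1 : (1%:E <= gam [set (0%R : Rd)])%E.
  apply: vague_limit_compact; first exact: compact_set1.
  by apply: filterE => n; exact: diff_meas_set0.
rewrite indicE; case: (boolP ((0 : Rd) \in A)) => [/set_mem A0|/negP A0].
  apply/eqP; rewrite eq_le; apply/andP; split.
    by apply: le_trans U1; exact: (@measure_mono _ Bd R gam).
  by apply: (le_trans G1); apply: (@measure_mono _ Bd R gam) => // x ->.
apply/eqP; rewrite eq_le measure_ge0 andbT leNgt; apply/negP => A1.
have : (gam (A `|` [set (0%R : Rd)]) <= 1%:E)%E.
  apply: le_trans U1; apply: (@measure_mono _ Bd R gam) => //; first exact: measurableU.
  by move=> x [/AU//|->]; exact: ballxx.
rewrite measureU//; last first.
  by apply/seteqP; split=> // x [Ax x0]; apply: A0; rewrite inE -x0.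
move=> H; have Aoo : (gam A <= 1%:E)%E.
  by apply: le_trans U1; exact: (@measure_mono _ Bd R gam).
have := le_trans (leeD (lexx (gam A)) G1) H.
by move: A1 Aoo; case: (gam A) => [x| |]//; rewrite -EFinD !lee_fin lte_fin => x0 _ ?; have {}x0 : 0 < x := x0; lra.
Qed.

End DifferenceLimit.

(** * Transfer between [Om] and its Borel hull *)

Section Transfer.
Variables (R : realType) (d : nat).
Local Notation Rd := 'rV[R]_d.
Local Notation Bd := (RdBorel R d).
Variable leb : {measure set RdLeb R d -> \bar R}.
Hypothesis Hleb : is_lebesgue leb.
Local Notation mu := (lebB leb : {measure set Bd -> \bar R}).

Lemma lebB_ball1 (x : Rd) : (mu (ball x 1%R) <= (2 ^+ d)%:E)%E.
Proof.
apply: (@le_trans _ _ (mu (box (x - const_mx 1) (x + const_mx 1)))).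
  apply: (@measure_mono _ Bd R mu); [exact: measurable_ball_borel|exact: measurable_box|].
  move=> y /ball_norm xy i; have := le_lt_trans (le_coord_norm (x - y) i) xy.
  by rewrite !mxE ltr_norml => /andP[? ?]; apply/andP; split; lra.
apply: le_trans (lebB_box_le Hleb _ _) _; rewrite lee_fin /vol.
rewrite (eq_bigr (fun=> 2)) => [|i _]; first by rewrite prodr_const card_ord.
by rewrite !mxE max_l; lra.
Qed.

Lemma leb_bounded_lty (Om : set Rd) : measurable (Om : set (RdLeb R d)) -> bounded_set Om -> (leb Om < +oo)%E.
Proof.
move=> mOm /bounded_set_box[M [_ H]].
apply: le_lt_trans (@measure_mono _ (RdLeb R d) R leb _ _ mOm _ H) _.
  by apply: borel_leb; exact: measurable_box.
exact: le_lt_trans (lebB_box_le Hleb _ _) (ltry _).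
Qed.

Lemma measurable_borel_leb (f : Rd -> R) : measurable_fun setT (f : Bd -> R) ->
  measurable_fun setT (f : RdLeb R d -> R).
Proof. by move=> mf _ Y mY; apply: borel_leb; exact: mf. Qed.

Lemma ft_reE (u v : Rd -> R) t : schwartz u -> schwartz v ->
  ft_re leb u v t = ftcos mu u t + 1 * ftsin mu v t.
Proof.
move=> su sv; have C0 : 0 <= 2 ^+ d :> R by rewrite exprn_ge0.
rewrite mul1r -RintegralD//; last 2 first.
- exact: (integrable_mul_cos C0 lebB_ball1).
- exact: (integrable_mul_sin C0 lebB_ball1).
congr fine; apply: integral_lebB => //; apply/(@measurable_EFinP _ Bd).
apply: measurable_funD; apply: measurable_funM; apply: continuous_measurable;
  by [exact: schwartz_continuous|exact: cos_dotv_continuous|exact: sin_dotv_continuous].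
Qed.

Lemma ft_imE (u v : Rd -> R) t : schwartz u -> schwartz v ->
  ft_im leb u v t = ftcos mu v t + -1 * ftsin mu u t.
Proof.
move=> su sv; have C0 : 0 <= 2 ^+ d :> R by rewrite exprn_ge0.
rewrite mulN1r -RintegralB//; last 2 first.
- exact: (integrable_mul_cos C0 lebB_ball1).
- exact: (integrable_mul_sin C0 lebB_ball1).
congr fine; apply: integral_lebB => //; apply/(@measurable_EFinP _ Bd).
apply: measurable_funB; apply: measurable_funM; apply: continuous_measurable;
  by [exact: schwartz_continuous|exact: cos_dotv_continuous|exact: sin_dotv_continuous].
Qed.

Lemma measurable_eball (x : Rd) (r : R) : measurable (eball x r : set Bd).
Proof.
have mg : measurable_fun setT ((fun y : Rd => \sum_(i < d) (y 0 i - x 0 i) * (y 0 i - x 0 i)) : Bd -> R).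
  apply: (@measurable_sum _ Bd R setT 'I_d _ (fun (i : 'I_d) (y : Rd) => (y 0 i - x 0 i) * (y 0 i - x 0 i))) => i.
  by apply: measurable_funM; apply: measurable_funB => //; exact: measurable_coord.
have := mg measurableT _ (measurable_itv `]-oo, (r ^+ 2)[); rewrite setTI.
rewrite (_ : _ @^-1` _ = eball x r)//; apply/seteqP; split=> y; rewrite /eball /normsq /dotv /= in_itv/=.
  by under [X in _ -> X < _]eq_bigr do rewrite !mxE.
by under [X in X < _ -> _]eq_bigr do rewrite !mxE.
Qed.

(** The Euclidean unit ball lies inside the sup-norm unit ball. *)
Lemma translation_bounded_ball (nu : {measure set Bd -> \bar R}) (C : R) :
  (forall x : Rd, (nu (ball x 1%R) <= C%:E)%E) -> translation_bounded nu.
Proof.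
move=> H; exists C => x; apply: le_trans (H x); apply: (@measure_mono _ Bd R nu).
- exact: measurable_eball.
- exact: measurable_ball_borel.
- move=> y; rewrite /eball/= expr1n => yx; apply/ball_norm; rewrite -normrN opprB.
  have := le_lt_trans (norm_le_normsq (y - x)) yx.
  by rewrite -[X in _ < X](expr1n _ 2) ltr_pXn2r ?nnegrE.
Qed.

Variables (Om B : set Rd).
Hypotheses (mOm : measurable (Om : set (RdLeb R d))) (mB : borel_set B).
Hypotheses (OB : Om `<=` B) (B0 : leb (B `\` Om) = 0%E) (Omoo : (leb Om < +oo)%E).

Lemma hull_measure : mu B = leb Om.
Proof.
rewrite [LHS](_ : _ = leb B)// -[B in leb B](setDUK OB) measureU//.
- by rewrite [X in (_ + X)%E]B0 adde0.
- by apply: measurableD => //; exact: borel_leb.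
- by rewrite setDIK.
Qed.

Lemma icos_hull t : Rintegral leb Om (fun x : RdLeb R d => cos (2 * pi * dotv t x)) = icos mu B t.
Proof.
congr fine; apply: integral_hull => //; apply/(@measurable_EFinP _ Bd).
by have [] := bdd_meas_cos t.
Qed.

Lemma isin_hull t : Rintegral leb Om (fun x : RdLeb R d => sin (2 * pi * dotv t x)) = isin mu B t.
Proof.
congr fine; apply: integral_hull => //; apply/(@measurable_EFinP _ Bd).
by have [] := bdd_meas_sin t.
Qed.

(** Completeness is applied to the exponentials [e_t], for arbitrary [t], which lie in [L^2(Om)]
    since [Om] has finite measure; the null difference leaves the distance unchanged. *)
Lemma complete_hull (Lam : set Rd) : orthogonal_basis_exp leb Om Lam ->
  forall (t : Rd) (eps : R), 0 < eps -> exists s : seq (Rd * (R * R)),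
  (forall c, c \in s -> Lam c.1) /\
  (\int[mu]_(x in B) ((cos (2 * pi * dotv t x) - lincomb_re s x) ^+ 2 +
     (sin (2 * pi * dotv t x) - lincomb_im s x) ^+ 2)%:E < (eps ^+ 2)%:E)%E.
Proof.
move=> [_ H] t eps eps0.
have [mc _] := bdd_meas_cos t; have [ms _] := bdd_meas_sin t.
have L : L2 leb Om (fun x => cos (2 * pi * dotv t x)) (fun x => sin (2 * pi * dotv t x)).
  split; first by apply: measurable_funTS; exact: measurable_borel_leb.
  split; first by apply: measurable_funTS; exact: measurable_borel_leb.
  under eq_integral do rewrite cos2Dsin2.
  by rewrite integral_cst// mul1e.
have [s [sL Hs]] := H _ _ L _ eps0; exists s; split=> //.
rewrite -(integral_hull mOm mB OB B0)//; apply/(@measurable_EFinP _ Bd).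
have bc c x : bdd_meas (fun y : Rd => c * cos (2 * pi * dotv x y)).
  by apply: bdd_measM; [exact: bdd_meas_cst|exact: bdd_meas_cos].
have bs c x : bdd_meas (fun y : Rd => c * sin (2 * pi * dotv x y)).
  by apply: bdd_measM; [exact: bdd_meas_cst|exact: bdd_meas_sin].
have [m1 _] : bdd_meas (lincomb_re s) by apply: bdd_meas_sum => c; exact: bdd_measB.
have [m2 _] : bdd_meas (lincomb_im s) by apply: bdd_meas_sum => c; exact: bdd_measD.
by apply: measurable_funD; apply: measurable_funX; exact: measurable_funB.
Qed.

(** Overlaps can only grow from [Om] to the hull [B], so the autocorrelation of [B] is positive
    wherever (e) makes a claim. *)
Lemma Deltaset_autocorr : Deltaset leb Om `<=` [set x | 0 < rautocorr mu B x].
Proof.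
move=> x; rewrite /Deltaset/= => H.
have Boo : (mu B < +oo)%E by rewrite hull_measure.
rewrite -lte_fin rautocorrE//; apply: (lt_le_trans H).
have IE (A : set Rd) : [set (y + x)%R | y in A] = [set y : Rd | A (y - x)%R].
  apply/seteqP; split=> y /=; first by move=> [z Az <-]; rewrite addrK.
  by move=> Ayx; exists (y - x) => //; rewrite subrK.
rewrite IE; pose E : set Rd := B `&` [set y : Rd | B (y - x)%R].
have mE : borel_set E by apply: measurableI => //; exact: measurable_shift_set.
have -> : autocorr mu B x = mu E.
  rewrite -[RHS](lebB_shift Hleb x mE) /autocorr; congr (mu _).
  by apply/seteqP; split=> y; rewrite /E/= addrK => -[].
apply: (@measure_mono _ (RdLeb R d) R leb).
- apply: measurableI => //; have := measurable_shift_leb (- x) measurableT mOm; by rewrite setTI.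
- exact: borel_leb.
- by move=> y [/OB ? /OB ?].
Qed.

End Transfer.

(** * Both vague limits along one ultrafilter *)

Unset Implicit Arguments.

Theorem theorem3p1 (R : realType) (d : nat)
    (leb : {measure set RdLeb R d -> \bar R}) (Hleb : is_lebesgue leb)
    (Om : set (RdLeb R d)) (Om_meas : measurable Om) (Om_bd : bounded_set Om)
    (Om_pos : (0 < leb Om)%E) (Om_spec : spectral leb Om) :
  exists gam : {measure set RdBorel R d -> \bar R},
    (* (a) *) translation_bounded gam /\
    (* (b) *) msupport gam `<=` Zset leb Om `|` [set 0] /\
    (* (c) *) (exists U : set 'rV[R]_d, open U /\ U 0 /\ eq_dirac_on gam 1%E U) /\
    (exists nu : {measure set RdBorel R d -> \bar R},
      (* (d) *) is_fourier_of leb gam nu /\ translation_bounded nu /\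
      (* (e) *) eq_dirac_on nu (leb Om) (Deltaset leb Om)).

Proof.
pose mu : {measure set RdBorel R d -> \bar R} := lebB leb.
have Omoo := leb_bounded_lty Hleb Om_meas Om_bd.
have [B [mB OB bB B0]] := borel_hull Hleb Om_meas Omoo Om_bd.
have muB : mu B = leb Om := hull_measure Om_meas mB OB B0.
have Boo : (mu B < +oo)%E by rewrite muB.
have Bpos : (0 < mu B)%E by rewrite muB.
have Hshift (A : set 'rV[R]_d) (x : 'rV[R]_d) : borel_set A ->
  mu [set y : 'rV[R]_d | A (y + x)%R] = mu A := lebB_shift Hleb x.
have Hbd (A : set 'rV[R]_d) : borel_set A -> bounded_set A -> (mu A < +oo)%E.
  exact: lebB_bounded.
have Hcont e (e0 : 0 < e) := shift_continuity Hleb mB bB e0.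
have [Lam [_ HLam]] := Om_spec.
have Hcompl := complete_hull Om_meas mB OB B0 Omoo HLam.
have Horth l l' : Lam l -> Lam l' -> l <> l' -> icos mu B (l - l') = 0 /\ isin mu B (l - l') = 0.
  move=> Ll Ll' /(HLam.1 _ _ Ll Ll').
  by rewrite (icos_hull Om_meas mB OB B0) (isin_hull Om_meas mB OB B0).
have /choice[s Hs] n : exists s, admissible Lam s /\ folner_bound mu B n.+1%:R^-1 s.
  have n0 : 0 < n.+1%:R^-1 :> R by rewrite invr_gt0.
  have [s [us sL s0 H]] := folner Hshift mB Boo Bpos bB Horth Hcompl Hcont n0.
  by exists s.
have As n : admissible Lam (s n) := (Hs n).1.
have Fs n : folner_bound mu B n.+1%:R^-1 (s n) := (Hs n).2.
(* [F] refines the filter of eventual sets, which forces the tolerances [1 / (n + 1)] to zero along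
   it. *)
have [F [FU FF]] := ultraFilterLemma eventually_filter.
have [C1 C10 HC1] := periodogram_meas_ball Hshift Hbd mB Boo Bpos Horth Hcont.
have H1 n := HC1 (s n) (As n).
have [del del0 sep] := spectrum_separated mB Boo Bpos bB Horth.
have sepn n : separated del (s n).
  by have [_ sL _] := As n; move=> x y /sL Lx /sL Ly; exact: sep.
(* Enough doublings to bring the radius [del / 2] to at least one. *)
pose k := Num.truncn (2 / del).
pose C2 : R := ((3 ^ d) ^ k)%N%:R.
have C20 : 0 <= C2 by rewrite ler0n.
have H2 n (x : 'rV[R]_d) : (diff_meas (s n) (ball x 1%R) <= C2%:E)%E.
  have [us _ s0] := As n; apply: (diff_meas_ball x (sepn n)) => //.
  rewrite mulrC -ler_pdivrMr ?divr_gt0// mul1r invf_div.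
  apply: (@le_trans _ _ k.+1%:R); first by rewrite ltW// truncnS_gt.
  by rewrite -natrX ler_nat ltn_expl.
pose gam := vague_limit FU C20 H2; pose nu := vague_limit FU C10 H1.
exists gam; split; first by apply: (translation_bounded_ball (C := C2)); exact: vague_limit_ball.
split.
  move=> x gx; apply: contrapT => /not_orP[nZ x0].
  (* A neighbourhood of a supposed support point outside [Zset] and the origin. It is open by
     continuity of [spec] and contains no difference of two points of [s n], since such a difference
     is zero or a zero of [spec]. *)
  pose U : set 'rV[R]_d := [set t | 0 < `|t|] `&` [set t | 0 < spec mu B t].
  have oU : open U.
    apply: openI.
      rewrite (_ : [set _ | _] = (fun x : 'rV[R]_d => `|x|) @^-1` [set y | 0 < y])//.
      by apply: open_comp; [move=> y _; exact: norm_continuous|exact: open_gt].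
    rewrite (_ : [set _ | _] = spec mu B @^-1` [set y | 0 < y])//.
    by apply: open_comp; [move=> y _; exact: spec_continuous|exact: open_gt].
  have : (0 < gam U)%E.
    apply: gx => //; split; first by rewrite /= normr_gt0; apply/eqP.
    rewrite /= lt_def spec_ge0 andbT; apply/eqP => /eqP.
    rewrite paddr_eq0 ?sqr_ge0// !sqrf_eq0 => /andP[/eqP ic /eqP si]; apply: nZ.
    by rewrite /Zset /ft_ind_re /ft_ind_im /= (icos_hull Om_meas mB OB B0) (isin_hull Om_meas mB OB B0) ic si oppr0.
  rewrite /gam diff_limit_notin ?ltxx//.
  move=> n l l' ls l's [/= ll'0]; have [_ sL _] := As n.
  rewrite (spec_orth Horth (sL _ ls) (sL _ l's)) ?ltxx// => ll'.
  by move: ll'0; rewrite ll' subrr normr0 ltxx.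
split.
  exists (ball 0 del); split; first exact: ball_open.
  split; first exact: ballxx.
  by apply: diff_limit_dirac => // n; have [us _ s0] := As n.
exists nu; split; last split.
- move=> u v su sv; have C0 : 0 <= 2 ^+ d :> R by rewrite exprn_ge0.
  have P := pairing_limit C0 (lebB_ball1 Hleb) Hshift FU C10 C20 H1 H2.
  split.
    rewrite (P u v 1)//; congr Rintegral; apply/funext => t; exact/esym/ft_reE.
  rewrite (P v u (-1))//; congr Rintegral; apply/funext => t; exact/esym/ft_imE.
- by apply: (translation_bounded_ball (C := C1)); exact: vague_limit_ball.
- move=> A mA AD; rewrite -muB -[mu B]fineK ?ge0_fin_numE//.
  apply: (limit_dirac Hshift Hbd mB Boo Bpos bB Horth Hcont As Fs) => //.
  exact: subset_trans AD (Deltaset_autocorr Hleb Om_meas mB OB B0 Omoo).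
Qed.
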